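(* Let $\mathcal G=(V,E,T,\alpha,\beta)$ be a temporal graph, let $c\colon E\to\mathbb N$ be a cost function, let $\delta_1,\ldots,\delta_7\in\mathbb Q_{\ge 0}$, and let $s\in V$ be a source vertex. Then, with respect to the linear combination $\mathrm{val}$ of the optimality criteria given by $\delta_1,\ldots,\delta_7$ (defined in the context), an optimal temporal walk from $s$ to each vertex $z\in V$ (for every $z$ for which a temporal walk from $s$ to $z$ exists) can be computed in $O(|V|+|E|\log|E|)$ time.
   Context: For integers $a\le b$, $[a,b]=\{n\in\mathbb N: a\le n\le b\}$ and $[a]=[1,a]$. A temporal graph $\mathcal G=(V,E,T,\alpha,\beta)$ consists of a lifetime $T\in\mathbb N$, a finite vertex set $V$, a time-arc set $E\subseteq V\times V\times\{1,\ldots,T\}\times\{0,\ldots,T\}$, a minimum waiting time $\alpha\colon V\to\{0,\ldots,T\}$ and a maximum waiting time $\beta\colon V\to\{0,\ldots,T\}$. A time-arc $(v,w,t,\lambda)\in E$ is a directed connection from $v$ to $w$ with time stamp $t$ (departure time from $v$) and transmission time $\lambda$ (arrival time $t+\lambda$ at $w$). Given $s,z\in V$, a temporal walk from $s$ to $z$ is a sequence $P=((v_{i-1},v_i,t_i,\lambda_i))_{i=1}^k$ of time-arcs in $E$ with $v_0=s$, $v_k=z$, and $t_i+\lambda_i+\alpha(v_i)\le t_{i+1}\le t_i+\lambda_i+\beta(v_i)$ for all $i\in[k-1]$ (vertices may repeat). For a cost function $c\colon E\to\mathbb N$ and $\delta_1,\ldots,\delta_7\in\mathbb Q_{\ge0}$,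 the value of such a walk is $$\mathrm{val}(P)=\delta_1(t_k+\lambda_k)+\delta_2(-t_1)+\delta_3(t_k+\lambda_k-t_1)+\delta_4\sum_{i=1}^k\lambda_i+\delta_5\sum_{i=1}^k c((v_{i-1},v_i,t_i,\lambda_i))+\delta_6\, k+\delta_7\sum_{i=1}^{k-1}\bigl(t_{i+1}-(t_i+\lambda_i)\bigr),$$ (the terms correspond to the criteria foremost, reverse-foremost, fastest, shortest, cheapest, minimum hop-count and minimum waiting time). A temporal walk from $s$ to $z$ is optimal with respect to this linear combination if it minimizes $\mathrm{val}(P)$ among all temporal walks from $s$ to $z$. *)

(* Defs.v *)
From mathcomp Require Import all_boot all_order all_algebra.

Set Implicit Arguments.
Unset Strict Implicit.
Unset Printing Implicit Defensive.

Import Order.TTheory GRing.Theory Num.Theory.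

(** * Temporal graphs, walks and their values *)

Record temporal_graph := TemporalGraph {
  vertex : finType;
  lifetime : nat;
  (* (v, w, t, lambda); the condition t >= 1 is [arcs_gt0] *)
  arcs : {set vertex * vertex * 'I_lifetime.+1 * 'I_lifetime.+1};
  minwait : vertex -> 'I_lifetime.+1;
  maxwait : vertex -> 'I_lifetime.+1;
  arcs_gt0 : forall e, e \in arcs -> 0 < e.1.2
}.

Definition time_arc (G : temporal_graph) : finType :=
  (vertex G * vertex G * 'I_(lifetime G).+1 * 'I_(lifetime G).+1)%type.

Section Walks.
Variable G : temporal_graph.
Implicit Types (e f : time_arc G) (s z : vertex G) (P : seq (time_arc G)).

Definition asrc e : vertex G := e.1.1.1.
Definition adst e : vertex G := e.1.1.2.
Definition dep e : nat := e.1.2.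
Definition dur e : nat := e.2.
Definition arr e : nat := dep e + dur e.

Definition link e f : bool :=
  [&& adst e == asrc f,
      arr e + minwait (adst e) <= dep f
    & dep f <= arr e + maxwait (adst e)].

(* Walks have at least one time-arc: t_1 and t_k occur in the value. *)
Definition temporal_walk s z P : bool :=
  if P is e :: p then
    [&& all [in arcs G] P, asrc e == s, adst (last e p) == z & path link e p]
  else false.

Local Open Scope ring_scope.

(* [d`_i] is the coefficient delta_(i+1). *)
Definition walk_value (c : time_arc G -> nat) (d : 7.-tuple rat) P : rat :=
  if P is e :: p then
    let t1 := (dep e)%:R in
    let tk := (arr (last e p))%:R in
      d`_0 * tk
    + d`_1 * (- t1)
    + d`_2 * (tk - t1)
    + d`_3 * (\sum_(f <- P) (dur f)%:R)
    + d`_4 * (\sum_(f <- P) (c f)%:R)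
    + d`_5 * (size P)%:R
    + d`_6 * (\sum_(i < size p)
                ((dep (nth e P i.+1))%:R - (arr (nth e P i))%:R))
  else 0.

Definition optimal_walk (c : time_arc G -> nat) (d : 7.-tuple rat) s z P : Prop :=
  temporal_walk s z P /\
  forall Q, temporal_walk s z Q -> walk_value c d P <= walk_value c d Q.

End Walks.

(** * A word RAM with structured control flow

    A program uses finitely many integer registers and an integer memory with
    indirect addressing.  Every constant, register or memory access, arithmetic
    operation, comparison, assignment and branch costs one time unit.  All
    values computed must lie in [-B, B], where B stands for the word size
    (O(log B) bits); a computation leaving this range is stuck, i.e., [exec]
    does not hold. *)

Inductive binop := OAdd | OSub | OMul | ODiv | OLe.

Inductive expr :=
  | Cst of int
  | Reg of nat
  | Read of expr
  | Bin of binop & expr & expr.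

Inductive cmd :=
  | Skip
  | Assign of nat & expr
  | Write of expr & expr
  | Seq of cmd & cmd
  | If of expr & cmd & cmd
  | While of expr & cmd.

Record state := State { regs : nat -> int; memory : int -> int }.

Section Machine.
Local Open Scope ring_scope.

Definition set_reg (st : state) (r : nat) (v : int) : state :=
  State (fun r' => if r' == r then v else regs st r') (memory st).

Definition set_mem (st : state) (a v : int) : state :=
  State (regs st) (fun a' => if a' == a then v else memory st a').

(* [ODiv] is Euclidean division, with value 0 for a zero divisor. *)
Definition eval_binop (o : binop) (x y : int) : int :=
  match o with
  | OAdd => x + y
  | OSub => x - y
  | OMul => x * y
  | ODiv => (x %/ y)%Z
  | OLe => if x <= y then 1 else 0
  end.

Fixpoint eval (st : state) (e : expr) : int :=
  match e with
  | Cst k => k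
  | Reg r => regs st r
  | Read a => memory st (eval st a)
  | Bin o e1 e2 => eval_binop o (eval st e1) (eval st e2)
  end.

Fixpoint cost (e : expr) : nat :=
  match e with
  | Cst _ | Reg _ => 1%N
  | Read a => (cost a).+1
  | Bin _ e1 e2 => (cost e1 + cost e2).+1%N
  end.

Fixpoint fits (B : nat) (st : state) (e : expr) : bool :=
  (absz (eval st e) <= B)%N &&
  match e with
  | Cst _ | Reg _ => true
  | Read a => fits B st a
  | Bin _ e1 e2 => fits B st e1 && fits B st e2
  end.

(* [exec B p st n st']: with words bounded by B, the program p started in st
   halts in st' after n time units. *)
Inductive exec (B : nat) : cmd -> state -> nat -> state -> Prop :=
  | exec_skip st : exec B Skip st 1%N st
  | exec_assign r e st :
      fits B st e ->
      exec B (Assign r e) st (cost e).+1 (set_reg st r (eval st e))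
  | exec_write a e st :
      fits B st a -> fits B st e ->
      exec B (Write a e) st (cost a + cost e).+1%N
        (set_mem st (eval st a) (eval st e))
  | exec_seq p q st1 st2 st3 n m :
      exec B p st1 n st2 -> exec B q st2 m st3 ->
      exec B (Seq p q) st1 (n + m)%N st3
  | exec_if_true e p q st st' n :
      fits B st e -> eval st e != 0 -> exec B p st n st' ->
      exec B (If e p q) st (cost e + n).+1%N st'
  | exec_if_false e p q st st' n :
      fits B st e -> eval st e = 0 -> exec B q st n st' ->
      exec B (If e p q) st (cost e + n).+1%N st'
  | exec_while_true e p st st' st'' n m :
      fits B st e -> eval st e != 0 ->
      exec B p st n st' -> exec B (While e p) st' m st'' ->
      exec B (While e p) st (cost e + n + m).+1%N st''
  | exec_while_false e p st :
      fits B st e -> eval st e = 0 ->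
      exec B (While e p) st (cost e).+1 st.

(* The input occupies the memory cells 0, 1, ..., size w - 1; all other cells
   and all registers are 0. *)
Definition init_state (w : seq nat) : state :=
  State (fun _ => 0) (fun a => if a is Posz i then (nth 0%N w i)%:Z else 0).

(* Words have O(log M) bits, with M the input length plus the largest input
   number. *)
Definition word_bound (K : nat) (w : seq nat) : nat :=
  ((size w + \max_(x <- w) x) ^ K)%N.

(* A null-terminated linked list: cell a holds the head, cell a + 1 the address
   of the tail. *)
Inductive list_at (m : int -> int) : int -> seq nat -> Prop :=
  | list_at_nil : list_at m 0 [::]
  | list_at_cons (a : int) (i : nat) (l : seq nat) :
      a != 0 -> m a = i%:Z -> list_at m (m (a + 1)) l ->
      list_at m a (i :: l).

End Machine.

(** * Input and output conventions *)

Section Encoding.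
Variables (G : temporal_graph) (c : time_arc G -> nat) (d : 7.-tuple rat).
Variables (s : vertex G) (es : seq (time_arc G)).

Definition encode_arc (e : time_arc G) : seq nat :=
  [:: enum_rank (asrc e) : nat; enum_rank (adst e) : nat; dep e; dur e; c e].

(* [es] lists the time-arcs of G in an arbitrary order. *)
Definition encode_input : seq nat :=
  [:: #|vertex G|; lifetime G; size es; enum_rank s : nat]
  ++ flatten [seq [:: absz (numq x); absz (denq x)] | x <- d]
  ++ [seq minwait v : nat | v <- enum (vertex G)]
  ++ [seq maxwait v : nat | v <- enum (vertex G)]
  ++ flatten [seq encode_arc e | e <- es].

(* Register 0 holds the address of a table indexed by the vertices.  The entry
   of z is the address of a linked list giving the positions in [es] of the
   time-arcs of the walk to z, last time-arc first.  Lists of different vertices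
   may share cells: writing all walks out separately can take space of order
   |V| * |E|.  The entry is 0 if there is no walk to z. *)
Definition outputs_optimal_walks (st : state) : Prop :=
  forall z : vertex G,
    let a := memory st (regs st 0 + (enum_rank z : nat)%:Z)%R in
    ((exists P, temporal_walk s z P) ->
       exists P, optimal_walk c d s z P /\
                 list_at (memory st) a [seq index e es | e <- rev P])
    /\ ((forall P, ~~ temporal_walk s z P) -> a = 0%R).

End Encoding.

(* Main.v *)
Require Import Defs.
From mathcomp Require Import all_boot all_order all_algebra.
From mathcomp Require Import zify ring.

(** Let D be the product of the denominators of the delta_i.  Telescoping the
    waiting times gives
      D val(P) = A arr(last arc) - B dep(first arc) + sum of wt over the arcs,
    with integers A, B and wt, where wt e >= 0 if e has transmission time 0.
    Let g e be the least value of - B dep(first) + sum of wt over the walks from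
    s that end with the arc e.  Then g f = wt f + h f, where h f is the minimum
    of g e over all e linked to f, and of - B dep f if f leaves s.

    One priority queue drives a simulation in lexicographic order of (time,
    value).  An arc f is first looked at at time dep f, is settled with the key
    (dep f, h f), and becomes usable at its head v at time arr f + alpha v, with
    the key (arr f + alpha v, g f).  Keys never decrease: arcs with a positive
    transmission time move to a later time, and for the others wt is
    nonnegative, as in Dijkstra's algorithm.  The arcs usable at v have windows
    of the common length beta v, so a monotone deque (arrival times increasing,
    g increasing) yields the window minimum.  An arc that becomes usable at time
    t serves the arcs leaving v at time t at once; the first one to do so at
    (v, t) has the least g, so each waiting arc is served once.

    At the end, every arc f linked from a settled arc e is settled with
    g f <= g e + wt f, and likewise for the arcs leaving s; by induction along a
    walk this makes the values found optimal.  Each step of the simulation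
    lowers a potential that is initially O(|E|) and costs one update of a
    tournament tree. *)

Set Implicit Arguments.
Unset Strict Implicit.
Unset Printing Implicit Defensive.

Import Order.TTheory GRing.Theory Num.Theory.

(** The number of linked pairs of arcs can be quadratic, so they cannot be examined one by one. Most
    pairs (e, f) are never compared: the invariant has to show that an arc discarded from a deque,
    or a waiting arc already served, loses nothing.

    The coefficient of the transmission time in wt is D (delta_4 - delta_7), because waiting is
    total time minus transmission time. So wt may be negative, and an order by value alone would not
    be safe; with the time as first component of the key, a negative weight occurs only on an arc
    that moves to a later time.

    The parity in the time codes 2t and 2t + 1 separates two roles at the same time t. All arcs
    leaving at time t are looked at before any arc becomes usable at time t. Hence a first look
    finds in the deque only arcs usable strictly before t, and an arc that becomes usable at t finds
    on the stack all arcs leaving at t that have not yet been served.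

    The potential has a second use: since every step consumes some of it, it bounds the stored
    numbers and thereby the word size. *)

Local Notation "n %:Z" := (Posz n) (only parsing) : nat_scope.

(** * Running programs on bounded words *)

(* In a state whose entries are at most X >= 2, an expression e and all its
   subexpressions are at most [X ^ edeg e]; only the values that are stored
   need a sharper bound. *)
Fixpoint edeg (e : expr) : nat :=
  match e with
  | Cst k => absz k
  | Reg _ => 1
  | Read a => maxn 1 (edeg a)
  | Bin _ e1 e2 => (edeg e1 + edeg e2).+1
  end.

Fixpoint cdeg (p : cmd) : nat :=
  match p with
  | Skip => 0
  | Assign _ e => edeg e
  | Write a e => maxn (edeg a) (edeg e)
  | Seq p q => maxn (cdeg p) (cdeg q)
  | If e p q => maxn (edeg e) (maxn (cdeg p) (cdeg q))
  | While e p => maxn (edeg e) (cdeg p)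
  end.

Fixpoint ccost (p : cmd) : nat :=
  match p with
  | Skip => 1
  | Assign _ e => (cost e).+1
  | Write a e => (cost a + cost e).+1
  | Seq p q => ccost p + ccost q
  | If e p q => (cost e + maxn (ccost p) (ccost q)).+1
  | While e p => 0
  end.

Lemma absz_div (m d : int) : absz (m %/ d)%Z <= absz m.
Proof.
have [->|d0] := eqVneq d 0%R; first by rewrite divz0.
have := divz_eq m d; have := modz_ge0 m d0; have := ltz_mod m d0.
by move: (m %/ d)%Z (m %% d)%Z => q r; case: (ltrgtP d 0%R) d0 => // h _; nia.
Qed.

Section BoundedExec.
Variables X D : nat.
Hypothesis X_gt1 : 1 < X.

Definition bounded (st : state) : Prop :=
  (forall r, absz (regs st r) <= X) /\ (forall a, absz (memory st a) <= X).

(** Each operation has one factor X to spare, which absorbs a sum: p + q <= 2pq <= Xpq for p, q >=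
    1. A constant k is below X^k. *)
Lemma absz_eval_deg st e : bounded st -> absz (eval st e) <= X ^ edeg e.
Proof.
move=> [hr hm]; elim: e => [k|r|a IH|o e1 IH1 e2 IH2] /=.
- by apply: ltnW; apply: ltn_expl.
- by rewrite expn1.
- by apply: leq_trans (hm _) _; rewrite -{1}(expn1 X) leq_exp2l // leq_maxl.
- rewrite expnS expnD; move: IH1 IH2.
  have : 0 < X ^ edeg e1 by rewrite expn_gt0; lia.
  have : 0 < X ^ edeg e2 by rewrite expn_gt0; lia.
  move: (X ^ _) (X ^ _) (eval st e1) (eval st e2) => p q x y hp hq hx hy.
  have hpq : p * q * 2 <= X * (q * p) by nia.
  have h1 : q + p <= p * q * 2 by nia.
  have h2 : absz (x * y)%R <= q * p by rewrite abszM mulnC; apply: leq_mul.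
  case: o => /=.
  + by lia.
  + by lia.
  + by apply: leq_trans h2 _; nia.
  + by have := absz_div x y; nia.
  + by case: ifP => _; rewrite ?absz0 ?absz1; nia.
Qed.

Lemma fits_deg st e : bounded st -> edeg e <= D -> fits (X ^ D) st e.
Proof.
move=> hb; have key e' : edeg e' <= D -> absz (eval st e') <= X ^ D.
  by move=> he; apply: leq_trans (absz_eval_deg _ hb) _; rewrite leq_exp2l.
elim: e => [k|r|a IH|o e1 IH1 e2 IH2] he; move: (key _ he) => hk.
- by rewrite /= in hk *; rewrite hk.
- by rewrite /= in hk *; rewrite hk.
- by rewrite /= in hk *; rewrite hk IH //; rewrite /= in he; lia.
- by rewrite /= in he; rewrite [fits _ _ _]/= in hk *; rewrite hk IH1 ?IH2 //;
    lia.
Qed.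

Definition runs (p : cmd) (st : state) (n : nat) (Q : state -> Prop) : Prop :=
  bounded st -> exists k st',
    [/\ exec (X ^ D) p st k st', k <= n, bounded st' & Q st'].

Lemma runs_mono p st n n' (Q Q' : state -> Prop) :
  n <= n' -> (forall st', Q st' -> Q' st') -> runs p st n Q -> runs p st n' Q'.
Proof.
move=> hn hQ h /h [k [st' [h1 h2 h3 h4]]]; exists k, st'.
by split=> //; [apply: leq_trans hn | apply: hQ].
Qed.

Lemma runs_seq p q st n m Q :
  runs p st n (fun st' => runs q st' m Q) -> runs (Seq p q) st (n + m) Q.
Proof.
move=> h /h [k [st' [h1 h2 h3 /(_ h3) [k' [st'' [h1' h2' h3' h4']]]]]].
exists (k + k'), st''; split=> //; first exact: exec_seq h1 h1'.
exact: leq_add.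
Qed.

(** The index k of the invariant is a variant: it bounds the number of iterations left, and there is
    one more test than iterations. *)
Lemma runs_while e p n (I : nat -> state -> Prop) k st :
  edeg e <= D ->
  (forall k st, I k st -> eval st e != 0%R ->
     runs p st n (fun st' => exists2 k', k' < k & I k' st')) ->
  I k st ->
  runs (While e p) st (k.+1 * (cost e + n).+1)
    (fun st' => eval st' e = 0%R /\ exists k', I k' st').
Proof.
move=> he hp; move: {2}k (leqnn k) => m.
elim: m k st => [|m IH] k st hk hI hb.
  have [h0|h0] := eqVneq (eval st e) 0%R; last first.
    by have [_ [st' [_ _ _ [k']]]] := hp _ _ hI h0 hb; lia.
  exists (cost e).+1, st; split=> //; [|nia|by split=> //; exists k].
  by apply: exec_while_false => //; apply: fits_deg.
have [h0|h0] := eqVneq (eval st e) 0%R.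
  exists (cost e).+1, st; split=> //; [|nia|by split=> //; exists k].
  by apply: exec_while_false => //; apply: fits_deg.
have [n1 [st1 [h1 h2 h3 [k' hk' hI']]]] := hp _ _ hI h0 hb.
have hk'm : k' <= m by lia.
have [n2 [st2 [g1 g2 g3 g4]]] := IH _ _ hk'm hI' h3.
exists (cost e + n1 + n2).+1, st2; split=> //.
  by apply: exec_while_true h1 g1 => //; apply: fits_deg.
by nia.
Qed.

(** Only stored values are compared with X, since intermediate values are controlled by [cdeg].
    Loops get [False] and go through [runs_while]; so the value 0 of [ccost] on a loop is never
    taken for its cost. *)
Fixpoint wp (p : cmd) (st : state) (Q : state -> Prop) : Prop :=
  match p with
  | Skip => Q st
  | Assign r e => absz (eval st e) <= X /\ Q (set_reg st r (eval st e))
  | Write a e => absz (eval st e) <= X /\ Q (set_mem st (eval st a) (eval st e))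
  | Seq p q => wp p st (fun st' => wp q st' Q)
  | If e p q => if eval st e != 0%R then wp p st Q else wp q st Q
  | While _ _ => False
  end.

Lemma runs_wp p st Q : cdeg p <= D -> wp p st Q -> runs p st (ccost p) Q.
Proof.
elim: p st Q => /= [|r e|a e|p IHp q IHq|e p IHp q IHq|//] st Q hd.
- by move=> hQ hb; exists 1, st; split=> //; constructor.
- move=> [h1 hQ] hb; have [hr hm] := hb.
  exists (cost e).+1, (set_reg st r (eval st e)); split=> //.
    by constructor; apply: fits_deg.
  by split=> //= r'; case: ifP.
- move=> [h1 hQ] hb; have [hr hm] := hb.
  exists (cost a + cost e).+1, (set_mem st (eval st a) (eval st e)); split=> //.
    by constructor; apply: fits_deg => //; lia.
  by split=> //= r'; case: ifP.
- move=> h; have [hp hq] : cdeg p <= D /\ cdeg q <= D by lia.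
  apply: runs_seq; apply: runs_mono (IHp _ _ hp h) => // st' h'; exact: IHq.
- move=> h hb; have hf : fits (X ^ D) st e by apply: fits_deg => //; lia.
  have [h0|h0] := eqVneq (eval st e) 0%R; rewrite ?h0 ?eqxx /= in h.
    have hq : cdeg q <= D by lia.
    have [k [st' [h1 h2 h3 h4]]] := IHq _ _ hq h hb.
    by exists (cost e + k).+1, st'; split=> //; [exact: exec_if_false | lia].
  have hp : cdeg p <= D by lia.
  have [k [st' [h1 h2 h3 h4]]] := IHp _ _ hp h hb.
  by exists (cost e + k).+1, st'; split=> //; [exact: exec_if_true | lia].
Qed.

End BoundedExec.

(** * The simulation *)

Definition upd (T : Type) (f : nat -> T) (i : nat) (v : T) : nat -> T :=
  fun x => if x == i then v else f x.

Definition upd2 (T : Type) (f : nat -> nat -> T) (i j : nat) (v : T) :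
    nat -> nat -> T :=
  fun x y => if (x == i) && (y == j) then v else f x y.

(* Arcs are numbered from 1, and 0 means none.  tr: tournament tree; (kt, kv):
   key of an arc, where time t is coded as 2t for the first look at the arcs
   leaving at time t and as 2t + 1 for everything else, and kv is g once the
   arc is settled; stt: status; prd: preceding arc of the best walk; idx:
   position in the input; hd, tl, dq: the deque of a vertex occupies the
   positions hd <= p < tl; pc, pa: stack of the arcs waiting at a vertex; best:
   last arc of the best walk to a vertex; ip, iq: one plus the position of an
   arc in pa, dq, or 0 (not stored by the program).
   Status 0: not looked at; 1: in the queue with a candidate for h; 2: settled;
   3: in the deque; 4: finished; 5: looked at, without candidate. *)
Record astate := AState {
  tr : nat -> nat;
  kt : nat -> nat;
  kv : nat -> int;
  stt : nat -> nat;
  prd : nat -> nat;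
  idx : nat -> nat;
  hd : nat -> nat;
  tl : nat -> nat;
  dq : nat -> nat -> nat;
  pc : nat -> nat;
  pa : nat -> nat -> nat;
  best : nat -> nat;
  ip : nat -> nat;
  iq : nat -> nat
}.

Definition set_tr a i v := AState (upd (tr a) i v) (kt a) (kv a) (stt a)
  (prd a) (idx a) (hd a) (tl a) (dq a) (pc a) (pa a) (best a) (ip a) (iq a).
Definition set_kt a i v := AState (tr a) (upd (kt a) i v) (kv a) (stt a)
  (prd a) (idx a) (hd a) (tl a) (dq a) (pc a) (pa a) (best a) (ip a) (iq a).
Definition set_kv a i v := AState (tr a) (kt a) (upd (kv a) i v) (stt a)
  (prd a) (idx a) (hd a) (tl a) (dq a) (pc a) (pa a) (best a) (ip a) (iq a).
Definition set_stt a i v := AState (tr a) (kt a) (kv a) (upd (stt a) i v)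
  (prd a) (idx a) (hd a) (tl a) (dq a) (pc a) (pa a) (best a) (ip a) (iq a).
Definition set_prd a i v := AState (tr a) (kt a) (kv a) (stt a)
  (upd (prd a) i v) (idx a) (hd a) (tl a) (dq a) (pc a) (pa a) (best a) (ip a)
  (iq a).
Definition set_idx a i v := AState (tr a) (kt a) (kv a) (stt a)
  (prd a) (upd (idx a) i v) (hd a) (tl a) (dq a) (pc a) (pa a) (best a) (ip a)
  (iq a).
Definition set_hd a i v := AState (tr a) (kt a) (kv a) (stt a)
  (prd a) (idx a) (upd (hd a) i v) (tl a) (dq a) (pc a) (pa a) (best a) (ip a)
  (iq a).
Definition set_tl a i v := AState (tr a) (kt a) (kv a) (stt a)
  (prd a) (idx a) (hd a) (upd (tl a) i v) (dq a) (pc a) (pa a) (best a) (ip a)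
  (iq a).
Definition set_dq a i p v := AState (tr a) (kt a) (kv a) (stt a)
  (prd a) (idx a) (hd a) (tl a) (upd2 (dq a) i p v) (pc a) (pa a) (best a)
  (ip a) (iq a).
Definition set_pc a i v := AState (tr a) (kt a) (kv a) (stt a)
  (prd a) (idx a) (hd a) (tl a) (dq a) (upd (pc a) i v) (pa a) (best a) (ip a)
  (iq a).
Definition set_pa a i p v := AState (tr a) (kt a) (kv a) (stt a)
  (prd a) (idx a) (hd a) (tl a) (dq a) (pc a) (upd2 (pa a) i p v) (best a)
  (ip a) (iq a).
Definition set_best a i v := AState (tr a) (kt a) (kv a) (stt a)
  (prd a) (idx a) (hd a) (tl a) (dq a) (pc a) (pa a) (upd (best a) i v) (ip a)
  (iq a).
Definition set_ip a i v := AState (tr a) (kt a) (kv a) (stt a)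
  (prd a) (idx a) (hd a) (tl a) (dq a) (pc a) (pa a) (best a)
  (upd (ip a) i v) (iq a).
Definition set_iq a i v := AState (tr a) (kt a) (kv a) (stt a)
  (prd a) (idx a) (hd a) (tl a) (dq a) (pc a) (pa a) (best a) (ip a)
  (upd (iq a) i v).

Definition lex (t : nat) (x : int) (t' : nat) (x' : int) : bool :=
  (t < t') || (t == t') && (x <= x')%R.

Section Algorithm.

Variables (E s : nat) (src dst dpt dt al be : nat -> nat).
Variables (wt : nat -> int) (cA cB : int).

Definition arc x := 0 < x <= E.
Definition art x := dpt x + dt x.
Definition act x := art x + al (dst x).
Definition lnk e f :=
  [&& dst e == src f, act e <= dpt f & dpt f <= art e + be (dst e)].

Hypothesis wt_ge0 : forall x, arc x -> dt x = 0 -> (0 <= wt x)%R.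

Definition settled a x := 2 <= stt a x <= 4.
Definition outval a x : int := (kv a x + cA * (art x)%:Z)%R.
Definition srcval x : int := (- cB * (dpt x)%:Z)%R.

Definition cand a f h e st :=
  set_stt (set_prd (set_kt (set_kv a f h) f (dpt f).*2.+1) f e) f st.

Definition ph0_pop a j :=
  let v := src j in set_hd (set_iq a (dq a v (hd a v)) 0) v (hd a v).+1.

Definition ph0_push a j :=
  let v := src j in
  set_ip (set_pc (set_pa a v (pc a v) j) v (pc a v).+1) j (pc a v).+1.

(** The front of the deque competes with starting a walk at j. With status 5 the value written is
    only a placeholder: the arc stays out of the queue until an arc that becomes usable serves
    it. *)
Definition ph0_leave a j :=
  let v := src j in
  let fr := dq a v (hd a v) in
  if (hd a v < tl a v) && ~~ ((v == s) && (srcval j <= kv a fr)%R)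
  then cand a j (kv a fr) fr 1
  else cand a j (srcval j) 0 (if v == s then 1 else 5).

Definition ph1 a j :=
  let a1 := set_idx (set_stt (set_kt (set_kv a j (kv a j + wt j)%R)
              j (act j).*2.+1) j 2) j j.-1 in
  let w := dst j in
  if (best a1 w == 0) || (outval a1 j <= outval a1 (best a1 w))%R
  then set_best a1 w j else a1.

Definition ph2_pop a j :=
  let w := dst j in set_tl (set_iq a (dq a w (tl a w).-1) 0) w (tl a w).-1.

Definition ph2_push a j :=
  let w := dst j in
  set_stt (set_iq (set_tl (set_dq a w (tl a w) j) w (tl a w).+1)
     j (tl a w).+1) j 3.

Definition ph3_pop a j :=
  let w := dst j in
  set_ip (set_pc a w (pc a w).-1) (pa a w (pc a w).-1) 0.

Definition ph3_test a j f :=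
  [&& dpt f == act j, act j <= art j + be (dst j)
    & (stt a f == 5) || (stt a f == 1) && (kv a j < kv a f)%R].

Definition ph3_upd a j f := if ph3_test a j f then cand a f (kv a j) j 1 else a.

(* The second component is the arc whose key or status may have changed. *)
Definition phase a j : astate * nat :=
  let v := src j in
  let w := dst j in
  match stt a j with
  | 0 => (if (hd a v < tl a v) && (art (dq a v (hd a v)) + be v < dpt j)
          then ph0_pop a j else ph0_leave (ph0_push a j) j, j)
  | 1 => (ph1 a j, j)
  | 2 => (if (hd a w < tl a w) && (kv a j <= kv a (dq a w (tl a w).-1))%R
          then ph2_pop a j else ph2_push a j, j)
  | _ => if pc a w == 0 then (set_stt a j 4, j)
         else let f := pa a w (pc a w).-1 in (ph3_upd (ph3_pop a j) j f, f)
  end.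

Fixpoint chain a x (l : seq nat) : Prop :=
  [/\ arc x, settled a x &
  match l with
  | [::] => [/\ prd a x = 0, src x = s & kv a x = (srcval x + wt x)%R]
  | y :: l' => [/\ prd a x = y, lnk y x, kv a x = (kv a y + wt x)%R
                 & chain a y l']
  end].

(* (t0, x0) is the last key taken from the queue.  The third case of [i_dom]
   bridges the steps between the removal of dominated arcs from the end of a
   deque and the insertion of the dominating one. *)
Record inv (t0 : nat) (x0 : int) (a : astate) : Prop := Inv {
  i_st : forall x, arc x -> stt a x <= 5;
  i_k0 : forall x, arc x -> stt a x = 0 ->
    [/\ kt a x = (dpt x).*2, ip a x = 0 & iq a x = 0];
  i_k1 : forall x, arc x -> stt a x = 1 -> kt a x = (dpt x).*2.+1;
  i_k2 : forall x, arc x -> settled a x -> kt a x = (act x).*2.+1;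
  i_iq : forall x, arc x -> stt a x <> 3 -> stt a x <> 4 -> iq a x = 0;
  i_min : forall x, arc x -> stt a x <= 3 -> lex t0 x0 (kt a x) (kv a x);
  i_dep : forall x, arc x -> 0 < stt a x -> (dpt x).*2 <= t0;
  i_set : forall x, arc x -> settled a x ->
    lex (dpt x).*2.+1 (kv a x - wt x)%R t0 x0;
  i_act : forall x, arc x -> 3 <= stt a x <= 4 -> lex (kt a x) (kv a x) t0 x0;
  i_src : forall x, arc x -> src x = s ->
    [/\ stt a x <> 5, stt a x = 1 -> (kv a x <= srcval x)%R
      & settled a x -> (kv a x <= srcval x + wt x)%R];
  i_lnk1 : forall e f, arc e -> arc f -> settled a e -> lnk e f ->
    stt a f = 1 \/ stt a f = 5 ->
    (stt a f = 1 /\ (kv a f <= kv a e)%R) \/ (stt a e <= 3 /\ act e = dpt f);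
  i_lnk2 : forall e f, arc e -> arc f -> settled a e -> lnk e f ->
    settled a f -> (kv a f <= kv a e + wt f)%R;
  i_hdtl : forall v, hd a v <= tl a v;
  i_dq : forall v p, hd a v <= p < tl a v ->
    [/\ arc (dq a v p), dst (dq a v p) = v, 3 <= stt a (dq a v p) <= 4
      & iq a (dq a v p) = p.+1];
  i_srt : forall v p q, hd a v <= p -> p <= q -> q < tl a v ->
    art (dq a v p) <= art (dq a v q) /\ (kv a (dq a v p) <= kv a (dq a v q))%R;
  i_dom : forall e, arc e -> 3 <= stt a e <= 4 ->
    [\/ (art e + be (dst e)).*2 < t0,
        exists p, [/\ hd a (dst e) <= p < tl a (dst e),
                      art e <= art (dq a (dst e) p)
                    & (kv a (dq a (dst e) p) <= kv a e)%R]
      | exists e', [/\ arc e', stt a e' = 2, dst e' = dst e,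
                       lex (kt a e') (kv a e') t0 x0
                     & art e <= art e' /\ (kv a e' <= kv a e)%R]];
  i_pa : forall v p, p < pc a v ->
    [/\ arc (pa a v p), src (pa a v p) = v, ip a (pa a v p) = p.+1
      & 0 < stt a (pa a v p)];
  i_ip : forall f p, arc f -> ip a f = p.+1 ->
    p < pc a (src f) /\ pa a (src f) p = f;
  i_pend : forall f, arc f -> stt a f = 1 \/ stt a f = 5 -> ip a f = 0 ->
    [\/ stt a f = 1 /\ lex (kt a f) (kv a f) t0 x0, (dpt f).*2.+1 < t0
      | be (src f) < al (src f)];
  i_cand : forall x, arc x -> stt a x = 1 ->
    [/\ prd a x = 0, src x = s & kv a x = srcval x] \/
    [/\ arc (prd a x), settled a (prd a x), lnk (prd a x) x
      & kv a x = kv a (prd a x)];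
  i_chain : forall x, arc x -> settled a x -> exists l, chain a x l;
  i_best0 : forall x, arc x -> settled a x -> best a (dst x) <> 0;
  i_best : forall z, best a z <> 0 ->
    [/\ arc (best a z), settled a (best a z), dst (best a z) = z
      & forall x, arc x -> settled a x -> dst x = z ->
          (outval a (best a z) <= outval a x)%R];
  i_idx : forall x, arc x -> settled a x -> idx a x = x.-1
}.

(** Apart from [i_min], which is supplied anew, the current key occurs in the invariant only as an
    upper bound, so it may grow. *)
Lemma inv_advance t0 x0 t1 x1 a :
  inv t0 x0 a -> lex t0 x0 t1 x1 ->
  (forall x, arc x -> stt a x <= 3 -> lex t1 x1 (kt a x) (kv a x)) ->
  inv t1 x1 a.
Proof.
rewrite /lex => -[? ? ? ? ? hmin hdep hset hact ? ? ? ? ? ? hdom ? ? hpend ? ? ?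
  ? ?].
move=> hl hm; split=> //.
- by move=> x ax hx; have := hdep x ax hx; lia.
- by move=> x ax hx; have := hset x ax hx; rewrite /lex; lia.
- by move=> x ax hx; have := hact x ax hx; rewrite /lex; lia.
- move=> e ae he; case: (hdom e ae he) => [h|h|[e' [h1 h2 h3 h4 h5]]].
  + by constructor 1; lia.
  + by constructor 2.
  + by constructor 3; exists e'; split=> //; move: h4; rewrite /lex; lia.
- move=> f af hf h0; case: (hpend f af hf h0) => [[h1 h2]|h|h].
  + by constructor 1; split=> //; move: h2; rewrite /lex; lia.
  + by constructor 2; lia.
  + by constructor 3.
Qed.

(** * Each step of the simulation preserves the invariant *)

Section Transition.
Variables (t0 : nat) (x0 : int) (a : astate) (j : nat).
Hypothesis H : inv t0 x0 a.
Hypothesis aj : arc j.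
Hypotheses (tj : kt a j = t0) (xj : kv a j = x0).

Lemma chain_agree a' :
  (forall x, arc x -> settled a x ->
     [/\ settled a' x, kv a' x = kv a x & prd a' x = prd a x]) ->
  forall x l, chain a x l -> chain a' x l.
Proof.
move=> h x l; elim: l x => [|y l IH] x /= [ax sx].
  by have [h1 h2 h3] := h _ ax sx; rewrite h2 h3.
move=> [h4 h5 h6 h7]; have [h1 h2 h3] := h _ ax sx.
have [ay sy] : arc y /\ settled a y by case: (l) h7 => [|? ?] [].
have [_ h2' _] := h _ ay sy.
by rewrite h2 h3 h2'; split=> //; split=> //; apply: IH.
Qed.

(** The clock stands at [dpt j], past the window of the front. Whatever the front dominated arrived
    no later at the same vertex and has expired as well, so it moves to the first case of
    [i_dom]. *)
Lemma inv_ph0_pop : stt a j = 0 -> hd a (src j) < tl a (src j) ->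
  art (dq a (src j) (hd a (src j))) + be (src j) < dpt j ->
  inv t0 x0 (ph0_pop a j).
Proof.
move=> s0 hne hexp.
have := H; case=> ? hk0 ? ? hiq ? ? ? ? ? ? ? hht hdq hsrt hdom ? ? ? ? hch ? ?
  ?.
have [kj _ _] := hk0 j aj s0.
split=> //=; rewrite /ph0_pop /= /upd /=.
- by move=> x ax sx; case: (hk0 x ax sx) => *; case: ifP.
- by move=> x ax h3 h4; case: ifP => // _; apply: hiq.
- by move=> v; case: eqP => [->|_].
- move=> v p hp.
  have hp' : hd a v <= p < tl a v by move: hp; case: eqP => [->|_]; lia.
  have [h1 h2 h3 h4] := hdq v p hp'; split=> //; rewrite h4.
  case: eqP => // e1.
  have hf : hd a (src j) <= hd a (src j) < tl a (src j) by rewrite leqnn.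
  have [g1 g2 g3 g4] := hdq _ _ hf.
  have ev : v = src j by rewrite -h2 e1 g2.
  by move: h4 hp; rewrite e1 g4 ev eqxx => -[->]; lia.
- move=> v p q hp hpq hq; apply: hsrt hq => //.
  by move: hp; case: eqP => [->|_]; lia.
- move=> e ae se; case: (hdom e ae se) => [h|[p [h1 h2 h3]]|h].
  + by constructor 1.
  + have [e1|ne] := eqVneq (dst e) (src j); last first.
      by constructor 2; exists p.
    have [e2|ne2] := eqVneq p (hd a (src j)).
      constructor 1; rewrite -tj kj; move: h2; rewrite e1 e2; lia.
    by constructor 2; exists p; rewrite e1 in h1 h2 h3 *; rewrite ?eqxx;
      split=> //; lia.
  + by constructor 3.
- by move=> x ax sx; have [l hl] := hch x ax sx; exists l;
    apply: chain_agree hl.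
Qed.

(** An arbitrary value and status treat at once the three outcomes: front of the deque, start of a
    walk, no candidate. *)
Lemma inv_ph0_leave h e0 st : stt a j = 0 ->
  st = 1 \/ st = 5 ->
  (src j = s -> st = 1 /\ (h <= srcval j)%R) ->
  (forall e, arc e -> 3 <= stt a e <= 4 -> lnk e j ->
     st = 1 /\ (h <= kv a e)%R) ->
  (st = 1 -> [/\ e0 = 0, src j = s & h = srcval j] \/
     [/\ arc e0, settled a e0, lnk e0 j & h = kv a e0]) ->
  inv t0 x0 (cand (ph0_push a j) j h e0 st).
Proof.
move=> s0 hst hsrc hlnk hprd.
have := H; case=> h1 hk0 hk1 hk2 hiq hmin hdep hset hact hs hl1 hl2 hht hdq hsrt
  hdom hpa hip hpend hcand hch hb0 hb hidx.
have [kj ipj iqj] := hk0 j aj s0.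
have sj x : settled (cand (ph0_push a j) j h e0 st) x = settled a x.
  by rewrite /settled /= /upd; case: eqP => // ->; rewrite s0; case: hst => ->.
have nj x : settled a x -> (x == j) = false.
  by rewrite /settled; case: eqP => // ->; rewrite s0.
have nj3 x : 3 <= stt a x <= 4 -> (x == j) = false.
  by case: eqP => // ->; rewrite s0.
split=> /=; rewrite /upd /upd2 /=.
- by move=> x ax; case: eqP => _; [case: hst => ->|apply: h1].
- by move=> x ax; case: eqP => [-> | _ sx]; [case: hst => ->|apply: hk0].
- by move=> x ax; case: eqP => [-> // | _ sx]; apply: hk1.
- by move=> x ax; rewrite sj => sx; rewrite nj //; apply: hk2.
- by move=> x ax; case: eqP => [-> // | _]; apply: hiq.
- move=> x ax; case: eqP => [_ _ | _]; last exact: hmin.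
  by rewrite /lex; lia.
- move=> x ax; case: eqP => [-> _ | _]; last exact: hdep.
  by lia.
- by move=> x ax; rewrite sj => sx; rewrite nj //; apply: hset.
- move=> x ax; case: eqP => [_ | _]; last exact: hact.
  by case: hst => ->.
- move=> x ax sx; have [g1 g2 g3] := hs x ax sx; rewrite sj.
  case: eqP => [e1|_]; last by split.
  rewrite e1 in sx *; have [-> ?] := hsrc sx; split=> //.
  by rewrite /settled s0.
- move=> e f ae af; rewrite sj => se le; rewrite (nj e) //.
  case: eqP => [e1 _|_]; last exact: hl1.
  have [e3|e2] : 3 <= stt a e <= 4 \/ stt a e = 2 by move: se; rewrite /settled;
    lia.
    by rewrite e1 in le; left; apply: hlnk.
  (* An arc in status 2 still has its key 2 act e + 1 ahead of the clock 2 dpt j; being linked to j,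
     it becomes usable exactly at [dpt j] and can still serve j. *)
  right; split; first by rewrite e2.
  have := hk2 e ae se; have := hmin e ae; rewrite e2 /lex => /(_ isT).
  by move: le; rewrite /lnk e1; lia.
- move=> e f ae af; rewrite !sj => se le sf; rewrite !nj //; exact: hl2.
- exact: hht.
- move=> v p hp; have [g1 g2 g3 g4] := hdq v p hp; rewrite nj3 //.
- move=> v p q hp hpq hq.
  have [_ _ g3 _] := hdq v p ltac:(lia); have [_ _ g3' _] := hdq v q ltac:(lia).
  by rewrite !nj3 //; apply: hsrt.
- move=> e ae; case: eqP => [-> | _ se]; first by case: hst => ->.
  case: (hdom e ae se) => [g|[p [g1 g2 g3]]|[e' [g1 g2 g3 g4 g5]]].
  + by constructor 1.
  + constructor 2; exists p; split=> //.
    by have [_ _ g _] := hdq _ p g1; rewrite !nj3.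
  + constructor 3; exists e'; have -> : (e' == j) = false.
      by case: eqP => // e1; rewrite e1 s0 in g2.
    by [].
- move=> v p; case: (eqVneq v (src j)) => [->|nv] /=.
    case: (eqVneq p (pc a (src j))) => [-> _|np hp].
      by rewrite eqxx; split=> //; case: hst => ->.
    have [g1 g2 g3 g4] := hpa (src j) p ltac:(lia).
    by have -> : (pa a (src j) p == j) = false
      by case: eqP => // e1; rewrite e1 s0 in g4.
  move=> hp; have [g1 g2 g3 g4] := hpa v p hp.
  by have -> : (pa a v p == j) = false
      by case: eqP => // e1; rewrite e1 s0 in g4.
- move=> f p af; case: (eqVneq f j) => [-> [<-]|nf hf].
    by rewrite !eqxx /=.
  have [g1 g2] := hip f p af hf.
  case: eqP => e1 /=; last by [].
  have -> : (p == pc a (src j)) = false by rewrite -e1; lia.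
  by rewrite -e1; split=> //; lia.
- move=> f af; case: (eqVneq f j) => [//|nf]; exact: hpend.
- move=> x ax; case: (eqVneq x j) => [-> s1|nx s1].
    case: (hprd s1) => [?|[g1 g2 g3 g4]]; [by left|right].
    by rewrite sj nj.
  case: (hcand x ax s1) => [?|[g1 g2 g3 g4]]; [by left|right].
  by rewrite sj nj.
- move=> x ax; rewrite sj => sx; have [l hl] := hch x ax sx; exists l.
  apply: chain_agree hl => y ay sy; rewrite sj /= /upd nj //.
- by move=> x ax; rewrite sj; apply: hb0.
- move=> z /hb [g1 g2 g3 g4]; rewrite sj; split=> // x ax; rewrite sj => sx dx.
  by rewrite /outval /= /upd !nj //; apply: g4.
- by move=> x ax; rewrite sj; apply: hidx.
Qed.

(** This is the step of Dijkstra's algorithm: the value of j is final, because everything still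
    queued has a key at or above the current one. *)
Lemma inv_ph1 : stt a j = 1 -> inv t0 x0 (ph1 a j).
Proof.
move=> s1.
have := H; case=> h1 hk0 hk1 hk2 hiq hmin hdep hset hact hs hl1 hl2 hht hdq hsrt
  hdom hpa hip hpend hcand hch hb0 hb hidx.
have kj := hk1 j aj s1; have ej : t0 = (dpt j).*2.+1 by rewrite -kj.
have setj : settled a j = false by rewrite /settled s1.
have nj x : settled a x -> (x == j) = false.
  by case: eqP => // ->; rewrite setj.
have nj3 x : 3 <= stt a x <= 4 -> (x == j) = false.
  by case: eqP => // ->; rewrite s1.
(* Without progress in time the transmission time is 0, and only then must the sign of the weight
   keep the new key from falling below the current one. *)
have wtj : act j <= dpt j -> (0 <= wt j)%R.
  by move=> h; apply: wt_ge0 => //; move: h; rewrite /act /art; lia.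
have actj : dpt j <= act j by rewrite /act /art; lia.
set a1 := set_idx (set_stt (set_kt (set_kv a j (kv a j + wt j)%R)
              j (act j).*2.+1) j 2) j j.-1.
have sj x : settled a1 x = settled a x || (x == j).
  rewrite /settled /= /upd; case: eqP => _ //=; first by rewrite orbT.
  by rewrite orbF.
have stj : settled a1 j by rewrite sj eqxx orbT.
have hch' x : arc x -> settled a1 x -> exists l, chain a1 x l.
  have agree y l : chain a y l -> chain a1 y l.
    by apply: chain_agree => z az sz; rewrite sj sz /= /upd nj.
  move=> ax; rewrite sj => /orP[sx|/eqP ->].
    by have [l hl] := hch x ax sx; exists l; apply: agree.
  case: (hcand j aj s1) => [[g1 g2 g3]|[g1 g2 g3 g4]].
    by exists [::]; split=> //=; rewrite /upd eqxx g3.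
  have [l hl] := hch _ g1 g2; exists (prd a j :: l); split=> //.
  by split=> //=; [rewrite /upd eqxx nj // g4|apply: agree].
(* Whether or not j becomes the best arc at its head changes only the table [best], so the rest is
   proved for any admissible table b. *)
have main b : (forall x, arc x -> settled a1 x -> b (dst x) <> 0) ->
  (forall z, b z <> 0 ->
    [/\ arc (b z), settled a1 (b z), dst (b z) = z
      & forall x, arc x -> settled a1 x -> dst x = z ->
          (outval a1 (b z) <= outval a1 x)%R]) ->
  inv t0 x0 (AState (tr a1) (kt a1) (kv a1) (stt a1) (prd a1) (idx a1) (hd a1)
    (tl a1) (dq a1) (pc a1) (pa a1) b (ip a1) (iq a1)).
{ move=> hb0' hb'; split=> /=.
  - by move=> x ax; rewrite /upd; case: eqP => // _; apply: h1.
  - by move=> x ax; rewrite /upd; case: eqP => // _; apply: hk0.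
  - by move=> x ax; rewrite /upd; case: eqP => // _; apply: hk1.
  - by move=> x ax; rewrite [settled _ _]sj /upd; case: eqP => [->//|_];
      rewrite orbF; apply: hk2.
  - move=> x ax; rewrite /upd; case: eqP => [-> _ _| _]; last exact: hiq.
    by apply: hiq; rewrite // s1.
  - move=> x ax; rewrite /upd; case: eqP => [_ _|_]; last exact: hmin.
    rewrite /lex ej -xj; case: (leqP (act j) (dpt j)) => [/wtj|]; lia.
  - move=> x ax; rewrite /upd; case: eqP => [-> _|_]; last exact: hdep.
    by rewrite ej; lia.
  - move=> x ax; rewrite [settled _ _]sj /upd; case: eqP => [-> _|_].
      by rewrite /lex ej -xj; lia.
    by rewrite orbF; apply: hset.
  - move=> x ax; rewrite /upd; case: eqP => [_ //|_]; exact: hact.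
  - move=> x ax sx; have [g1 g2 g3] := hs x ax sx; rewrite [settled _ _]sj /upd.
    case: eqP => [e1|_]; last by rewrite orbF.
    split=> [//|//|_]; rewrite e1 lerD2r.
    by have := g2 ltac:(by rewrite e1); rewrite e1.
  - move=> e f ae af; rewrite [settled _ _]sj => se le; rewrite /upd.
    case: (eqVneq f j) => [_ []|nf]; [by []|by []|].
    case: (eqVneq e j) se le => [-> _ le sf|ne]; last first.
      by rewrite orbF => se le sf; apply: hl1.
    (* Since f has been looked at, dpt f <= dpt j <= act j <= dpt f. *)
    right; split=> //; have := hdep f af ltac:(case: sf => ->; lia).
    by move: le; rewrite /lnk ej; lia.
  - move=> e f ae af; rewrite [settled _ e]sj [settled _ f]sj => se le sf;
      rewrite /upd.
    case: (eqVneq f j) sf => [ef _|nf].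
      (* An arc may be linked to itself, as a loop with transmission time 0; then a nonnegative
         weight suffices. *)
      case: (eqVneq e j) se => [ee _|ne].
        by have := wtj ltac:(move: le; rewrite /lnk ef ee; lia); rewrite ef;
          lia.
      rewrite orbF => se; rewrite ef lerD2r.
      case: (hl1 e f ae af se le) => [|[]|[g1 g2]]; rewrite ?ef //;
        first by left.
      (* Here e is still queued at the time of j, so its value is at least the current x0, the
         candidate of j. *)
      have := hmin e ae g1; rewrite (hk2 e ae se) /lex -xj ej g2 ef; lia.
    rewrite orbF => sf; case: (eqVneq e j) se => [ee _|ne].
      (* Here f was settled before the new j. Both depart at the same time, f was taken with a key
         at most x0, and settling j does not lower its value below x0. *)
      have dfj : dpt f = dpt j /\ act j <= dpt j.
        have := hset f af sf; move: le; rewrite /lnk ee /lex ej; lia.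
      have := wtj dfj.2; have := hset f af sf; rewrite /lex -xj ej dfj.1; lia.
    by rewrite orbF => se; apply: hl2.
  - exact: hht.
  - move=> v p hp; have [g1 g2 g3 g4] := hdq v p hp; rewrite /upd nj3 //.
  - move=> v p q hp hpq hq.
    have [_ _ g3 _] := hdq v p ltac:(lia).
    have [_ _ g3' _] := hdq v q ltac:(lia).
    by rewrite /upd !nj3 //; apply: hsrt.
  - move=> e ae; rewrite /upd; case: eqP => [-> // | _ se].
    case: (hdom e ae se) => [g|[p [g1 g2 g3]]|[e' [g1 g2 g3 g4 g5]]].
    + by constructor 1.
    + constructor 2; exists p; split=> //.
      by have [_ _ g _] := hdq _ p g1; rewrite !nj3.
    + constructor 3; exists e'; have -> : (e' == j) = false.
        by case: eqP => // e1; rewrite e1 s1 in g2.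
      by [].
  - move=> v p hp; have [g1 g2 g3 g4] := hpa v p hp; split=> //.
    by rewrite /upd; case: eqP.
  - exact: hip.
  - move=> f af; rewrite /upd; case: eqP => [_ []//|_]; exact: hpend.
  - move=> x ax; rewrite /upd; case: eqP => [//|nx] sx.
    case: (hcand x ax sx) => [?|[g1 g2 g3 g4]]; [by left|right].
    by rewrite [settled _ _]sj nj // orbF.
  - move=> x ax sx; have [l hl] := hch' x ax sx; exists l.
    by elim: l x {ax sx} hl => [|y l IH] x //= [? ? [? ? ? ?]]; split=> //;
      split=> //; apply: IH.
  - exact: hb0'.
  - exact: hb'.
  - move=> x ax; rewrite [settled _ _]sj /upd; case: eqP => [->//|_].
    by rewrite orbF; apply: hidx. }
rewrite /ph1 -/a1.
have ov x : settled a x -> outval a1 x = outval a x.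
  by move=> sx; rewrite /outval /= /upd nj.
case: ifP => hbest; apply: main => /=.
- move=> x ax; rewrite sj /upd; case: (eqVneq x j) => [->|nx].
    by rewrite eqxx => _; move: aj; rewrite /arc; lia.
  rewrite orbF => sx; case: eqP => _; last exact: hb0.
  by move: aj; rewrite /arc; lia.
- move=> z; rewrite /upd; case: eqP => [ez _|nz hz].
    split=> // x ax; rewrite sj => /orP[sx dx|/eqP -> //].
    have g := hb0 x ax sx; have [g1 g2 g3 g4] := hb _ g.
    move: hbest => /orP[/eqP e0|]; first by rewrite dx ez in g.
    by move=> hle; apply: le_trans hle _; rewrite /= -ez -dx !ov //; apply: g4.
  have [g1 g2 g3 g4] := hb z hz; split=> //; first by rewrite sj g2.
  move=> x ax; rewrite sj => /orP[sx dx|/eqP -> dz]; last by case: nz.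
  by rewrite !ov //; apply: g4.
- move=> x ax; rewrite sj; case: (eqVneq x j) => [->|nx]; last by rewrite orbF;
    apply: hb0.
  by move=> _ e0; move: hbest; rewrite /= e0 eqxx.
- move=> z hz; have [g1 g2 g3 g4] := hb z hz; split=> //;
    first by rewrite sj g2.
  move=> x ax; rewrite sj => /orP[sx dx|/eqP ->]; first by rewrite !ov //;
    apply: g4.
  move=> dz; rewrite -dz; move: hbest => /=; case: eqP => [e0|_ /=].
    by rewrite dz in e0.
  by move/negbT; rewrite -ltNge; apply: ltW.
Qed.

(** The removed entry became usable no later than j at the same vertex, hence arrived no later, and
    its value is no better. As j is not in the deque yet, the arcs represented by this entry pass to
    the third case of [i_dom]. *)
Lemma inv_ph2_pop : stt a j = 2 -> hd a (dst j) < tl a (dst j) ->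
  (kv a j <= kv a (dq a (dst j) (tl a (dst j)).-1))%R ->
  inv t0 x0 (ph2_pop a j).
Proof.
move=> s2 hne hle.
have := H; case=> ? hk0 ? hk2 hiq ? ? ? hact ? ? ? hht hdq hsrt hdom ? ? ? ? hch
  ? ? ?.
have kj : kt a j = (act j).*2.+1 by apply: hk2 => //; rewrite /settled s2.
set w := dst j in hne hle *; set q := (tl a w).-1 in hle *.
have hq : hd a w <= q < tl a w by rewrite /q; lia.
have [g1 g2 g3 g4] := hdq _ _ hq.
split=> //=; rewrite /ph2_pop -/w -/q /= /upd /=.
- by move=> x ax sx; case: (hk0 x ax sx) => *; case: ifP.
- by move=> x ax h3 h4; case: ifP => // _; apply: hiq.
- by move=> v; case: eqP => [->|_] //; lia.
- move=> v p hp.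
  have hp' : hd a v <= p < tl a v by move: hp; case: eqP => [->|_]; lia.
  have [h1 h2 h3 h4] := hdq v p hp'; split=> //; rewrite h4.
  case: eqP => // e1; have ev : v = w by rewrite -h2 e1 g2.
  by move: h4 hp; rewrite e1 g4 ev eqxx => -[->]; lia.
- move=> v p p' hp hpp hp'; apply: hsrt => //.
  by move: hp'; case: eqP => [->|_]; lia.
- move=> e ae se; case: (hdom e ae se) => [h|[p [h1 h2 h3]]|h].
  + by constructor 1.
  + have [e1|ne] := eqVneq (dst e) w; last by constructor 2; exists p.
    rewrite e1 in h1 h2 h3.
    have [e2|ne2] := eqVneq p q.
      constructor 3; exists j; split=> //;
        first by rewrite tj xj /lex eqxx lexx orbT.
      rewrite e2 in h2 h3; split; last exact: le_trans hle h3.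
      apply: leq_trans h2 _; have := hact _ g1 g3.
      rewrite hk2 // -?tj ?kj /lex /act ?g2 -/w; last by rewrite /settled; lia.
      lia.
    by constructor 2; exists p; rewrite e1 ?eqxx; split=> //; lia.
  + by constructor 3.
- by move=> x ax sx; have [l hl] := hch x ax sx; exists l;
    apply: chain_agree hl.
Qed.

(** Arrival times stay sorted because arcs enter a deque in the order of their keys and share the
    minimum waiting time of the vertex. *)
Lemma inv_ph2_push : stt a j = 2 ->
  (hd a (dst j) < tl a (dst j) ->
   (kv a (dq a (dst j) (tl a (dst j)).-1) <= kv a j)%R) ->
  inv t0 x0 (ph2_push a j).
Proof.
move=> s2 hle.
have := H; case=> h1 hk0 hk1 hk2 hiq hmin hdep hset hact hs hl1 hl2 hht hdq hsrt
  hdom hpa hip hpend hcand hch hb0 hb hidx.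
have setj : settled a j by rewrite /settled s2.
have kj : kt a j = (act j).*2.+1 by apply: hk2.
set w := dst j in hle *.
have sj x : settled (ph2_push a j) x = settled a x.
  by rewrite /settled /= /upd; case: eqP => // ->; rewrite s2.
have njd v p : hd a v <= p < tl a v -> (dq a v p == j) = false.
  by move=> hp; have [_ _ g _] := hdq v p hp; case: eqP => // e1;
    rewrite e1 s2 in g.
split=> //=; rewrite -/w /upd /upd2 /=.
- by move=> x ax; case: eqP => // _; apply: h1.
- move=> x ax; case: (eqVneq x j) => [//|nx sx]; exact: hk0.
- by move=> x ax; case: eqP => // _; apply: hk1.
- by move=> x ax; rewrite sj; apply: hk2.
- by move=> x ax; case: eqP => // _; apply: hiq.
- move=> x ax; case: (eqVneq x j) => [-> _|nx]; last exact: hmin.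
  by apply: hmin; rewrite ?s2.
- move=> x ax; case: (eqVneq x j) => [-> _|nx]; last exact: hdep.
  by apply: hdep; rewrite ?s2.
- by move=> x ax; rewrite sj; apply: hset.
- move=> x ax; case: (eqVneq x j) => [-> _|nx]; last exact: hact.
  by rewrite tj xj /lex eqxx lexx orbT.
- move=> x ax sx; have [g1 g2 g3] := hs x ax sx; rewrite sj.
  by case: (eqVneq x j).
- move=> e f ae af; rewrite sj => se le.
  case: (eqVneq f j) => [_ []//|nf sf].
  case: (hl1 e f ae af se le sf) => [?|[g1 g2]]; [by left|right; split=> //].
  by case: eqP.
- by move=> e f ae af; rewrite !sj; apply: hl2.
- by move=> v; case: eqP => // ->; apply: leqW.
- move=> v p; case: (eqVneq v w) => [->|nv] /=.
    case: (eqVneq p (tl a w)) => [->|np hp]; first by rewrite eqxx.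
    have hp' : hd a w <= p < tl a w by lia.
    by have [? ? ? ?] := hdq w p hp'; rewrite njd.
  by move=> hp; have [? ? ? ?] := hdq v p hp; rewrite njd.
- move=> v p q; case: (eqVneq v w) => [->|nv] /=; last exact: hsrt.
  move=> hp hpq hq.
  case: (eqVneq q (tl a w)) => [eq|nq].
    case: (eqVneq p (tl a w)) => [//|np].
    have hlt : hd a w < tl a w by lia.
    have hl : hd a w <= (tl a w).-1 < tl a w by lia.
    have [g1 g2 g3 g4] := hdq w _ hl.
    have [k1 k2] := hsrt w p (tl a w).-1 hp ltac:(lia) ltac:(lia).
    split; last exact: le_trans k2 (hle hlt).
    apply: leq_trans k1 _; have := hact _ g1 g3.
    rewrite hk2 // -?tj ?kj /lex /act ?g2 -/w; last by rewrite /settled; lia.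
    lia.
  have -> : (p == tl a w) = false by lia.
  by apply: hsrt => //; lia.
- have hme : (hd a w <= tl a w < (tl a w).+1) by rewrite hht /=.
  (* The new position [tl a w] represents all arcs dominated by j, including those that earlier
     removals had left to j. *)
  have hin e : arc e -> dst e = w -> art e <= art j -> (kv a j <= kv a e)%R ->
    exists p, [/\ hd a (dst e) <= p < (if dst e == w then (tl a w).+1 else tl a
      (dst e)),
       art e <= art (if (dst e == w) && (p == tl a w) then j else dq a (dst e)
         p)
     & (kv a (if (dst e == w) && (p == tl a w) then j else dq a (dst e) p) <= kv
       a e)%R].
    by move=> ae de h2 h3; exists (tl a w); rewrite de !eqxx /=.
  move=> e ae; case: (eqVneq e j) => [-> _|ne se].
    by constructor 2; apply: hin.
  case: (hdom e ae se) => [g|[p [g1 g2 g3]]|[e' [g1 g2 g3 g4 [g5 g6]]]].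
  + by constructor 1.
  + constructor 2; exists p.
    case: (eqVneq (dst e) w) => [e1|//] /=; rewrite e1 in g1 g2 g3 *.
    have -> : (p == tl a w) = false by lia.
    by split=> //; lia.
  + case: (eqVneq e' j) => [e1|ne'].
      by rewrite e1 in g3 g5 g6; constructor 2; apply: hin.
    by constructor 3; exists e'; rewrite (negbTE ne').
- move=> v p hp; have [g1 g2 g3 g4] := hpa v p hp; split=> //.
  by case: eqP.
- by move=> f af; case: (eqVneq f j) => [_ []//|nf]; apply: hpend.
- move=> x ax; case: (eqVneq x j) => [//|nx] sx.
  by case: (hcand x ax sx) => [?|[g1 g2 g3 g4]]; [left|right; rewrite sj].
- move=> x ax; rewrite sj => sx; have [l hl] := hch x ax sx; exists l.
  by apply: chain_agree hl => y ay sy; rewrite sj.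
- by move=> x ax; rewrite sj; apply: hb0.
- move=> z hz; have [g1 g2 g3 g4] := hb z hz; rewrite sj; split=> // x ax.
  by rewrite sj; apply: g4.
- by move=> x ax; rewrite sj; apply: hidx.
Qed.

(** With the stack empty, every waiting f linked from j at departure time [act j] has been taken
    off, and [i_pend] tells why it needs nothing more from j: its key is at most the current one, so
    its value is at most that of j. The other two cases contradict the link. *)
Lemma inv_ph3_done : stt a j = 3 -> pc a (dst j) = 0 ->
  inv t0 x0 (set_stt a j 4).
Proof.
move=> s3 hpc.
have := H; case=> h1 hk0 hk1 hk2 hiq hmin hdep hset hact hs hl1 hl2 hht hdq hsrt
  hdom hpa hip hpend hcand hch hb0 hb hidx.
have kj : kt a j = (act j).*2.+1 by apply: hk2 => //; rewrite /settled s3.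
have sj x : settled (set_stt a j 4) x = settled a x.
  by rewrite /settled /= /upd; case: eqP => // ->; rewrite s3.
have s34 x : (3 <= (set_stt a j 4).(stt) x <= 4) = (3 <= stt a x <= 4).
  by rewrite /= /upd; case: eqP => // ->; rewrite s3.
split=> //.
- by move=> x ax /=; rewrite /upd; case: eqP => // _; apply: h1.
- by move=> x ax /=; rewrite /upd; case: eqP => // _; apply: hk0.
- by move=> x ax /=; rewrite /upd; case: eqP => // _; apply: hk1.
- by move=> x ax; rewrite sj; apply: hk2.
- by move=> x ax /=; rewrite /upd; case: eqP => // _; apply: hiq.
- by move=> x ax /=; rewrite /upd; case: eqP => // _; apply: hmin.
- move=> x ax /=; rewrite /upd; case: eqP => [->|_]; last exact: hdep.
  by move=> _; apply: hdep; rewrite ?s3.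
- by move=> x ax; rewrite sj; apply: hset.
- by move=> x ax; rewrite s34; apply: hact.
- move=> x ax sx; rewrite sj /= /upd; have [g1 g2 g3] := hs x ax sx.
  by case: eqP.
- move=> e f ae af; rewrite sj /= /upd => se le.
  case: (eqVneq f j) => [_ []//|nf sf].
  have := hl1 e f ae af se le sf.
  case: (eqVneq e j) => [e1|//] [?|[g1 g2]]; first by left.
  rewrite e1 in g2 le; left.
  have hf : src f = dst j by move: le; rewrite /lnk; lia.
  have ipf : ip a f = 0.
    by case ef: (ip a f) => [//|p]; have [] := hip f p af ef; rewrite hf hpc.
  case: (hpend f af sf ipf) => [[k1 k2]|k|k].
  + split=> //; move: k2; rewrite e1 xj -tj kj (hk1 f af k1) g2 /lex; lia.
  + by move: k; rewrite -tj kj; lia.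
  + by move: k le; rewrite /lnk /act hf; lia.
- by move=> e f ae af; rewrite !sj; apply: hl2.
- move=> v p hp; have [g1 g2 g3 g4] := hdq v p hp; split=> //.
  by rewrite s34.
- move=> e ae; rewrite s34 => se.
  case: (hdom e ae se) => [g|g|[e' [g1 g2 g3 g4 g5]]].
  + by constructor 1.
  + by constructor 2.
  + constructor 3; exists e'; split=> //=; rewrite /upd.
    by case: eqP => // e1; rewrite e1 s3 in g2.
- move=> v p hp; have [g1 g2 g3 g4] := hpa v p hp; split=> //=.
  by rewrite /upd; case: eqP.
- by move=> f af /=; rewrite /upd; case: eqP => [_ []//|_]; apply: hpend.
- move=> x ax /=; rewrite sj /upd; case: eqP => // _; exact: hcand.
- move=> x ax; rewrite sj => sx; have [l hl] := hch x ax sx; exists l.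
  by apply: chain_agree hl => y ay sy; rewrite sj.
- by move=> x ax; rewrite sj; apply: hb0.
- move=> z hz; have [g1 g2 g3 g4] := hb z hz; rewrite sj; split=> // x ax.
  by rewrite sj; apply: g4.
- by move=> x ax; rewrite sj; apply: hidx.
Qed.

(** The served arc receives exactly the current key, so [i_min] holds with equality, and a candidate
    that it already had is not made worse. *)
Lemma inv_ph3_cand f : stt a j = 3 -> arc f -> src f = dst j ->
  dpt f = act j -> act j <= art j + be (dst j) ->
  stt a f = 5 \/ stt a f = 1 /\ (kv a j <= kv a f)%R ->
  inv t0 x0 (cand a f (kv a j) j 1).
Proof.
move=> s3 af sfw dfj hbe hf.
have := H; case=> h1 hk0 hk1 hk2 hiq hmin hdep hset hact hs hl1 hl2 hht hdq hsrt
  hdom hpa hip hpend hcand hch hb0 hb hidx.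
have setj : settled a j by rewrite /settled s3.
have kj : kt a j = (act j).*2.+1 by apply: hk2.
have sf x : settled (cand a f (kv a j) j 1) x = settled a x.
  rewrite /settled /= /upd; case: eqP => // ->.
  by case: hf => [->|[->]].
have nf x : settled a x -> (x == f) = false.
  by rewrite /settled; case: eqP => // ->; case: hf => [->|[->]].
have nf3 x : 3 <= stt a x <= 4 -> (x == f) = false.
  by case: eqP => // ->; case: hf => [->|[->]].
split=> //; rewrite /cand /= /upd.
- by move=> x ax; case: eqP => // _; apply: h1.
- by move=> x ax; case: eqP => // _; apply: hk0.
- by move=> x ax; case: eqP => [->//|_]; apply: hk1.
- by move=> x ax; rewrite [settled _ _]sf => sx; rewrite nf //; apply: hk2.
- move=> x ax; case: eqP => [-> _ _|_]; last exact: hiq.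
  by apply: hiq => //; case: hf => [->|[->]].
- move=> x ax; case: eqP => [_ _|_]; last exact: hmin.
  by rewrite dfj -kj tj xj /lex eqxx lexx orbT.
- move=> x ax; case: eqP => [-> _|_]; last exact: hdep.
  by rewrite dfj -tj kj.
- by move=> x ax; rewrite [settled _ _]sf => sx; rewrite nf //; apply: hset.
- by move=> x ax; case: eqP => // _; apply: hact.
- move=> x ax sx; rewrite [settled _ _]sf; have [g1 g2 g3] := hs x ax sx.
  case: (eqVneq x f) => [ex|//]; split=> //.
    case: hf => [f5|[f1 k]]; first by rewrite ex f5 in g1.
    by move=> _; apply: le_trans k _; rewrite -ex; apply: g2; rewrite ex.
  by move=> sx'; move: (nf x sx'); rewrite ex eqxx.
- move=> e g ae ag; rewrite [settled _ _]sf => se le; rewrite (nf e) //.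
  case: (eqVneq g f) => [eg _|_]; last exact: hl1.
  have hg : stt a g = 1 \/ stt a g = 5.
    by rewrite eg; case: hf => [->|[->]]; [right|left].
  case: (hl1 e g ae ag se le hg) => [[k1 k2]|]; last by right.
  left; split=> //; apply: le_trans k2; rewrite eg.
  by case: hf => [f5|[]//]; rewrite eg f5 in k1.
- move=> e g ae ag; rewrite [settled _ e]sf [settled _ g]sf => se le sg.
  by rewrite !nf //; apply: hl2.
- by move=> v p hp; have [g1 g2 g3 g4] := hdq v p hp; rewrite nf3.
- move=> v p q hp hpq hq.
  have [_ _ g3 _] := hdq v p ltac:(lia); have [_ _ g3' _] := hdq v q ltac:(lia).
  by rewrite !nf3 //; apply: hsrt.
- move=> e ae; case: eqP => [// | _ se].
  case: (hdom e ae se) => [g|[p [g1 g2 g3]]|[e' [g1 g2 g3 g4 g5]]].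
  + by constructor 1.
  + constructor 2; exists p; split=> //.
    by have [_ _ g _] := hdq _ p g1; rewrite !nf3.
  + constructor 3; exists e'; have -> : (e' == f) = false.
      by case: eqP => // e1; move: g2; rewrite e1; case: hf => [->|[->]].
    by [].
- move=> v p hp; have [g1 g2 g3 g4] := hpa v p hp; split=> //.
  by case: eqP.
- move=> g ag; case: (eqVneq g f) => [_ _ _|_]; last exact: hpend.
  by constructor 1; split=> //; rewrite dfj -kj tj xj /lex eqxx lexx orbT.
- move=> x ax; case: (eqVneq x f) => [-> _|nx sx].
    right; rewrite [settled _ _]sf nf //; split=> //.
    by rewrite /lnk sfw eqxx dfj leqnn hbe.
  case: (hcand x ax sx) => [?|[g1 g2 g3 g4]]; [by left|right].
  by rewrite [settled _ _]sf nf.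
- move=> x ax; rewrite [settled _ _]sf => sx.
  have [l hl] := hch x ax sx; exists l.
  by apply: chain_agree hl => y ay sy; rewrite [settled _ _]sf /= /upd nf.
- by move=> x ax; rewrite [settled _ _]sf; apply: hb0.
- move=> z hz; have [g1 g2 g3 g4] := hb z hz; rewrite [settled _ _]sf.
  split=> // x ax; rewrite [settled _ _]sf => sx dx.
  by rewrite /outval /= /upd !nf //; apply: g4.
- by move=> x ax; rewrite [settled _ _]sf; apply: hidx.
Qed.

(** Being off the stack matters only for [i_pend], so one of its cases for f is all that a removal
    requires. *)
Lemma inv_ph3_pop : stt a j = 3 -> 0 < pc a (dst j) ->
  let f := pa a (dst j) (pc a (dst j)).-1 in
  (stt a f = 1 \/ stt a f = 5 ->
    [\/ stt a f = 1 /\ lex (kt a f) (kv a f) t0 x0, (dpt f).*2.+1 < t0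
      | be (src f) < al (src f)]) ->
  inv t0 x0 (ph3_pop a j).
Proof.
move=> s3 hpc f hf; set w := dst j in hpc f hf *.
have := H; case=> h1 hk0 hk1 hk2 hiq hmin hdep hset hact hs hl1 hl2 hht hdq hsrt
  hdom hpa hip hpend hcand hch hb0 hb hidx.
have [af sf ipf stf] := hpa w (pc a w).-1 ltac:(lia).
rewrite -/f in af sf ipf stf.
split=> //; rewrite /ph3_pop -/w -/f /= /upd.
- by move=> x ax sx; have [? ? ?] := hk0 x ax sx; case: eqP.
- move=> v p hp.
  have hp' : p < pc a v by move: hp; case: eqP => [->|//]; lia.
  have [g1 g2 g3 g4] := hpa v p hp'; split=> //.
  case: eqP => // e1; have ev : v = w by rewrite -g2 e1.
  by move: hp; rewrite ev eqxx; move: g3; rewrite e1 ipf; lia.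
- move=> g p ag; case: (eqVneq g f) => [//|ng hg].
  have [g1 g2] := hip g p ag hg; split=> //.
  case: eqP => // e1; rewrite e1 in g1 g2.
  have : p != (pc a w).-1 by apply: contra ng => /eqP e2; rewrite -g2 e2.
  by lia.
- move=> g ag sg; case: (eqVneq g f) => [eg _|ng].
    by rewrite eg; apply: hf; rewrite -eg.
  exact: hpend.
- by move=> x ax sx; have [l hl] := hch x ax sx; exists l;
    apply: chain_agree hl.
Qed.

End Transition.

Lemma inv_phase t0 x0 a j : inv t0 x0 a -> arc j -> kt a j = t0 ->
  kv a j = x0 -> stt a j <= 3 -> inv t0 x0 (phase a j).1.
Proof.
move=> H aj tj xj sj; rewrite /phase; case es: (stt a j) => [|[|[|k]]].
- case: ifP => [/andP[h1 h2]|hf]; first exact: inv_ph0_pop.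
  have [kj ipj iqj] := i_k0 H aj es.
  set v := src j in hf *; set fr := dq a v (hd a v) in hf *.
  (* By [i_dom] the front is at least as good as every usable arc linked to j, including those no
     longer in the deque. *)
  have front e : arc e -> 3 <= stt a e <= 4 -> lnk e j ->
      hd a v < tl a v /\ (kv a fr <= kv a e)%R.
  { move=> ae se le; have dv : dst e = v by move: le; rewrite /lnk; lia.
    case: (i_dom H ae se) => [g|[p [g1 g2 g3]]|[e' [g1 g2 g3 g4 g5]]].
    + by move: g le; rewrite -tj kj /lnk; lia.
    + rewrite dv in g1 g2 g3; split; first by lia.
      apply: le_trans g3.
      by have [] := i_srt H (leqnn (hd a v)) (p := hd a v) (q := p) ltac:(lia)
        ltac:(lia).
    (* The times of e' and j would have to agree, but the code of e' is odd and that of j is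
       even. *)
    + have k2 := i_k2 H g1 ltac:(by rewrite /settled g2).
      have := i_min H g1 ltac:(by rewrite g2).
      by move: g4; rewrite k2 -tj kj /lex; lia. }
  have frlnk : hd a v < tl a v -> [/\ arc fr, settled a fr & lnk fr j].
    move=> hlt; have [g1 g2 g3 g4] := i_dq H (v := v) (p := hd a v) ltac:(lia).
    rewrite -/fr in g1 g2 g3 g4; have sf : settled a fr by rewrite /settled;
      lia.
    split=> //; have := i_act H g1 g3; rewrite (i_k2 H g1 sf) -tj kj /lex.
    by move: hf; rewrite hlt /lnk /act g2 -/v; lia.
  rewrite /= /ph0_leave -/v.
  have -> : dq (ph0_push a j) v (hd (ph0_push a j) v) = fr by [].
  case: ifP => /= [/andP[h1 h2]|h1].
    have [f1 f2 f3] := frlnk h1.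
    apply: inv_ph0_leave => //; [by left| | |by move=> _; right].
      by move=> ev; split=> //; move: h2; rewrite /v ev eqxx /= -ltNge => /ltW.
    by move=> e ae se le; split=> //; have [] := front e ae se le.
  apply: inv_ph0_leave => //.
  + by case: ifP; [left|right].
  + by move=> ev; rewrite /v ev eqxx.
  + move=> e ae se le; have [k1 k2] := front e ae se le.
    move: h1; rewrite k1 /= => /negbT; rewrite negbK => /andP[-> k3].
    by split=> //; apply: le_trans k3 k2.
  + by case: eqP => // ev _; left.
- exact: inv_ph1.
- case: ifP => [/andP[h1 h2]|hf]; first exact: inv_ph2_pop.
  apply: inv_ph2_push => // hlt; move: hf; rewrite hlt /= => /negbT.
  by rewrite -ltNge => /ltW.
- have s3 : stt a j = 3 by lia.
  case: eqP => [h0|/eqP h0]; first exact: inv_ph3_done.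
  set w := dst j in h0 *; set f := pa a w _.
  have [af sf ipf stf] := i_pa H (v := w) (p := (pc a w).-1) ltac:(lia).
  rewrite -/f in af sf ipf stf.
  have setj : settled a j by rewrite /settled s3.
  have kj : kt a j = (act j).*2.+1 by apply: (i_k2 H).
  rewrite /= /ph3_upd; case: ifP => [/and3P[/eqP t1 t2 t3]|ht].
    have nfj : (j == f) = false.
      by case: eqP => // e1; move: t3; rewrite /= -e1 s3.
    (* The proof serves f before removing it, since the removal relies on the new key of f; the two
       updates touch different components. *)
    have Hc : inv t0 x0 (cand a f (kv a j) j 1).
      apply: inv_ph3_cand => //.
      by move: t3 => /= /orP[/eqP|/andP[/eqP ? /ltW]]; [left|right].
    apply: (inv_ph3_pop Hc) => //=; rewrite -/w -/f /upd ?nfj //; first by lia.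
    move=> _; constructor 1.
    by rewrite eqxx t1 -kj tj xj /lex eqxx lexx orbT.
  apply: inv_ph3_pop => //=; rewrite -/w -/f; first by lia.
  move=> hs15; have hd1 : (dpt f).*2 <= (act j).*2.+1 by rewrite -kj tj;
    apply: (i_dep H).
  have [lt|eq] : dpt f < act j \/ dpt f = act j by lia.
    by constructor 2; lia.
  move: ht; rewrite /ph3_test /= eq eqxx /=.
  have [hb|hb _] := leqP (act j) (art j + be (dst j)).
    case: hs15 => s15; rewrite s15 //= => /negbT; rewrite -leNgt => hle.
    by constructor 1; split=> //; rewrite /lex (i_k1 H af s15) eq -tj kj -xj
      eqxx hle orbT.
  (* If the window of j is closed as soon as j becomes usable, the maximum waiting time is below the
     minimum one, and nothing is ever linked through this vertex. *)
  by constructor 3; move: hb; rewrite sf /act /w ltn_add2l.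
Qed.

(** * The final and the initial state *)

(** A finished run leaves only statuses 4 and 5. Status 5 is excluded for arcs leaving s by [i_src],
    and for f by [i_lnk1], as it would require a linked arc that is not finished. *)
Lemma final_settled t0 x0 a : inv t0 x0 a ->
  (forall x, arc x -> 3 < stt a x) ->
  (forall x, arc x -> src x = s ->
     settled a x /\ (kv a x <= srcval x + wt x)%R) /\
  (forall e f, arc e -> arc f -> settled a e -> lnk e f ->
     settled a f /\ (kv a f <= kv a e + wt f)%R).
Proof.
move=> H hfin; have hs x : arc x -> settled a x \/ stt a x = 5.
  by move=> ax; have := hfin x ax; have := i_st H ax; rewrite /settled; lia.
split=> [x ax sx|e f ae af se le].
  have [h1 _ h2] := i_src H ax sx; case: (hs x ax) => // h.
  by split=> //; apply: h2.
case: (hs f af) => [sf|f5]; first by split=> //; apply: (i_lnk2 H).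
case: (i_lnk1 H ae af se le (or_intror f5)) => [[]|[]]; first by rewrite f5.
by have := hfin e ae; lia.
Qed.

Lemma inv_init a :
  (forall x, arc x -> kt a x = (dpt x).*2) ->
  (forall x, kv a x = 0%R) -> (forall x, stt a x = 0) ->
  (forall v, hd a v = 0) -> (forall v, tl a v = 0) -> (forall v, pc a v = 0) ->
  (forall z, best a z = 0) -> (forall x, ip a x = 0) ->
  (forall x, iq a x = 0) -> inv 0 0 a.
Proof.
move=> hkt hkv hst hhd htl hpc hb hip hiq.
have ns x : settled a x = false by rewrite /settled hst.
split.
- by move=> x _; rewrite hst.
- by move=> x ax _; rewrite hkt // hip hiq.
- by move=> x _; rewrite hst.
- by move=> x _; rewrite ns.
- by move=> x _ _ _; rewrite hiq.
- by move=> x ax _; rewrite /lex hkt // hkv lexx andbT; lia.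
- by move=> x ax; rewrite hst.
- by move=> x ax; rewrite ns.
- by move=> x ax; rewrite hst.
- by move=> x ax _; rewrite hst ns.
- by move=> e f ae af; rewrite ns.
- by move=> e f ae af; rewrite ns.
- by move=> v; rewrite hhd htl.
- by move=> v p; rewrite htl; lia.
- by move=> v p q _ _; rewrite htl.
- by move=> e ae; rewrite hst.
- by move=> v p; rewrite hpc.
- by move=> f p _; rewrite hip.
- by move=> f _; rewrite hst => -[].
- by move=> x _; rewrite hst.
- by move=> x _; rewrite ns.
- by move=> x _; rewrite ns.
- by move=> z; rewrite hb.
- by move=> x _; rewrite ns.
Qed.

(* An arc pays for its changes of status and for one removal from each of the
   two lists. *)
Definition phi a x : nat :=
  nth 4 [:: 6; 4; 3; 1; 0] (stt a x) + (ip a x != 0) + (iq a x != 0).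

Definition Phi a : nat := \sum_(x < E.+1) phi a x.

(** * Every step lowers the potential *)

Lemma Phi_lt a a' y : arc y -> phi a' y < phi a y ->
  (forall x, x != y -> phi a' x = phi a x) -> Phi a' < Phi a.
Proof.
move=> ay hy hx; have yE : y < E.+1 by move: ay; rewrite /arc; lia.
rewrite /Phi (bigD1 (Ordinal yE)) //= [ltnRHS](bigD1 (Ordinal yE)) //=.
by rewrite -addSn leq_add // leq_sum // => i hi; rewrite hx.
Qed.

Lemma Phi_phase t0 x0 a j : inv t0 x0 a -> arc j -> stt a j <= 3 ->
  Phi (phase a j).1 < Phi a.
Proof.
move=> H aj sj; rewrite /phase; case es: (stt a j) => [|[|[|k]]].
- have [_ ipj iqj] := i_k0 H aj es.
  case: ifP => [/andP[h1 h2]|hf].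
    have [g1 g2 g3 g4] := i_dq H (v := src j) (p := hd a (src j)) ltac:(lia).
    apply: (Phi_lt g1); rewrite /phi /= /upd.
      by rewrite eqxx g4 /=; lia.
    by move=> x /negbTE ->.
  apply: (Phi_lt aj); rewrite /= /ph0_leave.
    (* The weight 6 drops to 4 + 1, where 1 pays for the place on the stack. Status 5 falls on the
       default 4 of [nth], the weight of status 1, so that serving an arc later costs nothing by
       itself. *)
    by case: ifP => _; rewrite /phi /= /upd !eqxx es ipj iqj //=; case: ifP.
  by move=> x /negbTE nx; case: ifP => _; rewrite /phi /= /upd nx.
- apply: (Phi_lt aj); rewrite /= /ph1.
    by case: ifP => _; rewrite /phi /= /upd !eqxx es /=; lia.
  by move=> x /negbTE nx; case: ifP => _; rewrite /phi /= /upd nx.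
- case: ifP => [/andP[h1 h2]|hf].
    have [g1 g2 g3 g4] := i_dq H (v := dst j) (p := (tl a (dst j)).-1)
      ltac:(lia).
    apply: (Phi_lt g1); rewrite /phi /= /upd.
      by rewrite eqxx g4 /=; lia.
    by move=> x /negbTE ->.
  have iqj := i_iq H aj ltac:(by rewrite es) ltac:(by rewrite es).
  apply: (Phi_lt aj).
    by rewrite /phi /= /upd !eqxx es iqj /=; lia.
  by move=> x /negbTE nx; rewrite /phi /= /upd nx.
- have s3 : stt a j = 3 by lia.
  case: eqP => [h0|/eqP h0].
    apply: (Phi_lt aj); first by rewrite /phi /= /upd eqxx s3 /=; lia.
    by move=> x /negbTE nx; rewrite /phi /= /upd nx.
  have [g1 g2 g3 g4] := i_pa H (v := dst j) (p := (pc a (dst j)).-1) ltac:(lia).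
  apply: (Phi_lt g1); rewrite /= /ph3_upd.
    case: ifP => [/and3P[_ _ h]|_]; rewrite /phi /= /upd eqxx g3 /=;
      last by lia.
    by move: h => /= /orP[/eqP ->|/andP[/eqP -> _]] /=; lia.
  by move=> x /negbTE nx; case: ifP => _; rewrite /phi /= /upd nx.
Qed.

(** * Bounds on the stored numbers *)

Variables W N0 : nat.
Hypothesis wtW : forall x, arc x -> absz (wt x) <= W.
Hypothesis srcW : forall x, arc x -> absz (srcval x) <= W.

(** A step lowers [Phi] by at least 1, while it raises a pointer by at most 1 and the largest
    absolute value of [kv] by at most W. The additional W in [b_kv] leaves room for the value of a
    walk that starts with the current arc. *)
Record bnd (a : astate) : Prop := Bnd {
  b_tl : forall v, tl a v + Phi a <= N0;
  b_pc : forall v, pc a v + Phi a <= N0;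
  b_kv : forall x, arc x -> absz (kv a x) + W * Phi a <= W * N0.+1
}.

Lemma bnd_phase t0 x0 a j : inv t0 x0 a -> arc j -> stt a j <= 3 ->
  bnd a -> bnd (phase a j).1.
Proof.
move=> H aj sj [b1 b2 b3]; have hPhi := Phi_phase H aj sj.
set a' := (phase a j).1 in hPhi *.
have step v : tl a' v <= (tl a v).+1 /\ pc a' v <= (pc a v).+1.
  rewrite /a' /phase /ph0_leave /ph1 /ph3_upd.
  case: (stt a j) => [|[|[|k]]]; repeat case: ifP => _ //=; rewrite /= ?/upd;
    do ?[case: eqP => [->|_]]; lia.
have leW x : arc x -> absz (kv a x) <= W * N0.+1 - W * Phi a.
  by move=> ax; have := b3 x ax; lia.
have kvs x : arc x ->
    [\/ absz (kv a' x) <= W, exists2 y, arc y & absz (kv a' x) <= absz (kv a y)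
      | exists2 y, arc y & absz (kv a' x) <= absz (kv a y) + W].
{ move=> ax; rewrite /a' /phase /ph0_leave /ph1 /ph3_upd.
  case es: (stt a j) => [|[|[|k]]].
  - case: ifP => [_|hf]; first by constructor 2; exists x.
    case: ifP => [/andP[h1 h2]|h1] /=; rewrite /upd.
      case: eqP => _; last by constructor 2; exists x.
      have [g1 _ _ _] := i_dq H (v := src j) (p := hd a (src j)) ltac:(rewrite
        leqnn; exact: h1).
      by constructor 2; eexists; first exact: g1.
    case: eqP => _; last by constructor 2; exists x.
    by constructor 1; apply: srcW.
  - have g : exists2 y, arc y & absz (upd (kv a) j (kv a j + wt j)%R x) <= absz
      (kv a y) + W.
      rewrite /upd; case: eqP => _; last by exists x => //; lia.
      by exists j => //; have := wtW aj; lia.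
    by case: ifP => _; constructor 3.
  - by case: ifP => _; constructor 2; exists x.
  - case: eqP => _; first by constructor 2; exists x.
    case: ifP => _; last by constructor 2; exists x.
    by rewrite /= /upd; case: eqP => _; constructor 2; [exists j|exists x]. }
have hW : W * Phi a' + W <= W * Phi a by rewrite addnC -mulnS leq_mul2l hPhi
  orbT.
have hN : W * Phi a <= W * N0 by rewrite leq_mul2l; apply/orP; right;
  have := b1 0; lia.
split.
- by move=> v; have [h _] := step v; have := b1 v; lia.
- by move=> v; have [_ h] := step v; have := b2 v; lia.
- move=> x ax; rewrite mulnS; case: (kvs x ax) => [h|[y ay h]|[y ay h]].
  + by lia.
  + by have := b3 y ay; rewrite mulnS; lia.
  + by have := b3 y ay; rewrite mulnS; lia.
Qed.

End Algorithm.

(** * The tournament tree *)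

Definition keyle a x y := lex (kt a x) (kv a x) (kt a y) (kv a y).

Definition better a x y :=
  if x == 0 then y else if y == 0 then x else if keyle a x y then x else y.

Definition uptr a i := set_tr a i (better a (tr a i.*2) (tr a i.*2.+1)).

Definition with_tr a t := AState t (kt a) (kv a) (stt a)
  (prd a) (idx a) (hd a) (tl a) (dq a) (pc a) (pa a) (best a) (ip a) (iq a).

Lemma lex_refl t x : lex t x t x.
Proof. by rewrite /lex eqxx lexx orbT. Qed.

(* Node i has the children 2i and 2i + 1; the leaf of the arc x is n + x. *)
Section Tournament.
Variable n : nat.
Hypothesis n_gt0 : 0 < n.

Definition node_ok a i := tr a i = better a (tr a i.*2) (tr a i.*2.+1).

Definition leaves_ok (L : nat -> bool) a :=
  forall i, i < n -> tr a (n + i) = if L i then i else 0.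

Definition tree_ok (L : nat -> bool) a :=
  leaves_ok L a /\ forall i, 0 < i < n -> node_ok a i.

(* Every internal node is right, except possibly the strict ancestors of i. *)
Definition tree_ok_but (L : nat -> bool) i a :=
  leaves_ok L a /\
  forall k, 0 < k < n -> node_ok a k \/ exists m, k = iter m.+1 half i.

Lemma better_or a x y : better a x y = x \/ better a x y = y.
Proof. by rewrite /better; do 3?case: ifP => _; [right|left|left|right]. Qed.

(** An arc can appear only at ancestors of its leaf; this confines the effect of a changed key to
    one path. *)
Lemma tree_winner L a c : tree_ok L a -> 0 < c < n.*2 -> tr a c != 0 ->
  L (tr a c) /\ tr a c < n /\ exists m, c = iter m half (n + tr a c).
Proof.
move=> [hl hn]; move: {2}(n.*2 - c) (leqnn (n.*2 - c)) => k.
elim: k c => [|k IH] c hk hc h0; first by lia.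
have [hcn|hcn] := leqP n c.
  have ec : c = n + (c - n) by lia.
  have := hl (c - n) ltac:(lia); rewrite -ec.
  case: ifP => [hL e1|_ e1]; last by rewrite e1 in h0.
  by rewrite e1; split=> //; split; [lia|exists 0].
have nk : node_ok a c by apply: hn; lia.
have [e1|e1] := better_or a (tr a c.*2) (tr a c.*2.+1);
  rewrite /node_ok e1 in nk; rewrite nk in h0 *.
  have [h1 [h2 [m h3]]] := IH c.*2 ltac:(lia) ltac:(lia) h0.
  by split=> //; split=> //; exists m.+1; rewrite iterS -h3 doubleK.
have [h1 [h2 [m h3]]] := IH c.*2.+1 ltac:(lia) ltac:(lia) h0.
by split=> //; split=> //; exists m.+1; rewrite iterS -h3 /= uphalf_double.
Qed.

Lemma better_beats a x y :
  (x != 0 -> better a x y != 0 /\ keyle a (better a x y) x) /\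
  (y != 0 -> better a x y != 0 /\ keyle a (better a x y) y).
Proof.
rewrite /better; case: (eqVneq x 0) => [e|nx].
  by split=> //; rewrite /keyle lex_refl.
case: (eqVneq y 0) => [e|ny]; first by split=> // _; rewrite /keyle lex_refl.
case: ifP => h; split=> _; rewrite ?nx ?ny /keyle ?lex_refl //; split=> //.
by move: h; rewrite /keyle /lex; lia.
Qed.

Lemma root_beats L a c : tree_ok L a -> 0 < c < n.*2 -> tr a c != 0 ->
  tr a 1 != 0 /\ keyle a (tr a 1) (tr a c).
Proof.
move=> [hl hn]; move: {2}c (leqnn c) => k.
elim: k c => [|k IH] c hk hc h0; first by lia.
have [c1|nc1] := eqVneq c 1; first by rewrite c1 in h0 *;
  rewrite /keyle lex_refl.
have nk : node_ok a c./2 by apply: hn; lia.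
have [b1 b2] := better_beats a (tr a c./2.*2) (tr a c./2.*2.+1).
rewrite -nk in b1 b2.
have [h1 h2] : tr a c./2 != 0 /\ keyle a (tr a c./2) (tr a c).
  have := odd_double_half c; case: (odd c) => ec.
    by rewrite add1n in ec; rewrite ec in b2; apply: b2.
  by rewrite add0n in ec; rewrite ec in b1; apply: b1.
have [h3 h4] := IH c./2 ltac:(lia) ltac:(lia) h1; split=> //.
by move: h2 h4; rewrite /keyle /lex; lia.
Qed.

Lemma tree_root0 L a x : tree_ok L a -> tr a 1 = 0 -> x < n -> L x -> x = 0.
Proof.
move=> ht h1 hx hL; apply/eqP/contraT => x0.
have lf := ht.1 x hx; rewrite hL in lf.
have := @root_beats L a (n + x) ht ltac:(lia); rewrite lf h1 => /(_ x0).
by case.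
Qed.

Lemma tree_root L a : tree_ok L a -> tr a 1 != 0 ->
  [/\ L (tr a 1), tr a 1 < n
    & forall x, 0 < x < n -> L x -> keyle a (tr a 1) x].
Proof.
move=> ht h1; have [h2 [h3 _]] := tree_winner (c := 1) ht ltac:(lia) h1.
split=> // x hx hL; have lf := ht.1 x ltac:(lia); rewrite hL in lf.
have [|_] := @root_beats L a (n + x) ht ltac:(lia); rewrite lf //; lia.
Qed.

(** Nodes store arcs and not keys, so a new key of u disturbs only the nodes that have its leaf as a
    child or compare u with another arc. By [tree_winner] these are ancestors of the leaf. *)
Lemma tree_update_start (L L' : nat -> bool) a a' (u : nat) : tree_ok L a -> 0 <
  u < n ->
  tr a' = tr a ->
  (forall x : nat, x != u ->
     [/\ kt a' x = kt a x, kv a' x = kv a x & L' x = L x]) ->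
  tree_ok_but L' (n + u) (set_tr a' (n + u) (if L' u then u else 0)).
Proof.
move=> ht hu etr agree; have [hl hn] := ht; split.
  move=> i hi /=; rewrite /upd eqn_add2l; case: eqP => [->//|/eqP ni].
  by have [_ _ ->] := agree i ni; rewrite etr hl.
move=> k hk.
have [e1|[ne1 ne1']] : (n + u = k.*2 \/ n + u = k.*2.+1) \/
   (k.*2 != n + u /\ k.*2.+1 != n + u) by lia.
  by right; exists 0 => /=; case: e1 => ->; rewrite ?doubleK //= uphalf_double.
have [e2|ne2] : (tr a k.*2 = u \/ tr a k.*2.+1 = u) \/
   (tr a k.*2 != u /\ tr a k.*2.+1 != u) by lia.
  right; case: e2 => e2.
    have [_ [_ [m hm]]] := tree_winner (c := k.*2) ht ltac:(lia) ltac:(lia).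
    by exists m; rewrite iterS -e2 -hm doubleK.
  have [_ [_ [m hm]]] := tree_winner (c := k.*2.+1) ht ltac:(lia) ltac:(lia).
  by exists m; rewrite iterS -e2 -hm /= uphalf_double.
left; rewrite /node_ok /= /upd etr.
have -> : (k == n + u) = false by lia.
have -> : (k.*2 == n + u) = false by lia.
have -> : (k.*2.+1 == n + u) = false by lia.
rewrite (hn k hk) /better /keyle /=.
have [-> -> _] := agree _ ne2.1; have [-> -> _] := agree _ ne2.2.
by [].
Qed.

Lemma tree_update_step L a i : tree_ok_but L i a -> 1 < i < n.*2 ->
  tree_ok_but L i./2 (uptr a i./2).
Proof.
move=> [hl hn] hi; split.
  move=> k hk; rewrite /= /upd.
  have -> : (n + k == i./2) = false by lia.
  exact: hl.
move=> k hk; have [e1|ne1] := eqVneq k i./2.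
  left; rewrite /node_ok /= /upd e1 eqxx.
  have -> : (i./2.*2 == i./2) = false by lia.
  have -> : (i./2.*2.+1 == i./2) = false by lia.
  by [].
have [e2|ne2] := eqVneq k i./2./2; first by right; exists 0.
case: (hn k hk) => [ok|[[|m] hm]].
- left; rewrite /node_ok /= /upd (negbTE ne1).
  have -> : (k.*2 == i./2) = false by lia.
  have -> : (k.*2.+1 == i./2) = false by lia.
  exact: ok.
- by move: ne1; rewrite hm eqxx.
- by right; exists m; rewrite hm -iterSr.
Qed.

(** Repeated halving of 0 or 1 gives only 0, which is not a node. *)
Lemma tree_update_end L a i : tree_ok_but L i a -> i < 2 -> tree_ok L a.
Proof.
move=> [hl hn] hi; split=> // k hk; case: (hn k hk) => // -[m hm].
suff h : iter m.+1 half i = 0 by lia.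
elim: m {hm} => [|m IH]; last by rewrite iterS IH.
by case: i hi {hn} => [|[]].
Qed.

End Tournament.

(** * What a step leaves unchanged *)

Section PhaseFrame.
Variables (E s : nat) (src dst dpt dt al be : nat -> nat).
Variables (wt : nat -> int) (cA cB : int).
Notation phaseG := (phase s src dst dpt dt al be wt cA cB).
Notation invG := (inv E s src dst dpt dt al be wt cA cB).

Lemma inv_with_tr t0 x0 a t : invG t0 x0 a -> invG t0 x0 (with_tr a t).
Proof.
move=> H; case: (H) => *; split=> // x ax sx.
by have [l hl] := i_chain H ax sx; exists l; apply: chain_agree hl.
Qed.

Lemma phase_frame t0 x0 a j : invG t0 x0 a -> arc E j -> stt a j <= 3 ->
  [/\ arc E (phaseG a j).2, tr (phaseG a j).1 = tr a
    & forall x, x != (phaseG a j).2 ->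
      [/\ kt (phaseG a j).1 x = kt a x, kv (phaseG a j).1 x = kv a x
        & stt (phaseG a j).1 x = stt a x]].
Proof.
move=> H aj sj; rewrite /phaseG; case es: (stt a j) => [|[|[|k]]] /=.
- case: ifP => _; split=> //; rewrite /ph0_leave; first by case: ifP.
  by move=> x /negbTE nx; case: ifP => _ /=; rewrite /upd nx.
- split=> //; rewrite /ph1; first by case: ifP.
  by move=> x /negbTE nx; case: ifP => _ /=; rewrite /upd nx.
- case: ifP => _; split=> //.
  by move=> x /negbTE nx /=; rewrite /upd nx.
- case: eqP => [h0|/eqP h0] /=.
    by split=> // x /negbTE nx; rewrite /upd nx.
  have [g1 _ _ _] := i_pa H (v := dst j) (p := (pc a (dst j)).-1) ltac:(lia).
  split=> //; rewrite /ph3_upd; first by case: ifP.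
  by move=> x /negbTE nx; case: ifP => _ //=; rewrite /upd nx.
Qed.

End PhaseFrame.

(** * The program *)

(* Register 0: output table; 1: current arc; 2: arc whose leaf is updated;
   3: tree node; 4, 5: A, B; 6, 7, 8: coefficients of wt; 10: D.
   Array r < 16 has its entry i at address - (16 i + r + 1), so that the cell
   (idx, prd) of an arc, in the arrays 5 and 4, is a list cell; arrays indexed
   by a vertex v and a position p use i = p |V| + v. *)
Definition c_ (k : nat) : expr := Cst k%:Z.
Definition eAdd := Bin OAdd.
Definition eSub := Bin OSub.
Definition eMul := Bin OMul.
Definition eLe := Bin OLe.
Definition eLt x y := eLe (eAdd x (c_ 1)) y.
Definition eAnd := Bin OMul.
Definition eNot x := eSub (c_ 1) x.
Definition eOr x y := eNot (eAnd (eNot x) (eNot y)).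
Definition eEq x y := eAnd (eLe x y) (eLe y x).

Definition nV := Read (c_ 0).
Definition nE := Read (c_ 2).
Definition nS := Read (c_ 3).

Definition eAddr (r : nat) (e : expr) := eSub (Cst (- (r.+1)%:Z)) (eMul (c_ 16)
  e).
Definition eArr r e := Read (eAddr r e).
Definition eIn (k : nat) e :=
  Read (eAdd (eAdd (c_ (13 + k)) (eMul (c_ 2) nV)) (eMul (c_ 5) e)).
Definition eSrc := eIn 0.
Definition eDst := eIn 1.
Definition eDep := eIn 2.
Definition eDur := eIn 3.
Definition eCst := eIn 4.
Definition eAl v := Read (eAdd (c_ 18) v).
Definition eBe v := Read (eAdd (eAdd (c_ 18) nV) v).
Definition eArt e := eAdd (eDep e) (eDur e).
Definition eAct e := eAdd (eArt e) (eAl (eDst e)).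
Definition eIx v p := eAdd (eMul p nV) v.
Definition eCell e := eAddr 5 e.
Definition eDbl x := eMul (c_ 2) x.
Definition eDblS x := eAdd (eDbl x) (c_ 1).

Definition eTr := eArr 0.
Definition eKt := eArr 1.
Definition eKv := eArr 2.
Definition eSt := eArr 3.
Definition eHd := eArr 6.
Definition eTl := eArr 7.
Definition eDq v p := eArr 8 (eIx v p).
Definition ePc := eArr 9.
Definition ePa v p := eArr 10 (eIx v p).
Definition eBest := eArr 11.
Definition wArr r i x := Write (eAddr r i) x.

Definition rJ := Reg 1.
Definition rU := Reg 2.
Definition rI := Reg 3.
Definition eWt e :=
  eAdd (eAdd (eMul (Reg 6) (eDur e)) (eMul (Reg 7) (eCst e))) (Reg 8).
Definition eSrcval e := eSub (c_ 0) (eMul (Reg 5) (eDep e)).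
Definition eOutval e := eAdd (eKv e) (eMul (Reg 4) (eArt e)).

Definition candC f h p st :=
  Seq (wArr 2 f h) (Seq (wArr 1 f (eDblS (eDep f)))
    (Seq (wArr 4 f p) (wArr 3 f st))).

Definition frontE := eDq (eSrc rJ) (eHd (eSrc rJ)).

Definition leaveC :=
  Seq (wArr 10 (eIx (eSrc rJ) (ePc (eSrc rJ))) rJ)
 (Seq (wArr 9 (eSrc rJ) (eAdd (ePc (eSrc rJ)) (c_ 1)))
  (If (eAnd (eLt (eHd (eSrc rJ)) (eTl (eSrc rJ)))
         (eNot (eAnd (eEq (eSrc rJ) nS) (eLe (eSrcval rJ) (eKv frontE)))))
     (candC rJ (eKv frontE) (eCell frontE) (c_ 1))
     (If (eEq (eSrc rJ) nS)
        (candC rJ (eSrcval rJ) (c_ 0) (c_ 1))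
        (candC rJ (eSrcval rJ) (c_ 0) (c_ 5))))).

(** The conjunction in [phase] becomes a nested test because [eAnd] evaluates both sides, and the
    front is known to be an arc only if the deque is nonempty. The nesting in [ph1C] and [ph2C] has
    similar reasons. *)
Definition ph0C :=
  If (eLt (eHd (eSrc rJ)) (eTl (eSrc rJ)))
    (If (eLt (eAdd (eArt frontE) (eBe (eSrc rJ))) (eDep rJ))
       (wArr 6 (eSrc rJ) (eAdd (eHd (eSrc rJ)) (c_ 1)))
       leaveC)
    leaveC.

(** The output table is kept up to date throughout, so no final pass over the vertices is made. *)
Definition setbestC :=
  Seq (wArr 11 (eDst rJ) rJ) (Write (eAdd (Reg 0) (eDst rJ)) (eCell rJ)).

Definition ph1C :=
  Seq (wArr 2 rJ (eAdd (eKv rJ) (eWt rJ)))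
 (Seq (wArr 1 rJ (eDblS (eAct rJ)))
 (Seq (wArr 3 rJ (c_ 2))
 (Seq (wArr 5 rJ (eSub rJ (c_ 1)))
   (If (eLe (eBest (eDst rJ)) (c_ 0)) setbestC
     (If (eLe (eOutval rJ) (eOutval (eBest (eDst rJ)))) setbestC Skip))))).

Definition pushC :=
  Seq (wArr 8 (eIx (eDst rJ) (eTl (eDst rJ))) rJ)
 (Seq (wArr 7 (eDst rJ) (eAdd (eTl (eDst rJ)) (c_ 1)))
    (wArr 3 rJ (c_ 3))).

Definition ph2C :=
  If (eLt (eHd (eDst rJ)) (eTl (eDst rJ)))
    (If (eLe (eKv rJ) (eKv (eDq (eDst rJ) (eSub (eTl (eDst rJ)) (c_ 1)))))
       (wArr 7 (eDst rJ) (eSub (eTl (eDst rJ)) (c_ 1)))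
       pushC)
    pushC.

Definition testE :=
  eAnd (eEq (eDep rU) (eAct rJ))
 (eAnd (eLe (eAct rJ) (eAdd (eArt rJ) (eBe (eDst rJ))))
    (eOr (eEq (eSt rU) (c_ 5))
         (eAnd (eEq (eSt rU) (c_ 1)) (eNot (eLe (eKv rU) (eKv rJ)))))).

Definition ph3C :=
  If (eLe (ePc (eDst rJ)) (c_ 0)) (wArr 3 rJ (c_ 4))
    (Seq (Assign 2 (ePa (eDst rJ) (eSub (ePc (eDst rJ)) (c_ 1))))
    (Seq (wArr 9 (eDst rJ) (eSub (ePc (eDst rJ)) (c_ 1)))
      (If testE (candC rU (eKv rJ) (eCell rJ) (c_ 1)) Skip))).

Definition phaseC :=
  Seq (Assign 1 (eTr (c_ 1)))
 (Seq (Assign 2 rJ)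
   (If (eLe (eSt rJ) (c_ 0)) ph0C
   (If (eLe (eSt rJ) (c_ 1)) ph1C
   (If (eLe (eSt rJ) (c_ 2)) ph2C ph3C)))).

Definition nodeC :=
  let l := eTr (eDbl rI) in
  let r := eTr (eDblS rI) in
  If (eLe l (c_ 0)) (wArr 0 rI r)
 (If (eLe r (c_ 0)) (wArr 0 rI l)
 (If (eOr (eLt (eKt l) (eKt r))
        (eAnd (eEq (eKt l) (eKt r)) (eLe (eKv l) (eKv r))))
    (wArr 0 rI l) (wArr 0 rI r))).

(** The product stores 0 in the leaf of an arc that has left the queue or is not in it, i.e. with
    status 4 or 5. *)
Definition leafC :=
  Seq (wArr 0 (eAdd (eAdd nE (c_ 1)) rU) (eMul rU (eLe (eSt rU) (c_ 3))))
    (Assign 3 (eAdd (eAdd nE (c_ 1)) rU)).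

Definition climbC := Seq (Assign 3 (Bin ODiv rI (c_ 2))) nodeC.
Definition treeC := Seq leafC (While (eLe (c_ 2) rI) climbC).

Definition insertC :=
  Seq (Assign 2 (eAdd rU (c_ 1))) (wArr 1 rU (eDbl (eDep rU))).

Definition loopsC :=
  Seq (While (eLt rU nE) (Seq insertC treeC))
      (While (eTr (c_ 1)) (Seq phaseC treeC)).

(* The record keeps unification from evaluating [cdeg loopsC]. *)
Record deg_le D : Prop := DegLe { deg_loops : cdeg loopsC <= D }.

(** * The program implements the simulation *)

Section Refinement.

Variables (inp : nat -> nat) (V E s : nat) (cA cB w1 w2 w3 : int).
Hypotheses (inpV : inp 0 = V) (inpE : inp 2 = E) (inpS : inp 3 = s).
(** The arcs are preceded by 4 header cells, 14 cells for the fractions and 2V waiting times. As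
    arcs are numbered from 1, their offsets start at 13 = 18 - 5. *)
Definition base := 18 + V.*2 + 5 * E.
Definition isrc x := inp (13 + V.*2 + 5 * x).
Definition idst x := inp (14 + V.*2 + 5 * x).
Definition idep x := inp (15 + V.*2 + 5 * x).
Definition idur x := inp (16 + V.*2 + 5 * x).
Definition icst x := inp (17 + V.*2 + 5 * x).
Definition ial v := inp (18 + v).
Definition ibe v := inp (18 + V + v).
Definition iwt x : int := (w1 * (idur x)%:Z + w2 * (icst x)%:Z + w3)%R.

Notation iarc := (arc E).
Notation iart := (art idep idur).
Notation iact := (act idst idep idur ial).
Notation isrcval := (srcval idep cB).
Notation ioutval := (outval idep idur cA).
Notation icand := (cand idep).

Hypothesis srcV : forall x, iarc x -> isrc x < V.
Hypothesis dstV : forall x, iarc x -> idst x < V.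

(** Number 16 stands for the output table, placed right after the input. The negative addresses
    leave all other arrays unbounded and initially 0. *)
Definition addr (r i : nat) : int :=
  if r == 16 then (base + i)%:Z else (- (16 * i + r.+1)%:Z)%R.

Definition cellz (e : nat) : int := if e == 0 then 0%R else addr 5 e.

Definition field (a : astate) (r i : nat) : int :=
  match r with
  | 0 => (tr a i)%:Z
  | 1 => (kt a i)%:Z
  | 2 => kv a i
  | 3 => (stt a i)%:Z
  | 4 => cellz (prd a i)
  | 5 => (idx a i)%:Z
  | 6 => (hd a i)%:Z
  | 7 => (tl a i)%:Z
  | 8 => (dq a (i %% V) (i %/ V))%:Z
  | 9 => (pc a i)%:Z
  | 10 => (pa a (i %% V) (i %/ V))%:Z
  | 11 => (best a i)%:Z
  | 16 => cellz (best a i)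
  | _ => 0%R
  end.

(** The contents F are arbitrary because between the two writes of [setbestC] the memory need not
    represent any [astate]. *)
Definition repF (st : state) (F : nat -> nat -> int) :=
  (forall i, i < base -> memory st i%:Z = (inp i)%:Z) /\
  (forall r i, r <= 16 -> memory st (addr r i) = F r i).

Record rep (st : state) (a : astate) (j u i : nat) : Prop := Rep {
  rep_mem : repF st (field a);
  rep_j : regs st 1 = j%:Z;
  rep_u : regs st 2 = u%:Z;
  rep_i : regs st 3 = i%:Z;
  rep_cst : [/\ regs st 0 = base%:Z, regs st 4 = cA, regs st 5 = cB
              & [/\ regs st 6 = w1, regs st 7 = w2 & regs st 8 = w3]]
}.

Lemma repF_write st F F' r i v : r <= 16 -> repF st F ->
  (forall r' i', r' <= 16 ->
     F' r' i' = if (r' == r) && (i' == i) then v else F r' i') ->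
  repF (set_mem st (addr r i) v) F'.
Proof.
move=> hr [h1 h2] hF; split.
  move=> k hk /=; rewrite h1 //; case: eqP => // e.
  by move: e; rewrite /addr; case: ifP => _; lia.
move=> r' i' hr' /=; rewrite hF // h2 //.
have -> : (addr r' i' == addr r i) = (r' == r) && (i' == i).
  apply/idP/idP; last by case/andP => /eqP -> /eqP ->.
  rewrite /addr; case: ifP; case: ifP; move/eqP => h3 /eqP h4 /eqP; lia.
by [].
Qed.

Definition ezn st e (v : nat) := eval st e = v%:Z.
Definition ez st e (v : int) := eval st e = v.
Definition eb st e (b : bool) := eval st e = (b : nat)%:Z.

Lemma eval_input_arc st k x m :
  (forall i, i < base -> memory st i%:Z = (inp i)%:Z) ->
  k < 5 -> ezn st x m -> m <= E ->
  ezn st (eIn k x) (inp (13 + k + V.*2 + 5 * m)).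
Proof.
move=> hmem hk hx hm; rewrite /ezn /=.
have -> : memory st 0%Z = V by rewrite (hmem 0) // inpV.
move: hx; rewrite /ezn => ->.
have -> : ((13 + k)%:Z + 2%:Z * V%:Z + 5%:Z * m%:Z)%R =
    (13 + k + V.*2 + 5 * m)%:Z by lia.
by rewrite hmem // /base; lia.
Qed.

(** * Values of expressions in a represented state *)

Section Eval.
Variables (st : state) (a : astate) (j u i : nat).
Hypothesis R : rep st a j u i.

Lemma ezn_c k : ezn st (c_ k) k. Proof. by []. Qed.
Lemma ezn_J : ezn st rJ j. Proof. exact: rep_j R. Qed.
Lemma ezn_U : ezn st rU u. Proof. exact: rep_u R. Qed.
Lemma ezn_I : ezn st rI i. Proof. exact: rep_i R. Qed.

Lemma ezn_in k : k < base -> eval st (Read (c_ k)) = (inp k)%:Z.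
Proof. by move=> h; rewrite /= (rep_mem R).1. Qed.

Lemma ezn_V : ezn st nV V.
Proof. by rewrite /ezn ezn_in ?inpV. Qed.
Lemma ezn_E : ezn st nE E.
Proof. by rewrite /ezn ezn_in ?inpE. Qed.
Lemma ezn_S : ezn st nS s.
Proof. by rewrite /ezn ezn_in ?inpS. Qed.

Lemma ezn_add x y m n : ezn st x m -> ezn st y n -> ezn st (eAdd x y) (m + n).
Proof. by rewrite /ezn /= => -> ->. Qed.
Lemma ezn_mul x y m n : ezn st x m -> ezn st y n -> ezn st (eMul x y) (m * n).
Proof. by rewrite /ezn /= => -> ->. Qed.
Lemma ezn_sub1 x m : 0 < m -> ezn st x m -> ezn st (eSub x (c_ 1)) m.-1.
Proof. by rewrite /ezn /= => h ->; lia. Qed.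
Lemma ezn_dbl x m : ezn st x m -> ezn st (eDbl x) m.*2.
Proof. by rewrite /ezn /= => ->; lia. Qed.
Lemma ezn_dblS x m : ezn st x m -> ezn st (eDblS x) m.*2.+1.
Proof. by rewrite /ezn /= => ->; lia. Qed.

Lemma eval_addr r x m : r < 16 -> ezn st x m -> eval st (eAddr r x) = addr r m.
Proof. by rewrite /ezn /addr /= => hr ->; case: eqP => [|_]; lia. Qed.

Lemma eval_arr r x m : r < 16 -> ezn st x m -> eval st (eArr r x) = field a r m.
Proof.
move=> hr hx; rewrite /eArr.
have -> : eval st (Read (eAddr r x)) = memory st (eval st (eAddr r x)) by [].
by rewrite (eval_addr hr hx) (rep_mem R).2 //; lia.
Qed.

Lemma ezn_tr x m : ezn st x m -> ezn st (eTr x) (tr a m).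
Proof. by move=> h; rewrite /ezn (@eval_arr 0 x m). Qed.
Lemma ezn_kt x m : ezn st x m -> ezn st (eKt x) (kt a m).
Proof. by move=> h; rewrite /ezn (@eval_arr 1 x m). Qed.
Lemma ez_kv x m : ezn st x m -> ez st (eKv x) (kv a m).
Proof. by move=> h; rewrite /ez (@eval_arr 2 x m). Qed.
Lemma ezn_st x m : ezn st x m -> ezn st (eSt x) (stt a m).
Proof. by move=> h; rewrite /ezn (@eval_arr 3 x m). Qed.
Lemma ezn_hd x m : ezn st x m -> ezn st (eHd x) (hd a m).
Proof. by move=> h; rewrite /ezn (@eval_arr 6 x m). Qed.
Lemma ezn_tl x m : ezn st x m -> ezn st (eTl x) (tl a m).
Proof. by move=> h; rewrite /ezn (@eval_arr 7 x m). Qed.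
Lemma ezn_pc x m : ezn st x m -> ezn st (ePc x) (pc a m).
Proof. by move=> h; rewrite /ezn (@eval_arr 9 x m). Qed.
Lemma ezn_best x m : ezn st x m -> ezn st (eBest x) (best a m).
Proof. by move=> h; rewrite /ezn (@eval_arr 11 x m). Qed.
Lemma ezn_ix v p m n : ezn st v m -> ezn st p n -> ezn st (eIx v p) (n * V + m).
Proof. by move=> h1 h2; apply: ezn_add => //; apply: ezn_mul => //;
  apply: ezn_V. Qed.
Lemma ezn_dq v p m n : ezn st v m -> ezn st p n -> m < V ->
  ezn st (eDq v p) (dq a m n).
Proof.
move=> h1 h2 hm; rewrite /ezn (@eval_arr 8 _ (n * V + m)) //=;
  last exact: ezn_ix.
by rewrite modnMDl modn_small // divnMDl ?divn_small ?addn0 //; lia.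
Qed.
Lemma ezn_pa v p m n : ezn st v m -> ezn st p n -> m < V ->
  ezn st (ePa v p) (pa a m n).
Proof.
move=> h1 h2 hm; rewrite /ezn (@eval_arr 10 _ (n * V + m)) //=;
  last exact: ezn_ix.
by rewrite modnMDl modn_small // divnMDl ?divn_small ?addn0 //; lia.
Qed.

Lemma eval_read e : eval st (Read e) = memory st (eval st e).
Proof. by []. Qed.
Lemma eval_add x y : eval st (eAdd x y) = (eval st x + eval st y)%R.
Proof. by []. Qed.
Lemma eval_mul x y : eval st (eMul x y) = (eval st x * eval st y)%R.
Proof. by []. Qed.
Lemma eval_sub x y : eval st (eSub x y) = (eval st x - eval st y)%R.
Proof. by []. Qed.

Lemma ezn_eIn k x m : k < 5 -> ezn st x m -> m <= E ->
  ezn st (eIn k x) (inp (13 + k + V.*2 + 5 * m)).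
Proof. exact: eval_input_arc (rep_mem R).1. Qed.

Lemma ezn_src x m : ezn st x m -> m <= E -> ezn st (eSrc x) (isrc m).
Proof. exact: (@ezn_eIn 0). Qed.
Lemma ezn_dst x m : ezn st x m -> m <= E -> ezn st (eDst x) (idst m).
Proof. exact: (@ezn_eIn 1). Qed.
Lemma ezn_dep x m : ezn st x m -> m <= E -> ezn st (eDep x) (idep m).
Proof. exact: (@ezn_eIn 2). Qed.
Lemma ezn_dur x m : ezn st x m -> m <= E -> ezn st (eDur x) (idur m).
Proof. exact: (@ezn_eIn 3). Qed.
Lemma ezn_cst x m : ezn st x m -> m <= E -> ezn st (eCst x) (icst m).
Proof. exact: (@ezn_eIn 4). Qed.
Lemma ezn_al v m : ezn st v m -> m < V -> ezn st (eAl v) (ial m).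
Proof.
move=> hv hm; have ha := ezn_add (ezn_c 18) hv.
by rewrite /ezn eval_read ha (rep_mem R).1 // /base; lia.
Qed.
Lemma ezn_be v m : ezn st v m -> m < V -> ezn st (eBe v) (ibe m).
Proof.
move=> hv hm; have ha := ezn_add (ezn_add (ezn_c 18) ezn_V) hv.
by rewrite /ezn eval_read ha (rep_mem R).1 // /base; lia.
Qed.
Lemma ezn_art x m : ezn st x m -> m <= E -> ezn st (eArt x) (iart m).
Proof. by move=> h hx; apply: ezn_add; [apply: ezn_dep|apply: ezn_dur]. Qed.
Lemma ezn_act x m : ezn st x m -> iarc m -> ezn st (eAct x) (iact m).
Proof.
move=> hx h; have hm : m <= E by case/andP: h.
apply: ezn_add; first exact: ezn_art.
by apply: ezn_al; [apply: ezn_dst|apply: dstV].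
Qed.
Lemma ez_wt x m : ezn st x m -> m <= E -> ez st (eWt x) (iwt m).
Proof.
move=> hx h; rewrite /ez /eWt 2!eval_add 2!eval_mul.
have := ezn_dur hx h; have := ezn_cst hx h; rewrite /ezn => -> -> /=.
by have [_ _ _ [-> -> ->]] := rep_cst R.
Qed.
Lemma ez_srcval x m : ezn st x m -> m <= E -> ez st (eSrcval x) (isrcval m).
Proof.
move=> hx h; rewrite /ez /eSrcval eval_sub eval_mul.
have := ezn_dep hx h; rewrite /ezn => -> /=.
by have [_ _ -> _] := rep_cst R; rewrite /isrcval; lia.
Qed.
Lemma ez_outval x m : ezn st x m -> m <= E -> ez st (eOutval x) (ioutval a m).
Proof.
move=> hx h; rewrite /ez /eOutval eval_add eval_mul.
have := ezn_art hx h; have := ez_kv hx; rewrite /ezn /ez => -> -> /=.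
by have [_ -> _ _] := rep_cst R.
Qed.
Lemma ez_cell x m : ezn st x m -> 0 < m -> ez st (eCell x) (cellz m).
Proof.
move=> hx h; rewrite /ez (@eval_addr 5 x m) // /cellz.
by case: eqP => // e; rewrite e in h.
Qed.
Lemma ez_n x m : ezn st x m -> ez st x m%:Z.
Proof. by []. Qed.

Lemma eb_le x y m n : ezn st x m -> ezn st y n -> eb st (eLe x y) (m <= n).
Proof. by rewrite /ezn /eb /= => -> ->; rewrite lez_nat; case: leqP. Qed.
Lemma eb_lez x y m n : ez st x m -> ez st y n -> eb st (eLe x y) (m <= n)%R.
Proof. by rewrite /ez /eb /= => -> ->; case: ifP. Qed.
Lemma eb_lt x y m n : ezn st x m -> ezn st y n -> eb st (eLt x y) (m < n).
Proof. by move=> h1 h2; rewrite -addn1; apply: eb_le => //; apply: ezn_add. Qed.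
Lemma eb_and x y b c : eb st x b -> eb st y c -> eb st (eAnd x y) (b && c).
Proof. by rewrite /eb /= => -> ->; case: b; case: c. Qed.
Lemma eb_not x b : eb st x b -> eb st (eNot x) (~~ b).
Proof. by rewrite /eb /= => ->; case: b. Qed.
Lemma eb_or x y b c : eb st x b -> eb st y c -> eb st (eOr x y) (b || c).
Proof. by move=> hx hy; rewrite -[_ || _]negbK negb_or; apply/eb_not/eb_and;
  apply: eb_not. Qed.
Lemma eb_eq x y m n : ezn st x m -> ezn st y n -> eb st (eEq x y) (m == n).
Proof. by move=> h1 h2; rewrite eqn_leq; apply: eb_and; apply: eb_le. Qed.
End Eval.

(** Evaluation guided by the shape of the expression; side conditions such as m <= E are expected in
    the context. *)
Ltac ev R :=
  lazymatch goal with
  | |- ezn _ (c_ _) _ => apply: ezn_c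
  | |- ezn _ frontE _ => unfold frontE; ev R
  | |- ezn _ rJ _ => exact: (ezn_J R)
  | |- ezn _ rU _ => exact: (ezn_U R)
  | |- ezn _ rI _ => exact: (ezn_I R)
  | |- ezn _ nV _ => exact: (ezn_V R)
  | |- ezn _ nE _ => exact: (ezn_E R)
  | |- ezn _ nS _ => exact: (ezn_S R)
  | |- ezn _ (eTr _) _ => eapply (ezn_tr R); ev R
  | |- ezn _ (eKt _) _ => eapply (ezn_kt R); ev R
  | |- ezn _ (eSt _) _ => eapply (ezn_st R); ev R
  | |- ezn _ (eHd _) _ => eapply (ezn_hd R); ev R
  | |- ezn _ (eTl _) _ => eapply (ezn_tl R); ev R
  | |- ezn _ (ePc _) _ => eapply (ezn_pc R); ev R
  | |- ezn _ (eBest _) _ => eapply (ezn_best R); ev R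
  | |- ezn _ (eDq _ _) _ => eapply (ezn_dq R); [ev R|ev R|assumption]
  | |- ezn _ (ePa _ _) _ => eapply (ezn_pa R); [ev R|ev R|assumption]
  | |- ezn _ (eIx _ _) _ => eapply (ezn_ix R); [ev R|ev R]
  | |- ezn _ (eSrc _) _ => eapply (ezn_src R); [ev R|assumption]
  | |- ezn _ (eDst _) _ => eapply (ezn_dst R); [ev R|assumption]
  | |- ezn _ (eDep _) _ => eapply (ezn_dep R); [ev R|assumption]
  | |- ezn _ (eAct _) _ => eapply (ezn_act R); [ev R|assumption]
  | |- ezn _ (eArt _) _ => eapply (ezn_art R); [ev R|assumption]
  | |- ezn _ (eBe _) _ => eapply (ezn_be R); [ev R|assumption]
  | |- ezn _ (eDbl _) _ => eapply ezn_dbl; ev R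
  | |- ezn _ (eDblS _) _ => eapply ezn_dblS; ev R
  | |- ezn _ (eSub _ (c_ 1)) _ => eapply ezn_sub1; [|ev R]; assumption
  | |- ezn _ (eAdd _ _) _ => eapply ezn_add; [ev R|ev R]
  | |- ezn _ (eMul _ _) _ => eapply ezn_mul; [ev R|ev R]
  | |- ez _ (eKv _) _ => eapply (ez_kv R); ev R
  | |- ez _ (eSrcval _) _ => eapply (ez_srcval R); [ev R|assumption]
  | |- ez _ (eOutval _) _ => eapply (ez_outval R); [ev R|assumption]
  | |- ez _ (eCell _) _ => eapply ez_cell; [ev R|assumption]
  | |- ez _ (eWt _) _ => eapply (ez_wt R); [ev R|assumption]
  | |- eb _ (eLt _ _) _ => eapply eb_lt; [ev R|ev R]
  | |- eb _ (eOr _ _) _ => eapply eb_or; [ev R|ev R]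
  | |- eb _ (eEq _ _) _ => eapply eb_eq; [ev R|ev R]
  | |- eb _ (eNot _) _ => eapply eb_not; ev R
  | |- eb _ (eAnd _ _) _ => eapply eb_and; [ev R|ev R]
  | |- eb _ (eLe _ _) _ =>
      first [eapply eb_le; [ev R|ev R] | eapply eb_lez; [ev R|ev R]]
  | |- ez _ _ _ => eapply ez_n; ev R
  end.

Ltac field_tac r' :=
  do 17?[case: r' => [|r'] //=]; rewrite /upd; case: eqP => // ->.

(** * Effect of single writes *)

Section Wp.
Variable X : nat.

Lemma wp_write r e x st a a' j u i m v (Q : state -> Prop) :
  rep st a j u i -> r < 16 -> ezn st e m -> ez st x v -> absz v <= X ->
  (forall r' i', r' <= 16 ->
     field a' r' i' = if (r' == r) && (i' == m) then v else field a r' i') ->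
  (forall st', rep st' a' j u i -> Q st') -> wp X (wArr r e x) st Q.
Proof.
move=> R hr he hx hv hF hQ.
have -> : wp X (wArr r e x) st Q = (absz (eval st x) <= X /\
   Q (set_mem st (eval st (eAddr r e)) (eval st x))) by [].
rewrite hx (eval_addr hr he); split=> //; apply: hQ.
have [h1 h2 h3 h4 h5] := R; split=> //.
exact: repF_write (ltnW hr) h1 hF.
Qed.

Lemma wp_assign r e st v Q :
  ez st e v -> absz v <= X -> Q (set_reg st r v) -> wp X (Assign r e) st Q.
Proof. by rewrite /ez /= => ->. Qed.

Lemma wp_seq p q st Q :
  wp X p st (fun st' => wp X q st' Q) -> wp X (Seq p q) st Q.
Proof. by []. Qed.

Lemma wp_if e p q st b Q : eb st e b -> (b -> wp X p st Q) ->
  (b = false -> wp X q st Q) -> wp X (If e p q) st Q.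
Proof. by rewrite /eb /= => ->; case: b => /= h1 h2; [apply: h1|apply: h2]. Qed.

Local Arguments wp : simpl never.

Variables (st : state) (a : astate) (j u i : nat) (Q : state -> Prop).
Hypothesis R : rep st a j u i.

Lemma wp_tr e x m v : ezn st e m -> ezn st x v -> v <= X ->
  (forall st', rep st' (set_tr a m v) j u i -> Q st') -> wp X (wArr 0 e x) st Q.
Proof.
move=> he hx hv; apply: wp_write R _ he hx hv _ => // r' i' _.
by field_tac r'.
Qed.

Lemma wp_kt e x m v : ezn st e m -> ezn st x v -> v <= X ->
  (forall st', rep st' (set_kt a m v) j u i -> Q st') -> wp X (wArr 1 e x) st Q.
Proof.
move=> he hx hv; apply: wp_write R _ he hx hv _ => // r' i' _.
by field_tac r'.
Qed.

Lemma wp_kv e x m v : ezn st e m -> ez st x v -> absz v <= X ->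
  (forall st', rep st' (set_kv a m v) j u i -> Q st') -> wp X (wArr 2 e x) st Q.
Proof.
move=> he hx hv; apply: wp_write R _ he hx hv _ => // r' i' _.
by field_tac r'.
Qed.

Lemma wp_st e x m v : ezn st e m -> ezn st x v -> v <= X ->
  (forall st', rep st' (set_stt a m v) j u i -> Q st') -> wp X (wArr 3 e x) st
    Q.
Proof.
move=> he hx hv; apply: wp_write R _ he hx hv _ => // r' i' _.
by field_tac r'.
Qed.

Lemma wp_prd e x m v : ezn st e m -> ez st x (cellz v) -> 16 * v + 6 <= X ->
  (forall st', rep st' (set_prd a m v) j u i -> Q st') -> wp X (wArr 4 e x) st
    Q.
Proof.
move=> he hx hv; apply: wp_write R _ he hx _ _ => //.
  by rewrite /cellz /addr /=; case: eqP => _; lia.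
by move=> r' i' _; field_tac r'.
Qed.

Lemma wp_idx e x m v : ezn st e m -> ezn st x v -> v <= X ->
  (forall st', rep st' (set_idx a m v) j u i -> Q st') -> wp X (wArr 5 e x) st
    Q.
Proof.
move=> he hx hv; apply: wp_write R _ he hx hv _ => // r' i' _.
by field_tac r'.
Qed.

Lemma wp_hd e x m v : ezn st e m -> ezn st x v -> v <= X ->
  (forall st', rep st' (set_hd a m v) j u i -> Q st') -> wp X (wArr 6 e x) st Q.
Proof.
move=> he hx hv; apply: wp_write R _ he hx hv _ => // r' i' _.
by field_tac r'.
Qed.

Lemma wp_tl e x m v : ezn st e m -> ezn st x v -> v <= X ->
  (forall st', rep st' (set_tl a m v) j u i -> Q st') -> wp X (wArr 7 e x) st Q.
Proof.
move=> he hx hv; apply: wp_write R _ he hx hv _ => // r' i' _.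
by field_tac r'.
Qed.

Lemma wp_pc e x m v : ezn st e m -> ezn st x v -> v <= X ->
  (forall st', rep st' (set_pc a m v) j u i -> Q st') -> wp X (wArr 9 e x) st Q.
Proof.
move=> he hx hv; apply: wp_write R _ he hx hv _ => // r' i' _.
by field_tac r'.
Qed.

Lemma ix_eq m p k : m < V -> (k == p * V + m) = (k %% V == m) && (k %/ V == p).
Proof.
move=> hm; apply/eqP/andP => [->|[/eqP h1 /eqP h2]].
  by rewrite modnMDl modn_small // divnMDl ?divn_small ?addn0 //; lia.
by rewrite {1}(divn_eq k V) h1 h2.
Qed.

Lemma wp_dq e f x m p v : ezn st e m -> ezn st f p -> ezn st x v -> m < V ->
  v <= X -> (forall st', rep st' (set_dq a m p v) j u i -> Q st') ->
  wp X (wArr 8 (eIx e f) x) st Q.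
Proof.
move=> he hf hx hm hv.
apply: wp_write R _ (ezn_ix R he hf) hx hv _ => // r' i' _.
do 17?[case: r' => [|r'] //=]; rewrite /upd2 ix_eq //.
by case: ifP.
Qed.

Lemma wp_pa e f x m p v : ezn st e m -> ezn st f p -> ezn st x v -> m < V ->
  v <= X -> (forall st', rep st' (set_pa a m p v) j u i -> Q st') ->
  wp X (wArr 10 (eIx e f) x) st Q.
Proof.
move=> he hf hx hm hv.
apply: wp_write R _ (ezn_ix R he hf) hx hv _ => // r' i' _.
do 17?[case: r' => [|r'] //=]; rewrite /upd2 ix_eq //.
by case: ifP.
Qed.

Lemma wp_setbest : iarc j -> j <= E -> 16 * E + 6 <= X ->
  (forall st', rep st' (set_best a (idst j) j) j u i -> Q st') ->
  wp X setbestC st Q.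
Proof.
move=> aj jE hX hQ.
have j0 : 0 < j by case/andP: aj.
have e1 : ezn st (eDst rJ) (idst j) by ev R.
have -> : wp X setbestC st Q = (absz (eval st rJ) <= X /\
   let st1 := set_mem st (eval st (eAddr 11 (eDst rJ))) (eval st rJ) in
   (absz (eval st1 (eCell rJ)) <= X /\
    Q (set_mem st1 (eval st1 (eAdd (Reg 0) (eDst rJ))) (eval st1 (eCell rJ)))))
      by [].
rewrite (eval_addr _ e1) // (ezn_J R); split; first by rewrite /=; lia.
pose F r k := if (r == 11) && (k == idst j) then j%:Z else field a r k.
have [[h1 h1'] h2 h3 h4 h5] := R.
have hF : repF (set_mem st (addr 11 (idst j)) j%:Z) F.
  exact: (repF_write (F := field a)).
set st1 := set_mem _ _ _ in hF *.
have hc : eval st1 (eCell rJ) = cellz j.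
  rewrite /eCell (@eval_addr st1 5 rJ j) // /cellz.
  by case: eqP => // e; rewrite e in j0.
have hd : eval st1 (eAdd (Reg 0) (eDst rJ)) = addr 16 (idst j).
  rewrite eval_add (_ : eval st1 (Reg 0) = base%:Z); last by have [] := h5.
  by rewrite (@eval_input_arc st1 1 rJ j hF.1).
cbv zeta; rewrite hc hd; split.
  by rewrite /cellz /addr /=; case: eqP => _; lia.
apply: hQ; split=> //.
apply: (repF_write (F := F)) => //.
move=> r' k _; rewrite /F; do 17?[case: r' => [|r'] //=]; rewrite /upd.
  by case: eqP.
by case: eqP.
Qed.

End Wp.

Local Arguments wp : simpl never.

(** * The code of each step computes [phase] *)

Variables (X W N0 : nat).
Hypothesis XE : 16 * E + 16 <= X.
Hypothesis XA : forall x, iarc x -> (iact x).*2.+1 <= X.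
Hypothesis XN : N0 < X.
Hypothesis XW : W * N0.+2 <= X.
Hypothesis wtW : forall x, iarc x -> absz (iwt x) <= W.
Hypothesis srcW : forall x, iarc x -> absz (isrcval x) <= W.

Notation iinv := (inv E s isrc idst idep idur ial ibe iwt cA cB).
Notation iphase := (phase s isrc idst idep idur ial ibe iwt cA cB).
Notation ibnd := (bnd E W N0).

Lemma arc_le x : iarc x -> x <= E. Proof. by case/andP. Qed.
Lemma arc_gt0 x : iarc x -> 0 < x. Proof. by case/andP. Qed.

Lemma dep_bound x : iarc x -> (idep x).*2.+1 <= X.
Proof. by move=> /XA; rewrite /iact /iart; lia. Qed.

(** The summand W is the weight added when an arc is settled; it accounts for [N0.+2] in [XW]. *)
Lemma kv_bound a x : ibnd a -> iarc x -> absz (kv a x) + W <= X.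
Proof.
move=> hb ax; have := b_kv hb ax; move: XW; rewrite !mulnS; lia.
Qed.

Lemma rep_ip st a j u i x v : rep st a j u i -> rep st (set_ip a x v) j u i.
Proof. by case=> -[h1 h2] *; split=> //; split=> // r k hr; rewrite h2. Qed.

Lemma rep_iq x v st a j u i : rep st a j u i -> rep st (set_iq a x v) j u i.
Proof. by case=> -[h1 h2] *; split=> //; split=> // r k hr; rewrite h2. Qed.

(** The target [fe] and the pointer [pe] are evaluated after some of the writes, hence the
    hypotheses about later states; [he] is read by the first write only. *)
Lemma wp_cand fe he pe k st a j u i f h p (Q : state -> Prop) :
  rep st a j u i ->
  (forall st' a', rep st' a' j u i -> ezn st' fe f) -> iarc f ->
  ez st he h -> absz h <= X ->
  (forall st', rep st' (set_kt (set_kv a f h) f (idep f).*2.+1) j u i ->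
     ez st' pe (cellz p)) ->
  p <= E -> k <= 5 ->
  (forall st', rep st' (icand a f h p k) j u i -> Q st') ->
  wp X (candC fe he pe (c_ k)) st Q.
Proof.
move=> R hf af hh hX hp pE hk hQ; have fE := arc_le af.
apply: wp_seq; apply: (wp_kv R (hf _ _ R) hh hX) => st1 R1.
have ef1 := hf _ _ R1.
apply: wp_seq; apply: (wp_kt R1 ef1 (v := (idep f).*2.+1)).
- by eapply ezn_dblS; eapply (ezn_dep R1).
- exact: dep_bound.
- move=> st2 R2; apply: wp_seq; apply: (wp_prd R2 (hf _ _ R2) (hp _ R2)).
    by lia.
  by move=> st3 R3; apply: (wp_st R3 (hf _ _ R3) (v := k)) => //; lia.
Qed.

Lemma wp_leave st a j i t0 x0 (Q : state -> Prop) : rep st a j j i ->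
  iinv t0 x0 a -> ibnd a -> iarc j ->
  (forall st', rep st'
     (ph0_leave s isrc idep cB (ph0_push isrc a j) j) j j i -> Q st') ->
  wp X leaveC st Q.
Proof.
move=> R H hb aj hQ; have jE := arc_le aj; have vV := srcV aj.
have := b_pc hb (isrc j); move=> hpc.
apply: wp_seq; eapply (wp_pa R); [ev R|ev R|ev R|assumption|by lia|].
move=> st1 R1; apply: wp_seq; eapply (wp_pc R1); [ev R1|ev R1| |].
  by rewrite /= addn1; lia.
move=> st2; rewrite addn1 => R2'.
have R2 : rep st2 (ph0_push isrc a j) j j i by exact: rep_ip.
move: hQ; rewrite /ph0_leave; set b := ph0_push isrc a j in R2 *; move=> hQ.
eapply wp_if; [ev R2| |] => hc.
  rewrite hc in hQ; case/andP: hc => hlt _.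
  have [g1 g2 g3 g4] := i_dq H (v := isrc j) (p := hd a (isrc j)) ltac:(rewrite
    leqnn; exact: hlt).
  have g0 := arc_gt0 g1; have gE := arc_le g1.
  eapply (wp_cand (p := dq a (isrc j) (hd a (isrc j))) R2);
    [by move=> st' a' R'; ev R'|exact: aj|ev R2
    |by have := kv_bound hb g1; rewrite /=; lia|by move=> st3 R3; ev R3
    |exact: gE|by []|exact: hQ].
rewrite hc in hQ.
have hsX : absz (isrcval j) <= X by have := srcW aj; move: XW; rewrite !mulnS;
  lia.
eapply wp_if; [ev R2| |] => hs; rewrite hs in hQ.
  eapply (wp_cand (p := 0) R2);
    [by move=> st' a' R'; ev R'|exact: aj|ev R2|exact: hsX|by []|by []|by []
    |exact: hQ].
eapply (wp_cand (p := 0) R2);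
  [by move=> st' a' R'; ev R'|exact: aj|ev R2|exact: hsX|by []|by []|by []
  |exact: hQ].
Qed.

Lemma wp_phase0 st a j i t0 x0 (Q : state -> Prop) : rep st a j j i ->
  iinv t0 x0 a -> ibnd a -> iarc j -> stt a j = 0 ->
  (forall st', rep st' (iphase a j).1 j (iphase a j).2 i -> Q st') ->
  wp X ph0C st Q.
Proof.
move=> R H hb aj s0; rewrite /iphase s0 => hQ.
have jE := arc_le aj; have vV := srcV aj.
eapply wp_if; [ev R| |] => hlt; rewrite hlt /= in hQ; last first.
  exact: wp_leave R H hb aj hQ.
have [g1 g2 g3 g4] := i_dq H (v := isrc j) (p := hd a (isrc j)) ltac:(rewrite
  leqnn; exact: hlt).
have gE := arc_le g1; have htl := b_tl hb (isrc j).
eapply wp_if; [ev R| |] => hc; rewrite hc /= in hQ; last first.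
  exact: wp_leave R H hb aj hQ.
eapply (wp_hd R); [ev R|ev R|by lia|].
by move=> st1; rewrite addn1 => R1; apply: hQ;
  have := rep_iq (dq a (isrc j) (hd a (isrc j))) 0 R1.
Qed.

Lemma wp_phase1 st a j i t0 x0 (Q : state -> Prop) : rep st a j j i ->
  iinv t0 x0 a -> ibnd a -> iarc j -> stt a j = 1 ->
  (forall st', rep st' (iphase a j).1 j (iphase a j).2 i -> Q st') ->
  wp X ph1C st Q.
Proof.
move=> R H hb aj s1; rewrite /iphase s1 /ph1 /= => hQ.
have jE := arc_le aj; have j0 := arc_gt0 aj; have wV := dstV aj.
have e1 : ez st (eAdd (eKv rJ) (eWt rJ)) (kv a j + iwt j)%R.
  have := ez_kv R (ezn_J R); have := ez_wt R (ezn_J R) jE.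
  by rewrite /ez eval_add => -> ->.
apply: wp_seq; eapply (wp_kv R); [ev R|exact: e1| |].
  by have := kv_bound hb aj; have := wtW aj; lia.
move=> st1 R1; apply: wp_seq; eapply (wp_kt R1); [ev R1|ev R1|exact: XA|].
move=> st2 R2; apply: wp_seq; eapply (wp_st R2); [ev R2|ev R2|by lia|].
move=> st3 R3; apply: wp_seq; eapply (wp_idx R3); [ev R3|ev R3|by lia|].
move=> st4 R4; set a1 := set_idx _ _ _ in R4 hQ *.
eapply wp_if; [ev R4| |]; rewrite leqn0 => hz; rewrite hz /= in hQ.
  by apply: (wp_setbest R4) => //; lia.
have [g1 g2 g3 g4] := i_best H (z := idst j) ltac:(by move/eqP: hz).
have gE := arc_le g1; rewrite -[best a _]/(best a1 (idst j)) in gE.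
eapply wp_if; [ev R4| |] => hc; rewrite hc /= in hQ.
  by apply: (wp_setbest R4) => //; lia.
exact: hQ.
Qed.

Lemma wp_push st a j i t0 x0 (Q : state -> Prop) : rep st a j j i ->
  iinv t0 x0 a -> ibnd a -> iarc j ->
  (forall st', rep st' (ph2_push idst a j) j j i -> Q st') -> wp X pushC st Q.
Proof.
move=> R H hb aj hQ.
have jE := arc_le aj; have wV := dstV aj; have htl := b_tl hb (idst j).
apply: wp_seq; eapply (wp_dq R); [ev R|ev R|ev R|assumption|by lia|].
move=> st1 R1; apply: wp_seq; eapply (wp_tl R1); [ev R1|ev R1| |].
  by rewrite /= addn1; lia.
move=> st2; rewrite addn1 => R2; eapply (wp_st R2); [ev R2|ev R2|by lia|].
by move=> st3 R3; apply: hQ; have := rep_iq j (tl a (idst j)).+1 R3.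
Qed.

Lemma wp_phase2 st a j i t0 x0 (Q : state -> Prop) : rep st a j j i ->
  iinv t0 x0 a -> ibnd a -> iarc j -> stt a j = 2 ->
  (forall st', rep st' (iphase a j).1 j (iphase a j).2 i -> Q st') ->
  wp X ph2C st Q.
Proof.
move=> R H hb aj s2; rewrite /iphase s2 => hQ.
have jE := arc_le aj; have wV := dstV aj; have htl := b_tl hb (idst j).
eapply wp_if; [ev R| |] => hlt; rewrite hlt /= in hQ; last first.
  exact: wp_push R H hb aj hQ.
have tl0 : 0 < tl a (idst j) by lia.
eapply wp_if; [ev R| |] => hc; rewrite hc /= in hQ; last first.
  exact: wp_push R H hb aj hQ.
eapply (wp_tl R); [ev R|ev R|by lia|].
by move=> st1 R1; apply: hQ; have := rep_iq (dq a (idst j) (tl a (idst j)).-1) 0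
  R1.
Qed.

Lemma rep_set_u st a j u i v : rep st a j u i ->
  rep (set_reg st 2 v%:Z) a j v i.
Proof. by case=> *; split. Qed.

Lemma rep_set_j st a j u i v : rep st a j u i ->
  rep (set_reg st 1 v%:Z) a v u i.
Proof. by case=> *; split. Qed.

Lemma rep_set_i st a j u i v : rep st a j u i ->
  rep (set_reg st 3 v%:Z) a j u v.
Proof. by case=> *; split. Qed.

Lemma wp_phase3 st a j i t0 x0 (Q : state -> Prop) : rep st a j j i ->
  iinv t0 x0 a -> ibnd a -> iarc j -> stt a j = 3 ->
  (forall st', rep st' (iphase a j).1 j (iphase a j).2 i -> Q st') ->
  wp X ph3C st Q.
Proof.
move=> R H hb aj s3; rewrite /iphase s3 => hQ.
have jE := arc_le aj; have j0 := arc_gt0 aj.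
have wV := dstV aj; have hpc := b_pc hb (idst j).
eapply wp_if; [ev R| |]; rewrite leqn0 => hz; rewrite hz /= in hQ.
  eapply (wp_st R); [ev R|ev R|by lia|].
  by move=> st1 R1; apply: hQ.
have pc0 : 0 < pc a (idst j) by lia.
have [g1 g2 g3 g4] := i_pa H (v := idst j) (p := (pc a (idst j)).-1) ltac:(lia).
have gE := arc_le g1.
apply: wp_seq; eapply wp_assign; [ev R|by rewrite /=; lia|].
have R1 := rep_set_u (pa a (idst j) (pc a (idst j)).-1) R.
set f := pa a _ _ in g1 g2 g3 g4 gE R1 hQ *.
move: (set_reg _ _ _) R1 => st1 R1.
apply: wp_seq; eapply (wp_pc R1); [ev R1|ev R1|by lia|].
move=> st2 R2'.
have R2 : rep st2 (ph3_pop idst a j) j f i by exact: rep_ip.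
move: hQ; rewrite /ph3_upd; set b := ph3_pop _ a j in R2 *; move=> hQ.
eapply wp_if; [rewrite /testE; ev R2| |] => hc.
  have ht : ph3_test idst idep idur ial ibe b j f.
    by move: hc; rewrite /ph3_test -!ltNge.
  rewrite ht in hQ.
  eapply (wp_cand (p := j) R2);
    [by move=> st' a' R'; ev R'|exact: g1|ev R2
    |by have := kv_bound hb aj; rewrite /=; lia|by move=> st3 R3; ev R3
    |exact: jE|by []|exact: hQ].
have ht : ph3_test idst idep idur ial ibe b j f = false.
  by move: hc; rewrite /ph3_test -!ltNge.
by rewrite ht in hQ; apply: hQ.
Qed.

Lemma wp_phase st a j u i t0 x0 (Q : state -> Prop) : rep st a j u i ->
  iinv t0 x0 a -> ibnd a -> iarc (tr a 1) -> stt a (tr a 1) <= 3 ->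
  (forall st', rep st' (iphase a (tr a 1)).1 (tr a 1) (iphase a (tr a 1)).2 i ->
     Q st') ->
  wp X phaseC st Q.
Proof.
move=> R H hb; move ek : (tr a 1) => k ak sk hQ.
have kE := arc_le ak.
apply: wp_seq; eapply wp_assign; [ev R|by rewrite /=; lia|].
have R1 := rep_set_j (tr a 1) R; rewrite ek in R1 *.
move: (set_reg _ _ _) R1 => st1 R1.
apply: wp_seq; eapply wp_assign; [ev R1|by rewrite /=; lia|].
have R2 := rep_set_u k R1.
move: (set_reg _ _ _) R2 => st2 R2.
eapply wp_if; [ev R2| |] => h0; first by apply: wp_phase0 R2 H hb ak _ hQ; lia.
eapply wp_if; [ev R2| |] => h1; first by apply: wp_phase1 R2 H hb ak _ hQ; lia.
eapply wp_if; [ev R2| |] => h2; first by apply: wp_phase2 R2 H hb ak _ hQ; lia.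
by apply: wp_phase3 R2 H hb ak _ hQ; lia.
Qed.

Lemma wp_node st a j u i (Q : state -> Prop) : rep st a j u i ->
  (forall k, tr a k <= E) ->
  (forall st', rep st' (uptr a i) j u i -> Q st') -> wp X nodeC st Q.
Proof.
move=> R hE; rewrite /uptr /better => hQ.
have b1 := hE i.*2; have b2 := hE i.*2.+1.
eapply wp_if; [ev R| |]; rewrite leqn0 => h1; rewrite h1 in hQ.
  by eapply (wp_tr R); [ev R|ev R|lia|].
eapply wp_if; [ev R| |]; rewrite leqn0 => h2; rewrite h2 in hQ.
  by eapply (wp_tr R); [ev R|ev R|lia|].
eapply wp_if; [ev R| |] => h3.
  have h : keyle a (tr a i.*2) (tr a i.*2.+1) by exact: h3.
  by rewrite h in hQ; eapply (wp_tr R); [ev R|ev R|lia|].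
have h : keyle a (tr a i.*2) (tr a i.*2.+1) = false by exact: h3.
by rewrite h in hQ; eapply (wp_tr R); [ev R|ev R|lia|].
Qed.

(** * The loops *)

Variable D : nat.
Hypothesis X_gt1 : 1 < X.
Hypothesis hD : deg_le D.

Lemma degs : [/\ cdeg leafC <= D, edeg (eLe (c_ 2) rI) <= D, cdeg climbC <= D,
  edeg (eLt rU nE) <= D
  & [/\ cdeg insertC <= D, edeg (eTr (c_ 1)) <= D & cdeg phaseC <= D]].
Proof. by case: hD => h; split; last split; apply: leq_trans h; vm_compute. Qed.

Definition tree_time k :=
  ccost leafC + k.+1 * (cost (eLe (c_ 2) rI) + ccost climbC).+1.

Lemma wp_leaf st a j u i L (Q : state -> Prop) : rep st a j u i -> iarc u ->
  L u = (stt a u <= 3) ->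
  (forall st', rep st' (set_tr a (E.+1 + u) (if L u then u else 0)) j u
     (E.+1 + u) -> Q st') -> wp X leafC st Q.
Proof.
move=> R au hL hQ; have uE := arc_le au.
have e1 : ezn st (eMul rU (eLe (eSt rU) (c_ 3))) (if L u then u else 0).
  have h : eb st (eLe (eSt rU) (c_ 3)) (stt a u <= 3) by ev R.
  rewrite /ezn eval_mul (ezn_U R) h hL; case: (_ <= _) => /=; lia.
have hv : (if L u then u else 0) <= X by case: (L u) => //; lia.
apply: wp_seq; eapply (wp_tr R); [ev R|exact: e1|exact: hv|].
move=> st1; rewrite addn1 => R1.
eapply wp_assign; [ev R1|by rewrite /=; lia|].
by rewrite addn1; apply/hQ/(rep_set_i _ R1).
Qed.

Lemma wp_climb st a j u i (Q : state -> Prop) : rep st a j u i ->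
  (forall k, tr a k <= E) -> i < E.+1.*2 ->
  (forall st', rep st' (uptr a i./2) j u i./2 -> Q st') -> wp X climbC st Q.
Proof.
move=> R hE hi hQ; apply: wp_seq.
have e1 : ez st (Bin ODiv rI (c_ 2)) (i./2)%:Z.
  have -> : ez st (Bin ODiv rI (c_ 2)) (i./2)%:Z = ((eval st rI %/ 2)%Z =
    (i./2)%:Z) by [].
  by rewrite (ezn_I R) divz_nat divn2.
eapply wp_assign; [exact: e1|by rewrite /=; lia|].
by apply: wp_node (rep_set_i _ R) _ hQ.
Qed.

Lemma runs_tree st a j u i L k0 : rep st a j u i -> iarc u ->
  tree_ok_but E.+1 L (E.+1 + u) (set_tr a (E.+1 + u) (if L u then u else 0)) ->
  L u = (stt a u <= 3) -> (forall k, tr a k <= E) -> E.+1 <= 2 ^ k0 ->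
  runs X D treeC st (tree_time k0) (fun st' => exists t i',
    [/\ rep st' (with_tr a t) j u i', tree_ok E.+1 L (with_tr a t)
      & forall k, t k <= E]).
Proof.
move=> R au ht hL hE hk; have uE := arc_le au.
(* The variant k bounds the number of halvings that still lead from i' to the root. *)
pose I (k : nat) (st : state) := exists t i',
  [/\ rep st (with_tr a t) j u i', tree_ok_but E.+1 L i' (with_tr a t),
     forall k, t k <= E & 0 < i' < E.+1.*2 /\ i' < 2 ^ k.+1].
apply: runs_seq; apply: runs_mono (leqnn _) _ _; last first.
  apply: runs_wp; [exact: X_gt1|by have [] := degs|].
  apply: (@wp_leaf _ _ _ _ _ L (fun st' => I k0 st')) R au hL _ => st1 R1.
  exists (upd (tr a) (E.+1 + u) (if L u then u else 0)), (E.+1 + u).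
  split; [exact: R1|exact: ht| |].
    by move=> k; rewrite /upd; case: eqP => _; [case: (L u)|exact: hE].
  have e2 : 2 ^ k0.+1 = (2 ^ k0).*2 by rewrite expnS mul2n.
  by rewrite e2; lia.
move=> st1 hI.
apply: runs_mono (leqnn _) _ (runs_while (I := I) X_gt1 _ _ hI).
- move=> st2 [h0 [k [t [i' [R2 h1 h2 h3]]]]]; exists t, i'; split;
    [exact: R2| |exact: h2].
  apply: (tree_update_end _ h1) => //.
  have := eb_le (ezn_c st2 2) (ezn_I R2); rewrite /eb h0.
  by case: leqP.
- by have [] := degs.
- move=> k st2 [t [i' [R2 h1 h2 [h3 h4]]]] hne.
have h5 : 1 < i'.
  by move: hne; have := eb_le (ezn_c st2 2) (ezn_I R2); rewrite /eb => ->;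
    case: leqP.
apply: runs_wp; [exact: X_gt1|by have [] := degs|].
apply: (wp_climb R2) => //; first by lia.
move=> st3 R3; exists k.-1; first by case: k h4 => [|k] //; rewrite expn1; lia.
pose b := better (with_tr a t) (t i'./2.*2) (t i'./2.*2.+1).
exists (upd t i'./2 b), i'./2; split; first exact: R3.
+ by apply: tree_update_step h1 _; lia.
+ move=> m; rewrite /upd; case: eqP => // _; rewrite /b.
  by have [->|->] := better_or (with_tr a t) (t i'./2.*2) (t i'./2.*2.+1).
+ split; first by lia.
  case: k h4 => [|k]; first by rewrite expn1; lia.
  have e2 : 2 ^ k.+2 = (2 ^ k.+1).*2 by rewrite expnS mul2n.
  by rewrite e2 /=; lia.
Qed.

Record fresh (m : nat) (a : astate) : Prop := Fresh {
  f_kt : forall x, 0 < x <= m -> kt a x = (idep x).*2;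
  f_zero : forall x, [/\ kv a x = 0%R, stt a x = 0, ip a x = 0 & iq a x = 0];
  f_vtx : forall v, [/\ hd a v = 0, tl a v = 0, pc a v = 0 & best a v = 0]
}.

Lemma runs_insert st a j i k0 : rep st a j 0 i -> fresh 0 a ->
  tree_ok E.+1 (fun x => 0 < x <= 0) a -> (forall k, tr a k <= E) ->
  E.+1 <= 2 ^ k0 ->
  runs X D (While (eLt rU nE) (Seq insertC treeC)) st
    (E.+1 * (cost (eLt rU nE) + (ccost insertC + tree_time k0)).+1)
    (fun st' => exists a j i, [/\ rep st' a j E i, fresh E a,
       tree_ok E.+1 (fun x => 0 < x <= E) a & forall k, tr a k <= E]).
Proof.
move=> R hf ht hE hk.
pose I (k : nat) (st : state) := exists a j u i,
  [/\ rep st a j u i, fresh u a, tree_ok E.+1 (fun x => 0 < x <= u) a,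
     forall k, tr a k <= E & u + k = E].
have hI : I E st by exists a, j, 0, i.
apply: runs_mono (leqnn _) _ (runs_while (I := I) X_gt1 _ _ hI).
- move=> st2 [h0 [k [b [j' [u [i' [R2 h1 h2 h3 h4]]]]]]].
  have eu : u = E.
    have := eb_lt (ezn_U R2) (ezn_E R2); rewrite /eb h0; case: ltnP => //; lia.
  by rewrite eu in R2 h1 h2; exists b, j', i'.
- by have [] := degs.
- move=> k st2 [b [j' [u [i' [R2 h1 h2 h3 h4]]]]] hne.
have h5 : u < E.
  by move: hne; have := eb_lt (ezn_U R2) (ezn_E R2); rewrite /eb => ->;
    case: ltnP.
have au : iarc u.+1 by rewrite /arc; lia.
have uE := arc_le au.
have step : runs X D insertC st2 (ccost insertC) (fun st' =>
    rep st' (set_kt b u.+1 (idep u.+1).*2) j' u.+1 i').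
  apply: runs_wp; [exact: X_gt1|by have [_ _ _ _ []] := degs|].
  apply: wp_seq; eapply wp_assign; [ev R2|by rewrite /=; lia|].
  have R3 := rep_set_u u.+1 R2; rewrite addn1.
  move: (set_reg _ _ _) R3 => st3 R3.
  eapply (wp_kt R3); [ev R3|ev R3|by have := dep_bound au; lia|].
  by move=> st4 R4; exact: R4.
apply: runs_seq; apply: runs_mono (leqnn _) _ step.
move=> st3 R3 /=; set c := set_kt _ _ _ in R3.
have hL : (0 < u.+1 <= u.+1) = (stt c u.+1 <= 3).
  by have [_ -> _ _] := f_zero h1 u.+1; rewrite leqnn.
have hb : tree_ok_but E.+1 (fun x => 0 < x <= u.+1) (E.+1 + u.+1)
    (set_tr c (E.+1 + u.+1) (if 0 < u.+1 <= u.+1 then u.+1 else 0)).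
  apply: (@tree_update_start E.+1 isT (fun x => 0 < x <= u) (fun x => 0 < x <=
    u.+1) b c u.+1) => //.
  move=> x nx; split=> //=; first by rewrite /upd (negbTE nx).
  by lia.
apply: runs_mono (leqnn _) _ (runs_tree R3 au hb hL _ hk) => //.
move=> st4 [t [i2 [R4 g1 g2]]]; exists k.-1; first by lia.
exists (with_tr c t), j', u.+1, i2; split=> //; last by lia.
have [f1 f2 f3] := h1; split=> // x hx; rewrite /= /upd.
by case: (eqVneq x u.+1) => [->//|nx]; apply: f1; lia.
Qed.

Definition live a x := (0 < x <= E) && (stt a x <= 3).

Hypothesis wt_ge0 : forall x, iarc x -> idur x = 0 -> (0 <= iwt x)%R.

Lemma runs_main st a j u i t0 x0 k0 : rep st a j u i -> iinv t0 x0 a -> ibnd a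
  ->
  tree_ok E.+1 (live a) a -> (forall k, tr a k <= E) -> E.+1 <= 2 ^ k0 ->
  runs X D (While (eTr (c_ 1)) (Seq phaseC treeC)) st
    (N0.+1 * (cost (eTr (c_ 1)) + (ccost phaseC + tree_time k0)).+1)
    (fun st' => exists a j u i t0 x0, [/\ rep st' a j u i, iinv t0 x0 a
       & forall x, iarc x -> 3 < stt a x]).
Proof.
move=> R H hb ht hE hk.
pose I (k : nat) (st : state) := exists a j u i t0 x0,
  [/\ rep st a j u i, iinv t0 x0 a, ibnd a, tree_ok E.+1 (live a) a
    & (forall k, tr a k <= E) /\ Phi E a <= k].
have hI : I N0 st.
  exists a, j, u, i, t0, x0; split=> //; split=> //.
  (* The bound at any vertex gives [Phi] <= N0, so the potential serves as the loop variant. *)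
  by have := b_tl hb 0; lia.
apply: runs_mono (leqnn _) _ (runs_while (I := I) X_gt1 _ _ hI).
- move=> st2 [h0 [k [b [j' [u' [i' [t1 [x1 [R2 h1 h2 h3 h4]]]]]]]]].
  exists b, j', u', i', t1, x1; split=> // x ax; rewrite ltnNge;
    apply/negP => hx.
  have e0 : tr b 1 = 0.
    by have := ezn_tr R2 (ezn_c st2 1); rewrite /ezn h0; lia.
  have := tree_root0 (x := x) _ h3 e0; rewrite /live.
  by move: ax; rewrite /arc; lia.
- by have [_ _ _ _ []] := degs.
- move=> k st2 [b [j' [u' [i' [t1 [x1 [R2 h1 h2 h3 [h4 h5]]]]]]]] hne.
have nz : tr b 1 != 0.
  by move: hne; rewrite (ezn_tr R2 (ezn_c st2 1)).
have [/andP[ar s3] lt min] := tree_root (ltn0Sn E) h3 nz.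
set r := tr b 1 in nz ar s3 lt min.
have min' x : iarc x -> stt b x <= 3 -> lex (kt b r) (kv b r) (kt b x) (kv b x).
  move=> ax sx; apply: min; first by move: ax; rewrite /arc; lia.
  by rewrite /live sx andbT.
(* The clock moves to the key at the root before the step is made. *)
have h1' : iinv (kt b r) (kv b r) b := inv_advance h1 (i_min h1 ar s3) min'.
have h6 := inv_phase wt_ge0 h1' ar (erefl _) (erefl _) s3.
have h7 := bnd_phase wtW srcW h1' ar s3 h2.
have h8 := Phi_phase h1' ar s3.
have [f1 f2 f3] := phase_frame h1' ar s3.
have step : runs X D phaseC st2 (ccost phaseC) (fun st' =>
    rep st' (iphase b r).1 r (iphase b r).2 i').
  apply: runs_wp; [exact: X_gt1|by have [_ _ _ _ []] := degs|].
  by apply: (wp_phase R2 h1' h2) => // st3 R3; exact: R3.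
apply: runs_seq; apply: runs_mono (leqnn _) _ step.
move=> st3 R3; set c := (iphase b r).1 in h6 h7 h8 f2 f3 R3.
set f := (iphase b r).2 in f1 f3 R3.
have fE := arc_le f1; have f0 := arc_gt0 f1.
have hL : live c f = (stt c f <= 3) by rewrite /live f0 fE.
have hbut : tree_ok_but E.+1 (live c) (E.+1 + f)
    (set_tr c (E.+1 + f) (if live c f then f else 0)).
  apply: (@tree_update_start E.+1 isT (live b) (live c) b c f) => //.
  by move=> x nx; have [g1 g2 g3] := f3 x nx; rewrite /live g3.
have hE' m : tr c m <= E by rewrite f2.
apply: runs_mono (leqnn _) _ (runs_tree R3 f1 hbut hL hE' hk).
move=> st4 [t [i2 [R4 g1 g2]]]; exists (Phi E c); first by lia.
exists (with_tr c t), r, f, i2, (kt b r), (kv b r); split=> //.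
+ exact: inv_with_tr.
+ by have [? ? ?] := h7; split.
Qed.

Lemma runs_loops st a j i k0 : rep st a j 0 i -> fresh 0 a ->
  (forall k, tr a k = 0) -> N0 = 6 * E.+1 -> E.+1 <= 2 ^ k0 ->
  runs X D loopsC st
    (E.+1 * (cost (eLt rU nE) + (ccost insertC + tree_time k0)).+1 +
     N0.+1 * (cost (eTr (c_ 1)) + (ccost phaseC + tree_time k0)).+1)
    (fun st' => exists a j u i t0 x0, [/\ rep st' a j u i, iinv t0 x0 a
       & forall x, iarc x -> 3 < stt a x]).
Proof.
move=> R hf ht hN hk; apply: runs_seq.
have ht0 : tree_ok E.+1 (fun x => 0 < x <= 0) a.
  split=> [x hx|x hx]; first by rewrite ht; case: ifP => //; lia.
  by rewrite /node_ok !ht /better.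
apply: runs_mono (leqnn _) _ (runs_insert R hf ht0 _ hk); last by move=> k;
  rewrite ht.
move=> st1 [b [j' [i' [R1 [f1 f2 f3] h2 h3]]]].
have hPhi : Phi E b = N0.
  (* All statuses are 0, of weight 6, and the sum includes the index 0. *)
  rewrite /Phi hN (eq_bigr (fun=> 6)) ?sum_nat_const ?card_ord 1?mulnC //.
  by move=> x _; rewrite /phi; have [_ -> -> ->] := f2 x.
apply: (runs_main (t0 := 0) (x0 := 0%R) R1) => //.
- apply: inv_init => //; try by [move=> x; have [] := f2 x|move=> v;
    have [] := f3 v].
- split.
  + by move=> v; have [_ -> _ _] := f3 v; rewrite hPhi.
  + by move=> v; have [_ _ -> _] := f3 v; rewrite hPhi.
  + by move=> x _; have [-> _ _ _] := f2 x; rewrite hPhi mulnS; lia.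
- split=> [x hx|x hx]; last exact: h2.2.
  rewrite h2.1 // /live; have [_ -> _ _] := f2 x.
  by rewrite andbT.
Qed.

End Refinement.

(** * Scaling the coefficients *)

Definition eNum i := Read (c_ (4 + i.*2)).
Definition eDen i := Read (c_ (5 + i.*2)).
Definition eProd (l : seq nat) := foldr (fun i e => eMul (eDen i) e) (c_ 1) l.
Definition eDelta i := Bin ODiv (eMul (eNum i) (Reg 10)) (eDen i).

Definition preC :=
  Seq (Assign 10 (eProd (iota 0 7)))
 (Seq (Assign 4 (eAdd (eAdd (eDelta 0) (eDelta 2)) (eDelta 6)))
 (Seq (Assign 5 (eAdd (eAdd (eDelta 1) (eDelta 2)) (eDelta 6)))
 (Seq (Assign 6 (eSub (eDelta 3) (eDelta 6)))
 (Seq (Assign 7 (eDelta 4))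
 (Seq (Assign 8 (eDelta 5))
   (Assign 0 (eAdd (eAdd (c_ 18) (eMul (c_ 2) nV)) (eMul (c_ 5) nE)))))))).

Definition prog := Seq preC loopsC.

Section Prelude.
Variables (inp : nat -> nat) (M X : nat).
Hypothesis inpM : forall i, inp i <= M.
Hypothesis M_ge18 : 18 <= M.
Hypothesis XM : X = M ^ 12.

Definition iden (l : seq nat) : int :=
  foldr (fun i z => ((inp (5 + i.*2))%:Z * z)%R) 1%R l.
Definition iD : int := iden (iota 0 7).
(** This is D delta_(i+1): the division is exact because D is a multiple of each denominator. *)
Definition iDelta i : int :=
  (((inp (4 + i.*2))%:Z * iD)%R %/ (inp (5 + i.*2))%:Z)%Z.
(** Coefficients of the last arrival, the first departure (up to sign) and the total transmission
    time. The indices are shifted by one, so index 6 is the waiting time, which contributes to all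
    three. *)
Definition icA : int := (iDelta 0 + iDelta 2 + iDelta 6)%R.
Definition icB : int := (iDelta 1 + iDelta 2 + iDelta 6)%R.
Definition iw1 : int := (iDelta 3 - iDelta 6)%R.

Lemma absz_iden l : absz (iden l) <= M ^ size l.
Proof.
elim: l => [//|i l IH]; rewrite /iden /= abszM expnS.
exact: leq_mul (inpM _) IH.
Qed.

Lemma absz_iDelta i : absz (iDelta i) <= M ^ 8.
Proof.
rewrite /iDelta; apply: leq_trans (absz_div _ _) _; rewrite abszM (expnS M 7).
exact: leq_mul (inpM _) (absz_iden (iota 0 7)).
Qed.

Lemma M8X : 3 * M ^ 8 <= X.
Proof.
rewrite XM (expnD M 4 8); apply: leq_mul => //.
by apply: leq_trans (_ : M ^ 1 <= _); [rewrite expn1; lia|rewrite leq_exp2l //;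
  lia].
Qed.

Lemma eval_eProd st l : (forall i, memory st i%:Z = (inp i)%:Z) ->
  eval st (eProd l) = iden l.
Proof. by move=> hm; elim: l => [//|i l IH] /=; rewrite IH hm. Qed.

Lemma eval_eDelta st i : (forall i, memory st i%:Z = (inp i)%:Z) ->
  regs st 10 = iD -> eval st (eDelta i) = iDelta i.
Proof. by move=> hm hr; rewrite /= !hm hr. Qed.

Lemma wp_pre st (Q : state -> Prop) :
  (forall i, memory st i%:Z = (inp i)%:Z) ->
  18 + (inp 0).*2 + 5 * inp 2 <= M ->
  (forall st', memory st' = memory st ->
     (forall r, r \in [:: 1; 2; 3] -> regs st' r = regs st r) ->
     [/\ regs st' 0 = (18 + (inp 0).*2 + 5 * inp 2)%:Z, regs st' 4 = icA,
         regs st' 5 = icB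
       & [/\ regs st' 6 = iw1, regs st' 7 = iDelta 4 & regs st' 8 = iDelta 5]]
         ->
     Q st') ->
  wp X preC st Q.
Proof.
move=> hm hb hQ; have hX := M8X; have hd := absz_iDelta.
have hMX : M <= X by rewrite XM -{1}(expn1 M) leq_exp2l //; lia.
apply: wp_seq; eapply wp_assign; first exact: eval_eProd.
  apply: leq_trans (absz_iden _) _; rewrite XM leq_exp2l //; lia.
move e1 : (set_reg _ _ _) => st1.
have m1 : memory st1 = memory st by rewrite -e1.
have r1 : regs st1 10 = iD by rewrite -e1.
have k1 i : memory st1 i%:Z = (inp i)%:Z by rewrite m1.
apply: wp_seq; eapply wp_assign; [by rewrite /ez !eval_add !eval_eDelta //;
  reflexivity|by have := hd 0; have := hd 2; have := hd 6; lia|].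
move e2 : (set_reg _ _ _) => st2.
have m2 : memory st2 = memory st by rewrite -e2.
have r2 : regs st2 10 = iD by rewrite -e2.
have k2 i : memory st2 i%:Z = (inp i)%:Z by rewrite m2.
apply: wp_seq; eapply wp_assign; [by rewrite /ez !eval_add !eval_eDelta //;
  reflexivity|by have := hd 1; have := hd 2; have := hd 6; lia|].
move e3 : (set_reg _ _ _) => st3.
have m3 : memory st3 = memory st by rewrite -e3.
have r3 : regs st3 10 = iD by rewrite -e3.
have k3 i : memory st3 i%:Z = (inp i)%:Z by rewrite m3.
apply: wp_seq; eapply wp_assign; [by rewrite /ez eval_sub !eval_eDelta //;
  reflexivity|by have := hd 3; have := hd 6; lia|].
move e4 : (set_reg _ _ _) => st4.
have m4 : memory st4 = memory st by rewrite -e4.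
have r4 : regs st4 10 = iD by rewrite -e4.
have k4 i : memory st4 i%:Z = (inp i)%:Z by rewrite m4.
apply: wp_seq; eapply wp_assign; [by rewrite /ez eval_eDelta //;
  reflexivity|by have := hd 4; lia|].
move e5 : (set_reg _ _ _) => st5.
have m5 : memory st5 = memory st by rewrite -e5.
have r5 : regs st5 10 = iD by rewrite -e5.
have k5 i : memory st5 i%:Z = (inp i)%:Z by rewrite m5.
apply: wp_seq; eapply wp_assign; [by rewrite /ez eval_eDelta //;
  reflexivity|by have := hd 5; lia|].
move e6 : (set_reg _ _ _) => st6.
have m6 : memory st6 = memory st by rewrite -e6.
have k6 i : memory st6 i%:Z = (inp i)%:Z by rewrite m6.
have e7 : ez st6 (eAdd (eAdd (c_ 18) (eMul (c_ 2) nV)) (eMul (c_ 5) nE))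
    (18 + (inp 0).*2 + 5 * inp 2)%:Z.
  by rewrite /ez !eval_add !eval_mul /nV /nE !eval_read /= (k6 0) (k6 2); lia.
eapply wp_assign; [exact: e7|by rewrite /=; lia|].
apply: hQ => //; last by rewrite -e6 -e5 -e4 -e3 -e2.
by move=> r; rewrite !inE -e6 -e5 -e4 -e3 -e2 -e1; case/or3P => /eqP ->.
Qed.

End Prelude.

(** * Decoding the input and the output *)

Section Flatten.
Variables (T U : eqType) (f : T -> seq U) (k : nat).
Hypothesis size_f : forall x, size (f x) = k.

Lemma size_flatten_const l : size (flatten [seq f x | x <- l]) = k * size l.
Proof. by elim: l => [|x l IH]; rewrite ?muln0 //= size_cat IH size_f mulnS.
  Qed.

Lemma nth_flatten_const x0 u0 l p r : p < size l -> r < k ->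
  nth u0 (flatten [seq f x | x <- l]) (k * p + r) = nth u0 (f (nth x0 l p)) r.
Proof.
elim: l p => [//|x l IH] [|p] /= hp hr; rewrite nth_cat size_f.
  by rewrite muln0 add0n hr.
rewrite mulnS -addnA ifF ?addKn ?IH //.
by rewrite -[X in _ < X]addn0 ltn_add2l.
Qed.
End Flatten.

Section Encoding.
Variables (G : temporal_graph) (c : time_arc G -> nat) (d : 7.-tuple rat).
Variables (s : vertex G) (es : seq (time_arc G)).
Let w := encode_input c d s es.
Let inp i := nth 0 w i.
Let V := #|vertex G|.
Let E := size es.

Definition handle (e : time_arc G) := (index e es).+1.

Lemma size_enum : size (enum (vertex G)) = V.
Proof. by rewrite /V cardE. Qed.

Lemma size_rats (l : seq rat) :
  size (flatten [seq [:: absz (numq x); absz (denq x)] | x <- l]) = 2 * size l.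
Proof. exact: size_flatten_const. Qed.

Lemma size_encode : size w = 18 + V.*2 + 5 * E.
Proof.
rewrite /w /encode_input 4!size_cat size_rats size_tuple 2!size_map size_enum.
by rewrite (@size_flatten_const _ _ _ 5) //= -/E; lia.
Qed.

Lemma inp_tail i : inp (4 + i) = nth 0
  (flatten [seq [:: absz (numq x); absz (denq x)] | x <- d]
   ++ [seq minwait v : nat | v <- enum (vertex G)]
   ++ [seq maxwait v : nat | v <- enum (vertex G)]
   ++ flatten [seq encode_arc c e | e <- es]) i.
Proof. by []. Qed.

Lemma inp_rat i : i < 7 -> inp (4 + i.*2) = absz (numq (nth 0%R d i)) /\
  inp (5 + i.*2) = absz (denq (nth 0%R d i)).
Proof.
move=> hi; have hs := size_tuple d.
have key r : r < 2 -> inp (4 + (2 * i + r)) =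
    nth 0 [:: absz (numq (nth 0%R d i)); absz (denq (nth 0%R d i))] r.
  move=> hr; rewrite inp_tail nth_cat size_rats hs ifT; last by lia.
  by rewrite (@nth_flatten_const _ _ _ 2 _ 0%R) // hs.
have := key 0 isT; have := key 1 isT; rewrite /= => <- <-.
by split; congr (inp _); lia.
Qed.

Lemma inp_wait (v : vertex G) : inp (18 + enum_rank v) = minwait v /\
  inp (18 + V + enum_rank v) = maxwait v.
Proof.
have hv : enum_rank v < V by [].
have hs := size_tuple d.
split.
  rewrite (_ : 18 + _ = 4 + (14 + enum_rank v)) // inp_tail.
  rewrite nth_cat size_rats hs [(_ < _)](_ : _ = false); last by lia.
  rewrite nth_cat size_map size_enum ifT; last by lia.
  rewrite (nth_map v) ?size_enum; last by lia.
  by rewrite (_ : _ - _ = enum_rank v) ?nth_enum_rank //; lia.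
rewrite (_ : 18 + V + _ = 4 + (14 + V + enum_rank v)) // inp_tail.
rewrite nth_cat size_rats hs [(_ < _)](_ : _ = false); last by lia.
rewrite nth_cat size_map size_enum ifF; last by lia.
rewrite nth_cat size_map size_enum ifT; last by lia.
rewrite (nth_map v) ?size_enum; last by lia.
by rewrite (_ : _ - _ = enum_rank v) ?nth_enum_rank //; lia.
Qed.

Lemma inp_arc e k : e \in es -> k < 5 ->
  inp (13 + k + V.*2 + 5 * handle e) = nth 0 (encode_arc c e) k.
Proof.
move=> he hk; have hi : index e es < E by rewrite index_mem.
have hs := size_tuple d.
rewrite /handle (_ : 13 + _ + _ + _ = 4 + (14 + V.*2 + 5 * index e es + k));
  last by lia.
rewrite inp_tail.
rewrite nth_cat size_rats hs [(_ < _)](_ : _ = false); last by lia.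
rewrite nth_cat size_map size_enum ifF; last by lia.
rewrite nth_cat size_map size_enum ifF; last by lia.
rewrite (_ : _ - _ = 5 * index e es + k); last by lia.
by rewrite (@nth_flatten_const _ _ _ 5 _ e) // nth_index.
Qed.

Hypothesis es_uniq : uniq es.

Lemma arcP x : arc E x -> exists2 e, e \in es & x = handle e.
Proof.
move=> /andP[x0 xE]; have hx : x.-1 < size es by rewrite -/E; lia.
have [e0 _] : exists e : time_arc G, True.
  by case: (es) hx => [//|e l] _; exists e.
exists (nth e0 es x.-1); first exact: mem_nth.
by rewrite /handle index_uniq //; lia.
Qed.

Lemma handle_arc e : e \in es -> arc E (handle e).
Proof. by rewrite -index_mem /arc /handle -/E. Qed.

Lemma inp_max i : inp i <= size w + \max_(x <- w) x.
Proof.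
have [h|h] := ltnP i (size w); last by rewrite /inp nth_default.
apply: leq_trans (leq_addl _ _).
by rewrite (big_nth 0) big_mkord; exact: (leq_bigmax (Ordinal h)).
Qed.

Notation gsrc := (isrc inp V).
Notation gdst := (idst inp V).
Notation gdep := (idep inp V).
Notation gdur := (idur inp V).
Notation gal := (ial inp).
Notation gbe := (ibe inp V).

Lemma handle_data e : e \in es ->
  [/\ gsrc (handle e) = enum_rank (asrc e), gdst (handle e) = enum_rank (adst
    e),
      gdep (handle e) = dep e, gdur (handle e) = dur e
    & icst inp V (handle e) = c e].
Proof.
move=> he; split; [exact: (inp_arc (k := 0) he isT)
 |exact: (inp_arc (k := 1) he isT)|exact: (inp_arc (k := 2) he isT)
 |exact: (inp_arc (k := 3) he isT)|exact: (inp_arc (k := 4) he isT)].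
Qed.

Lemma handle_art e : e \in es -> art gdep gdur (handle e) = arr e.
Proof. by case/handle_data => _ _ h1 h2 _; rewrite /art h1 h2. Qed.

Lemma handle_lnk e f : e \in es -> f \in es ->
  lnk gsrc gdst gdep gdur gal gbe (handle e) (handle f) = link e f.
Proof.
move=> he hf; have [_ h1 _ _ _] := handle_data he.
have [h2 _ h3 _ _] := handle_data hf.
rewrite /lnk /link /act (handle_art he) h1 h2 h3.
rewrite /ial /ibe (inp_wait (adst e)).1 (inp_wait (adst e)).2.
by rewrite (inj_eq (@ord_inj _)) (inj_eq enum_rank_inj).
Qed.

End Encoding.

Lemma dvdz_iden inp l i : i \in l -> ((inp (5 + i.*2))%:Z %| iden inp l)%Z.
Proof.
elim: l => [//|k l IH]; rewrite inE /iden /= => /orP[/eqP ->|/IH h].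
  exact: dvdz_mulr.
exact: dvdz_mull.
Qed.

Lemma iden_gt0 inp l : (forall i, i \in l -> 0 < inp (5 + i.*2)) ->
  (0 < iden inp l)%R.
Proof.
elim: l => [//|k l IH] h; rewrite /iden /= mulr_gt0 //.
  by rewrite ltz_nat; apply: h; rewrite inE eqxx.
by apply: IH => i hi; apply: h; rewrite inE hi orbT.
Qed.

Section Correctness.
Variables (G : temporal_graph) (c : time_arc G -> nat) (d : 7.-tuple rat).
Variables (s : vertex G) (es : seq (time_arc G)).
Hypothesis d_ge0 : forall i : 'I_7, (0 <= tnth d i)%R.
Hypothesis es_uniq : uniq es.
Hypothesis es_arcs : es =i arcs G.
Let w := encode_input c d s es.
Let inp i := nth 0 w i.
Let V := #|vertex G|.
Let E := size es.

Notation gsrc := (isrc inp V).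
Notation gdst := (idst inp V).
Notation gdep := (idep inp V).
Notation gdur := (idur inp V).
Notation gal := (ial inp).
Notation gbe := (ibe inp V).
Notation gcA := (icA inp).
Notation gcB := (icB inp).
Notation gwt := (iwt inp V (iw1 inp) (iDelta inp 4) (iDelta inp 5)).
Notation hdl := (handle es).
Notation ginv := (inv E (enum_rank s) gsrc gdst gdep gdur gal gbe gwt gcA gcB).
Notation gchain := (chain E (enum_rank s) gsrc gdst gdep gdur gal gbe gwt gcB).
Notation gsrcval := (srcval gdep gcB).

Lemma d_nth_ge0 i : i < 7 -> (0 <= nth 0%R d i)%R.
Proof. by move=> hi; have := d_ge0 (Ordinal hi); rewrite (tnth_nth 0%R). Qed.

Lemma iD_gt0 : (0 < iD inp)%R.
Proof.
apply: iden_gt0 => i; rewrite mem_iota add0n => /andP[_ hi].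
have [_ h2] := inp_rat c d s es hi.
by rewrite [inp _]h2 absz_gt0 denq_neq0.
Qed.

Lemma iDeltaE i : i < 7 ->
  ((iDelta inp i)%:~R = (iD inp)%:~R * nth 0 d i :> rat)%R.
Proof.
move=> hi; have [h1 h2] := inp_rat c d s es hi.
have : ((inp (5 + i.*2))%:Z %| iD inp)%Z by apply: dvdz_iden; rewrite mem_iota.
rewrite /iDelta [inp (4 + _)]h1 [inp (5 + _)]h2; case/dvdzP => q hq.
set x := nth 0%R d i in hq *.
have dn : (absz (denq x))%:Z = denq x by rewrite absz_denq.
(* The input stores absolute values of numerators; the nonnegativity of the coefficients makes this
   faithful. *)
have nn : (absz (numq x))%:Z = numq x.
  by apply: gez0_abs; rewrite numq_ge0; apply: d_nth_ge0.
rewrite dn in hq *; rewrite nn hq mulrA mulzK ?denq_neq0 //.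
have hx : (x * (denq x)%:~R = (numq x)%:~R)%R.
  by rewrite -{1}(divq_num_den x) divfK // intr_eq0 denq_neq0.
by rewrite !intrM -hx; ring.
Qed.

Lemma iDelta_ge0 i : i < 7 -> (0 <= iDelta inp i)%R.
Proof.
move=> hi; have h0 : (0 <= (iD inp)%:~R :> rat)%R by rewrite ler0z ltW //
  iD_gt0.
by rewrite -(ler0z rat) iDeltaE // mulr_ge0 // d_nth_ge0.
Qed.

(** With transmission time 0 the only possibly negative coefficient drops out. *)
Lemma iwt_ge0 x : arc E x -> gdur x = 0 -> (0 <= gwt x)%R.
Proof.
move=> _ h0; rewrite /iwt h0 mulr0 add0r addr_ge0 ?iDelta_ge0 //.
by rewrite mulr_ge0 ?iDelta_ge0.
Qed.

(** The scaled value of a walk without the term A times its arrival time. That term depends only on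
    the last arc, so walks with the same last arc are compared by [gval] alone. *)
Definition gval e p : int :=
  (gsrcval (hdl e) + \sum_(f <- e :: p) gwt (hdl f))%R.

Lemma wait_telescope (e x0 : time_arc G) p :
  (\sum_(i < size p) ((dep (nth x0 (e :: p) i.+1))%:R
      - (arr (nth x0 (e :: p) i))%:R) =
   (arr (last e p))%:R - (dep e)%:R - \sum_(f <- e :: p) (dur f)%:R :> rat)%R.
Proof.
elim: p e => [|f p IH] e.
  by rewrite big_ord0 big_seq1 /= /arr natrD; ring.
rewrite big_ord_recl big_cons [last _ _]/=.
have -> := IH f; rewrite [nth _ _ _]/= [nth _ _ _]/= /arr natrD; ring.
Qed.

Lemma sum_iwt u1 u2 u3 (P : seq (time_arc G)) : {subset P <= es} ->
  ((\sum_(f <- P) iwt inp V u1 u2 u3 (hdl f))%:~R =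
   u1%:~R * (\sum_(f <- P) (dur f)%:R) + u2%:~R * (\sum_(f <- P) (c f)%:R)
   + u3%:~R * (size P)%:R :> rat)%R.
Proof.
elim: P => [|f q IH] hs; first by rewrite !big_nil !mulr0 !addr0.
have hf : f \in es by apply: hs; rewrite inE eqxx.
have [_ _ _ h1 h2] := handle_data c d s hf.
rewrite !big_cons intrD IH; last by move=> x hx; apply: hs; rewrite inE hx orbT.
rewrite /iwt [gdur _]h1 [icst _ _ _]h2 !intrD !intrM -!pmulrn.
have -> : ((size (f :: q))%:R = (size q)%:R + 1 :> rat)%R by rewrite /= -natr1.
by ring.
Qed.

Lemma walk_valueE e p : {subset e :: p <= es} ->
  ((iD inp)%:~R * walk_value c d (e :: p) =
   (gval e p + gcA * (arr (last e p))%:Z)%:~R :> rat)%R.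
Proof.
move=> hs; rewrite /walk_value wait_telescope /gval 2!intrD sum_iwt //.
have he : e \in es by apply: hs; rewrite inE eqxx.
have [_ _ h3 _ _] := handle_data c d s he.
have eA : ((icA inp)%:~R = (iD inp)%:~R * (d`_0 + d`_2 + d`_6) :> rat)%R.
  by rewrite /icA 2!intrD !iDeltaE //; ring.
have eB : ((icB inp)%:~R = (iD inp)%:~R * (d`_1 + d`_2 + d`_6) :> rat)%R.
  by rewrite /icB 2!intrD !iDeltaE //; ring.
have e1 : ((iw1 inp)%:~R = (iD inp)%:~R * (d`_3 - d`_6) :> rat)%R.
  by rewrite /iw1 intrB !iDeltaE //; ring.
have e2 : ((gcA * (arr (last e p))%:Z)%:~R =
    (icA inp)%:~R * (arr (last e p))%:R :> rat)%R by rewrite intrM -pmulrn.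
have e3 : ((gsrcval (hdl e))%:~R = - (icB inp)%:~R * (dep e)%:R :> rat)%R.
  by rewrite /srcval [gdep _]h3 intrM -pmulrn mulrNz.
rewrite e2 e3 eA eB e1 !iDeltaE //.
by ring.
Qed.

Lemma gval_rcons e p f : gval e (rcons p f) = (gval e p + gwt (hdl f))%R.
Proof. by rewrite /gval -rcons_cons big_rcons /= addrA. Qed.

(** Read backwards, a chain is a walk; this gives the half of optimality that the computed value is
    attained. *)
Lemma chain_walk a e l : e \in es -> gchain a (hdl e) l -> exists e1 p,
  [/\ last e1 p = e, temporal_walk s (adst e) (e1 :: p),
      gval e1 p = kv a (hdl e)
    & hdl e :: l = rev [seq hdl f | f <- e1 :: p]].
Proof.
elim: l e => [|y l IH] e he /= [ae se].
  move=> [h1 h2 h3]; exists e, [::]; split=> //.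
    rewrite /temporal_walk /= -es_arcs he eqxx !andbT /=.
    have [h4 _ _ _ _] := handle_data c d s he.
    move: h2; rewrite [gsrc _]h4 => /ord_inj /enum_rank_inj ->; exact: eqxx.
  by rewrite /gval big_seq1 h3.
move=> [h1 h2 h3 h4].
have ay : arc E y by case: (l) h4 => [|? ?] [].
have [f hf ey] := arcP es_uniq ay.
rewrite ey in h2 h3 h4.
have [e1 [p [g1 g2 g3 g4]]] := IH f hf h4.
exists e1, (rcons p e); split.
- by rewrite last_rcons.
- move: g2; rewrite /temporal_walk => /and4P[k1 k2 k3 k4].
  move: k1 => /= /andP[k0 k1]; rewrite k0 all_rcons k1 /= -es_arcs he k2.
  by rewrite last_rcons eqxx rcons_path k4 g1 -(handle_lnk c d s hf he) h2.
- by rewrite gval_rcons g3 h3.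
- by rewrite ey g4 /= map_rcons !rev_cons rev_rcons.
Qed.

Lemma chain_list st a j u i cA' cB' w1 w2 w3 x l :
  rep inp V E cA' cB' w1 w2 w3 st a j u i ->
  (forall x, arc E x -> settled a x -> idx a x = x.-1) ->
  gchain a x l -> list_at (memory st) (cellz V E x) [seq y.-1 | y <- x :: l].
Proof.
move=> R hidx; have [_ hm] := rep_mem R.
elim: l x => [|y l IH] x /= [ax sx].
{ move=> [h1 _ _]; have x0 : (x == 0) = false by move: ax; rewrite /arc; lia.
  rewrite /cellz x0; constructor.
  * by apply/eqP; rewrite /addr /=; lia.
  * by rewrite hm //= hidx.
  * have -> : (addr V E 5 x + 1)%R = addr V E 4 x by rewrite /addr /=; lia.
    by rewrite hm //= h1 /cellz; constructor. }
move=> [h1 _ _ h4]; have x0 : (x == 0) = false by move: ax; rewrite /arc; lia.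
rewrite /cellz x0; constructor.
+ by apply/eqP; rewrite /addr /=; lia.
+ by rewrite hm //= hidx.
+ have -> : (addr V E 5 x + 1)%R = addr V E 4 x by rewrite /addr /=; lia.
  by rewrite hm //= h1; apply: IH.
Qed.

(** The other half of optimality: no walk beats the computed value of its last arc, since each link
    adds one inequality of [final_settled]. *)
Lemma walk_settled a t0 x0 z e p : ginv t0 x0 a ->
  (forall x, arc E x -> 3 < stt a x) -> temporal_walk s z (e :: p) ->
  settled a (hdl (last e p)) /\ (kv a (hdl (last e p)) <= gval e p)%R.
Proof.
move=> H hfin; have [hs hl] := final_settled H hfin.
elim/last_ind: p z => [|p f IH] z.
  move=> /and4P[/andP[he _] h1 _ _]; rewrite -es_arcs in he.
  have [h4 _ _ _ _] := handle_data c d s he.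
  have hsrc : gsrc (hdl e) = enum_rank s by rewrite [gsrc _]h4 (eqP h1).
  have [k1 k2] := hs _ (handle_arc he) hsrc.
  by split=> //; rewrite /gval big_seq1.
rewrite /temporal_walk -rcons_cons all_rcons last_rcons rcons_path.
move=> /and4P[/andP[hf k1] k2 _ /andP[k3 k4]].
have hw : temporal_walk s (adst (last e p)) (e :: p).
  by rewrite /temporal_walk k1 k2 eqxx k3.
have [g1 g2] := IH _ hw.
have hle : last e p \in es by rewrite es_arcs; apply: (allP k1);
  apply: mem_last.
have hf' : f \in es by rewrite es_arcs.
have hlk := k4; rewrite -(handle_lnk c d s hle hf') in hlk.
have [g3 g4] := hl _ _ (handle_arc hle) (handle_arc hf') g1 hlk.
by split=> //; rewrite gval_rcons; apply: le_trans g4 _; rewrite lerD2r.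
Qed.

Lemma walk_subset z P : temporal_walk s z P -> {subset P <= es}.
Proof.
case: P => [//|e p] /and4P[h _ _ _] x hx; rewrite es_arcs.
exact: (allP h).
Qed.

Lemma outputs_correct st a j u i t0 x0 w1 w2 w3 :
  rep inp V E gcA gcB w1 w2 w3 st a j u i -> ginv t0 x0 a ->
  (forall x, arc E x -> 3 < stt a x) -> outputs_optimal_walks c d s es st.
Proof.
move=> R H hfin z; set adr := memory _ _.
have ea : adr = cellz V E (best a (enum_rank z)).
  rewrite /adr; have [-> _ _ _] := rep_cst R.
  have -> : ((base V E)%:Z + (enum_rank z)%:Z)%R = addr V E 16 (enum_rank z) by
    [].
  by rewrite (rep_mem R).2.
cbv zeta; rewrite ea.
have main : best a (enum_rank z) <> 0 -> exists P, optimal_walk c d s z P /\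
    list_at (memory st) (cellz V E (best a (enum_rank z)))
      [seq index e es | e <- rev P].
  move=> hb; have [g1 g2 g3 g4] := i_best H hb.
  have [e he ee] := arcP es_uniq g1; rewrite ee in g1 g2 g3 g4 *.
  have [l hl] := i_chain H g1 g2.
  have [e1 [p [h1 h2 h3 h4]]] := chain_walk he hl.
  have [_ h5 _ _ _] := handle_data c d s he.
  have ez : adst e = z.
    by move: g3; rewrite [gdst _]h5 => /ord_inj /enum_rank_inj.
  rewrite ez in h2.
  exists (e1 :: p); split; last first.
    have := chain_list R (i_idx H) hl.
    by rewrite h4 -map_rev -map_comp; apply.
  split=> // Q hQ; case: Q hQ => [//|f q] hQ.
  have [k1 k2] := walk_settled H hfin hQ.
  have hfs := walk_subset hQ; have hes := walk_subset h2.
  have hlast : last f q \in es by apply: hfs; apply: mem_last.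
  have dl : gdst (hdl (last f q)) = enum_rank z.
    have [_ -> _ _ _] := handle_data c d s hlast.
    by move: hQ => /and4P[_ _ /eqP -> _].
  have k3 := g4 _ (handle_arc hlast) k1 dl.
  have D0 : (0 < (iD inp)%:~R :> rat)%R by rewrite ltr0z iD_gt0.
  rewrite -(ler_pM2l D0) !walk_valueE // ler_int h1 h3.
  move: k3; rewrite /outval [art _ _ _](handle_art c d s he).
  rewrite [art _ _ (hdl (last f q))](handle_art c d s hlast) => k3.
  by apply: le_trans k3 _; rewrite lerD2r.
split.
  case=> Q; case: Q => [//|f q] hQ; apply: main.
  have [k1 _] := walk_settled H hfin hQ.
  have hlast : last f q \in es by apply: (walk_subset hQ); apply: mem_last.
  have [_ dl _ _ _] := handle_data c d s hlast.
  have := i_best0 H (handle_arc hlast) k1.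
  rewrite [gdst _]dl.
  by move: hQ => /and4P[_ _ /eqP -> _].
move=> hno; have [->//|/eqP hb] := eqVneq (best a (enum_rank z)) 0.
by have [P [[hP _] _]] := main hb; have := hno P; rewrite hP.
Qed.

End Correctness.

(** * Word size and running time *)

Lemma square_bound M : 18 <= M -> 18 * M <= M ^ 12.
Proof.
move=> M_ge18; rewrite (expnS M 11) mulnC leq_mul2l; apply/orP; right.
have M_gt1 : 1 < M by lia.
by apply: leq_trans M_ge18 _; rewrite -{1}(expn1 M) leq_exp2l.
Qed.

(** Origin of the exponent 12: a weight is at most 4 M^9, at most 7 M of them accumulate, and 28
    M^10 <= M^12. *)
Lemma value_bound M E : 18 <= M -> E <= M -> 4 * M ^ 9 * (6 * E.+1).+2 <= M ^
  12.
Proof.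
move=> M_ge18 EM; apply: leq_trans (_ : 4 * M ^ 9 * (7 * M) <= _);
  first by rewrite leq_mul2l; lia.
rewrite (expnD M 9 3) -mulnA mulnCA leq_mul2l; apply/orP; right.
by rewrite (expnS M 2) mulnA mulnC leq_mul2l (expnS M 1) expn1; nia.
Qed.

Section WordBounds.
Variables (inp : nat -> nat) (M V : nat).
Hypothesis inpM : forall i, inp i <= M.
Hypothesis M_ge18 : 18 <= M.

(** The transmission time contributes 2 M^9, as its coefficient is a difference; the cost
    contributes M^9, the hop count M^8. *)
Lemma iwt_bound x :
  absz (iwt inp V (iw1 inp) (iDelta inp 4) (iDelta inp 5) x) <= 4 * M ^ 9.
Proof.
rewrite /iwt /iw1; move: (inpM (16 + V.*2 + 5 * x)) (inpM (17 + V.*2 + 5 * x)).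
rewrite -/(idur inp V x) -/(icst inp V x);
  move: (idur _ _ x) (icst _ _ x) => p q hp hq.
have h3 := absz_iDelta inpM 3; have h4 := absz_iDelta inpM 4.
have h5 := absz_iDelta inpM 5; have h6 := absz_iDelta inpM 6.
rewrite (expnS M 8); move: (M ^ 8) h3 h4 h5 h6 => P h3 h4 h5 h6.
have k1 : absz ((iDelta inp 3 - iDelta inp 6) * p%:Z)%R <= (P + P) * M.
  by rewrite abszM; apply: leq_mul => //; lia.
have k2 : absz (iDelta inp 4 * q%:Z)%R <= P * M.
  by rewrite abszM; apply: leq_mul.
have k3 : P <= P * M by rewrite leq_pmulr //; lia.
have k4 : (P + P) * M = P * M + P * M by rewrite mulnDl.
have k5 : 4 * (M * P) = 4 * (P * M) by rewrite (mulnC M).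
move: (_ * _)%R (_ * _)%R k1 k2 => y1 y2; lia.
Qed.

Lemma srcval_bound x : absz (srcval (idep inp V) (icB inp) x) <= 4 * M ^ 9.
Proof.
rewrite /srcval /icB; move: (inpM (15 + V.*2 + 5 * x)).
rewrite -/(idep inp V x); move: (idep _ _ x) => p hp.
have h1 := absz_iDelta inpM 1; have h2 := absz_iDelta inpM 2.
have h6 := absz_iDelta inpM 6.
rewrite (expnS M 8) abszM (mulnC M) mulnA.
by apply: leq_mul => //; lia.
Qed.

Lemma act_bound x :
  (act (idst inp V) (idep inp V) (idur inp V) (ial inp) x).*2.+1 <= M ^ 12.
Proof.
apply: leq_trans (square_bound M_ge18); rewrite /act /art.
have := inpM (15 + V.*2 + 5 * x); have := inpM (16 + V.*2 + 5 * x).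
have := inpM (18 + idst inp V x).
rewrite -/(idep inp V x) -/(idur inp V x) -/(ial inp (idst inp V x)); lia.
Qed.
End WordBounds.

(** Here n = |E|, and l is its logarithm. For n <= 1 the product n * l vanishes and v >= 1 pays. The
    factor 7 comes from the at most 6 (n + 1) steps and the final test, the factor 8 from comparing
    (n + 1)(l + 3) with v + n l. *)
Lemma time_bound c0 a1 a2 a3 a4 b1 b2 v n l : 0 < v ->
  (n = 0 -> l = 0) -> (1 < n -> 0 < l) ->
  c0 + (n.+1 * (a1 + (a2 + (b1 + l.+2 * b2))).+1 +
    (6 * n.+1).+1 * (a3 + (a4 + (b1 + l.+2 * b2))).+1) <=
  8 * (c0 + (a1 + a2 + b1 + b2).+1 + 7 * (a3 + a4 + b1 + b2).+1) * (v + n * l).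
Proof.
move=> hv hl0 hl; have hS : n.+1 * l.+3 <= 8 * (v + n * l).
  case: n hl hl0 => [|[|n]] hl hl0; [by rewrite hl0 //; lia|by lia|].
  by have := hl isT; nia.
set S := n.+1 * l.+3 in hS.
have one a a' : a + (a' + (b1 + l.+2 * b2)) < l.+3 * (a + a' + b1 + b2).+1.
  by rewrite !mulnS !mulnDr !mulSn; lia.
apply: leq_trans (_ : S * (c0 + (a1 + a2 + b1 + b2).+1
    + 7 * (a3 + a4 + b1 + b2).+1) <= _); last first.
  by rewrite [leqRHS]mulnAC leq_mul2r hS orbT.
rewrite 2!mulnDr -addnA; apply: leq_add; first by rewrite leq_pmull // muln_gt0.
apply: leq_add; first by rewrite -mulnA leq_mul2l one.
rewrite mulnCA -mulnA mulnA; apply: leq_mul; [by lia|exact: one].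
Qed.

Definition time_const :=
  8 * (ccost preC + (cost (eLt rU nE) + ccost insertC + ccost leafC
     + (cost (eLe (c_ 2) rI) + ccost climbC).+1).+1
   + 7 * (cost (eTr (c_ 1)) + ccost phaseC + ccost leafC
     + (cost (eLe (c_ 2) rI) + ccost climbC).+1).+1).

Theorem theorem1 :
  exists (prog : cmd) (C K : nat),
  forall (G : temporal_graph) (c : time_arc G -> nat) (d : 7.-tuple rat)
         (s : vertex G) (es : seq (time_arc G)),
    (forall i : 'I_7, (0 <= tnth d i)%R) ->
    uniq es -> es =i arcs G ->
    let w := encode_input c d s es in
    exists (n : nat) (st : state),
      [/\ exec (word_bound K w) prog (init_state w) n st,
          n <= C * (#|vertex G| + #|arcs G| * trunc_log 2 #|arcs G|)
        & outputs_optimal_walks c d s es st].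
Proof.
(* Stored values stay below M^12, and expressions of degree at most [cdeg prog] in them give K. *)
exists prog, time_const, (12 * cdeg prog).
move=> G c d s es d0 eu ea w.
pose inp i := nth 0 w i; pose V := #|vertex G|; pose E := size es.
pose M := size w + \max_(x <- w) x.
have cardE' : #|arcs G| = E by rewrite -(eq_card ea) (card_uniqP eu).
have sw : size w = 18 + V.*2 + 5 * E := size_encode c d s es.
have inpM i : inp i <= M := inp_max c d s es i.
have M18 : 18 <= M by rewrite /M sw; lia.
have bM : 18 + V.*2 + 5 * E <= M by rewrite /M sw leq_addr.
have EM : E <= M by lia.
have V0 : 0 < V by rewrite /V; apply/card_gt0P; exists s.
have M0 : 0 < M by lia.
set X := M ^ 12; have sqX : 18 * M <= X := square_bound M18.
have X1 : 1 < X by lia.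
have XE : 16 * E + 16 <= X by lia.
have XN : 6 * E.+1 < X by lia.
have rV (v : vertex G) : enum_rank v < V by [].
have srcV x : arc E x -> isrc inp V x < V.
  by move=> /(arcP eu) [e he ->]; have [-> _ _ _ _] := handle_data c d s he.
have dstV x : arc E x -> idst inp V x < V.
  by move=> /(arcP eu) [e he ->]; have [_ -> _ _ _] := handle_data c d s he.
pose k0 := (trunc_log 2 E).+1.
have hk0 : E < 2 ^ k0 by rewrite /k0; apply: trunc_log_ltn.
have hdeg : deg_le (cdeg prog) by split; exact: leq_maxr.
pose a0 := AState (fun=> 0) (fun=> 0) (fun=> 0%R) (fun=> 0) (fun=> 0) (fun=> 0)
  (fun=> 0) (fun=> 0) (fun _ _ => 0) (fun=> 0) (fun _ _ => 0) (fun=> 0)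
  (fun=> 0) (fun=> 0).
have hrun : runs X (cdeg prog) prog (init_state w)
    (ccost preC + (E.+1 * (cost (eLt rU nE) + (ccost insertC + tree_time k0)).+1
     + (6 * E.+1).+1 * (cost (eTr (c_ 1)) + (ccost phaseC + tree_time k0)).+1))
    (fun st => outputs_optimal_walks c d s es st).
{ apply: runs_seq; apply: runs_wp; [exact: X1|exact: leq_maxl|].
  apply: (wp_pre (inp := inp) inpM M18) => // st hm hr hc.
  have R : rep inp V E (icA inp) (icB inp) (iw1 inp) (iDelta inp 4)
      (iDelta inp 5) st a0 0 0 0.
    split; [|exact: hr|exact: hr|exact: hr|exact: hc].
    split=> [i hi|r i hr16]; rewrite hm //.
    rewrite /addr; case: eqP => [->|_].
      (* The output table lies beyond the input, where the memory is 0, the code for no walk. *)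
      have hn : nth 0 w (base V E + i) = 0 by rewrite nth_default // sw
        leq_addr.
      by rewrite -[memory _ _]/((nth 0 w (base V E + i))%:Z) hn.
    have -> : (- (16 * i + r.+1)%:Z)%R = Negz (16 * i + r) by rewrite NegzE;
      lia.
    by do 17?[case: r hr16 => [|r] hr16 //].
  have hf : fresh inp V 0 a0 by split=> // x; lia.
  have := runs_loops (W := 4 * M ^ 9) (N0 := 6 * E.+1) (erefl : inp 0 = V)
    (erefl : inp 2 = E) (erefl : inp 3 = enum_rank s) srcV dstV (X := X)
    XE _ XN _ _ _ X1 hdeg (iwt_ge0 d0) R hf
    (fun _ => erefl _) (erefl _) hk0.
  move=> hloop; apply: runs_mono (leqnn _) _ (hloop _ _ _ _).
  - by move=> st' [a [j [u [i [t0 [x0 [R' H hfin]]]]]]];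
      apply: outputs_correct R' H hfin.
  - by move=> x _; apply: act_bound.
  - exact: value_bound.
  - by move=> x _; apply: iwt_bound.
  - by move=> x _; apply: srcval_bound. }
have hb : bounded X (init_state w).
  split=> [r|[i|i]] //=.
  by apply: leq_trans (inpM i) _; lia.
have [n [st [h1 h2 _ h4]]] := hrun hb.
exists n, st; split; [by rewrite /word_bound -/M expnM| |exact: h4].
apply: leq_trans h2 _; rewrite cardE'.
apply: time_bound => // [->//|E1]; by rewrite trunc_log_gt0; lia.
Qed.
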